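(* Assume that every $\pi\in\Pi$ satisfies the structural condition (Q) below and that the associated matrices $(A_\pi,R_\pi,S_\pi)_{\pi\in\Pi}$ satisfy the continuity condition (K) below. Let $\pi\in\Pi$. For any $x\in\mathbb{R}^r$, $Q\in\mathbb{S}_r^+$, $s\ge0$ and $t\ge s+\upsilon$ we have the almost sure estimate $$\begin{aligned}\mathbb{W}_2\left[\eta^\pi_{s,t}(x,Q),\eta_{s,t}(x,Q)\right]^2\le{}&\Vert\psi^\pi_{s,t}(x,Q)-\psi_{s,t}(x,Q)\Vert_2^2+\mathrm{tr}\left[\phi^\pi_{s,t}(Q)-\phi_{s,t}(Q)\right]\\&+4r\left[\varpi^c_+(\mathcal{O})+\frac1{\varpi^o_-}\right]\left[\varpi^o_+(\mathcal{C})+\frac1{\varpi^c_-}\right]\Vert\phi^\pi_{s,t}(Q)-\phi_{s,t}(Q)\Vert_2 .\end{aligned}$$ In addition, for any $n\ge1$ and any $t\ge s+\upsilon$, almost surely $$\mathbb{W}_{2n}\left[\eta_{s,t}(x,Q),\eta^\pi_{s,t}(x,Q)\right]\le\Vert\psi_{s,t}(x,Q)-\psi^\pi_{s,t}(x,Q)\Vert_2+\sqrt{\frac{rn}2}\left(\varpi^o_+(\mathcal{C})+\frac1{\varpi^c_-}\right)^{1/2}\Vert\phi_{t-s}(Q)-\phi^\pi_{t-s}(Q)\Vert_2\;e^{\frac12+\frac3{4n}} .$$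
   Context: Notation: $\mathbb{M}_r$ = real $r\times r$ matrices, $\mathbb{S}_r^+\subset\mathbb{S}_r$ = symmetric positive semi-definite (resp. symmetric) matrices, $\le$ = Loewner order, $'$ = transpose, $\Vert\cdot\Vert_2$ = Euclidean/spectral norm. $\mathbb{W}_n(\nu_1,\nu_2)=\inf\mathbb{E}(\Vert Z_1-Z_2\Vert_2^n)^{1/n}$ over couplings with $\mathrm{Law}(Z_i)=\nu_i$. Standing setting: $A\in\mathbb{M}_r$, $C$ is a real $r'\times r$ matrix, $R\in\mathbb{S}_r^+$ and $\Sigma\in\mathbb{S}_{r'}^+$ are positive definite, $S:=C'\Sigma^{-1}C$; $(A,R^{1/2})$ is controllable and $(A,C)$ is observable. Signal/observation: $dX_t=AX_t\,dt+R^{1/2}dW_t$, $dY_t=CX_t\,dt+\Sigma^{1/2}dV_t$, $Y_0=0$, with $(W,V)$ a standard Brownian motion independent of the Gaussian vector $X_0$. $\mathrm{Ricc}(Q)=AQ+QA'-QSQ+R$ with flow $\phi_t$ ($\phi_0(Q)=Q$), $\phi_{s,t}:=\phi_{t-s}$. Gramian constants: $\mathcal{O}_t:=\int_0^te^{-A's}Se^{-As}ds$, $\mathcal{C}_t:=\int_0^te^{As}Re^{A's}ds$, $\mathcal{C}_t(\mathcal{O}):=\mathcal{O}_t^{-1}\left[\int_0^te^{-(t-s)A'}\mathcal{O}_sR\mathcal{O}_se^{-(t-s)A}ds\right]\mathcal{O}_t^{-1}$, $\mathcal{O}_t(\mathcal{C}):=\mathcal{C}_t^{-1}\left[\int_0^te^{(t-s)A}\mathcal{C}_sS\mathcal{C}_se^{(t-s)A'}ds\right]\mathcal{C}_t^{-1}$;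 $\upsilon>0$ and the positive constants are fixed with $\varpi^c_-Id\le\mathcal{C}_\upsilon$, $\varpi^o_-Id\le\mathcal{O}_\upsilon$, $\mathcal{C}_\upsilon(\mathcal{O})\le\varpi^c_+(\mathcal{O})Id$, $\mathcal{O}_\upsilon(\mathcal{C})\le\varpi^o_+(\mathcal{C})Id$. $\Pi$ is a compact subset of the set of continuous mappings $\pi:\mathbb{S}_r^+\to\mathbb{S}_r^+$ with the uniform norm $\Vert\pi_1-\pi_2\Vert=\sup_{Q}\Vert\pi_1(Q)-\pi_2(Q)\Vert_2$; $B(\delta):=\{\pi\in\Pi:\Vert\pi-\mathrm{id}\Vert\le\delta\}$. For $\pi\in\Pi$, $\phi^\pi_t(Q)$ is the flow (assumed uniquely defined) of $\partial_tP_t=[A-\pi(P_t)S]P_t+P_t[A-\pi(P_t)S]'+R+\pi(P_t)S\pi(P_t)=\mathrm{Ricc}(P_t)+\Gamma_\pi(P_t)$, where $\Gamma_\pi(Q)=(\pi(Q)-Q)S(\pi(Q)-Q)$; $\phi^\pi_{s,t}:=\phi^\pi_{t-s}$. Condition (Q): $\Gamma_\pi(Q)=B_0+B_1Q+QB_1'+QB_2Q+\mathcal{R}(Q)$ for all $Q\in\mathbb{S}_r^+$, for some $B_0,B_1,B_2\in\mathbb{S}_r$ with $B_2\le S$ and a symmetric remainder with $\varpi:=\sup_{Q}\Vert\mathcal{R}(Q)\Vert_2<\infty$ (all depending on $\pi$). Then set $A_\pi:=A+B_1$, $R_\pi:=R+B_0+\varpi Id$, $S_\pi:=S-B_2$.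 Condition (K): for all $\epsilon\in\,]0,1]$, $\alpha\in\,]0,1[$ there is $\delta>0$ such that for all $\pi\in B(\delta)$: $\alpha S\le S_\pi\le\alpha^{-1}S$, $\alpha R\le R_\pi\le\alpha^{-1}R$ and $\Vert A-A_\pi\Vert_2\le\epsilon$. Filters: for $t\ge s$, $\psi_{s,t}(x,Q)$ solves $d\psi_{s,t}=A\psi_{s,t}\,dt+\phi_{s,t}(Q)C'\Sigma^{-1}(dY_t-C\psi_{s,t}\,dt)$, $\psi_{s,s}=x$; $\psi^\pi_{s,t}(x,Q)$ solves the same equation with $\phi_{s,t}(Q)$ replaced by $\pi(\phi^\pi_{s,t}(Q))$. Conditional laws: $\eta_{s,t}(x,Q)$, resp. $\eta^\pi_{s,t}(x,Q)$, is the conditional law, given $\sigma(Y_u,s\le u\le t)$, of the nonlinear Kalman-Bucy diffusion $d\overline X_t=A\overline X_t\,dt+R^{1/2}d\overline W_t+G_tC'\Sigma^{-1}[dY_t-(C\overline X_t\,dt+\Sigma^{1/2}d\overline V_t)]$ (with $(\overline W,\overline V)$ an independent copy of $(W,V)$) started at time $s$ with mean $x$ and covariance $Q$ (Gaussian), with $G_t=\phi_{s,t}(Q)$, resp. $G_t=\pi(\phi^\pi_{s,t}(Q))$. These are the Gaussian distributions with mean $\psi_{s,t}(x,Q)$ and covariance $\phi_{s,t}(Q)$, resp. mean $\psi^\pi_{s,t}(x,Q)$ and covariance $\phi^\pi_{s,t}(Q)$. *)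

(* Defs.v *)
From HB Require Import structures.
From mathcomp Require Import all_boot all_order all_algebra.
From mathcomp Require Import all_classical all_reals all_analysis.

Set Implicit Arguments.
Unset Strict Implicit.
Unset Printing Implicit Defensive.

Import Order.TTheory GRing.Theory Num.Theory.
Import numFieldNormedType.Exports.

Local Open Scope classical_set_scope.
Local Open Scope ring_scope.

Section Matrices.
Context {R : realType}.

Definition symmx {r} (M : 'M[R]_r) : Prop := M^T = M.

Definition quadform {r} (M : 'M[R]_r) (v : 'cV[R]_r) : R :=
  (v^T *m M *m v) ord0 ord0.

Definition psd {r} : set 'M[R]_r :=
  [set M | symmx M /\ forall v, 0 <= quadform M v].

Definition posdef {r} (M : 'M[R]_r) : Prop :=
  symmx M /\ forall v, v != 0 -> 0 < quadform M v.

Definition loewner_le {r} (M N : 'M[R]_r) : Prop := psd (N - M).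

(* The library norm on matrices is the sup norm of the entries, hence the
   Euclidean and spectral norms below. *)
Definition norm2 {r} (v : 'cV[R]_r) : R := Num.sqrt (\sum_i v i ord0 ^+ 2).

Definition opnorm2 {m n} (M : 'M[R]_(m, n)) : R :=
  sup [set norm2 (M *m v) | v in [set v : 'cV[R]_n | norm2 v <= 1]].

Definition sqrtmx {r} (M : 'M[R]_r) : 'M[R]_r :=
  xget 0 [set N : 'M[R]_r | psd N /\ N *m N = M].

Definition expmx {r} (M : 'M[R]_r) : 'M[R]_r :=
  limn (series (fun k => k`!%:R^-1 *: M ^+ k)).

Definition mxint {m n} (a b : R) (F : R -> 'M[R]_(m, n)) : 'M[R]_(m, n) :=
  \matrix_(i, j) \int[lebesgue_measure]_(u in `[a, b]) F u i j.

Definition controllable {r p} (A : 'M[R]_r) (B : 'M[R]_(r, p)) : Prop :=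
  \rank (\mxrow_(k < r) (A ^+ k *m B)) = r.

Definition observable {r p} (A : 'M[R]_r) (C : 'M[R]_(p, r)) : Prop :=
  \rank (\mxcol_(k < r) (C *m A ^+ k)) = r.

End Matrices.

Notation "M <=L N" := (loewner_le M N) (at level 70) : ring_scope.

Section Gramians.
Context {R : realType} {r : nat}.
Implicit Types (A S Rm : 'M[R]_r) (t : R).

Definition obs_gram A S t : 'M[R]_r :=
  mxint 0 t (fun s => expmx (- (s *: A^T)) *m S *m expmx (- (s *: A))).

Definition ctl_gram A Rm t : 'M[R]_r :=
  mxint 0 t (fun s => expmx (s *: A) *m Rm *m expmx (s *: A^T)).

Definition ctl_gram_obs A S Rm t : 'M[R]_r :=
  invmx (obs_gram A S t)
  *m mxint 0 t (fun s => expmx (- ((t - s) *: A^T)) *m obs_gram A S s *m Rm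
                         *m obs_gram A S s *m expmx (- ((t - s) *: A)))
  *m invmx (obs_gram A S t).

Definition obs_gram_ctl A S Rm t : 'M[R]_r :=
  invmx (ctl_gram A Rm t)
  *m mxint 0 t (fun s => expmx ((t - s) *: A) *m ctl_gram A Rm s *m S
                         *m ctl_gram A Rm s *m expmx ((t - s) *: A^T))
  *m invmx (ctl_gram A Rm t).

End Gramians.

Section RiccatiFlows.
Context {R : realType} {r : nat}.
Implicit Types (A S Rm Q : 'M[R]_r) (pi : 'M[R]_r -> 'M[R]_r).

Definition ricc A S Rm Q : 'M[R]_r := A *m Q + Q *m A^T - Q *m S *m Q + Rm.

Definition ricc_pi A S Rm pi Q : 'M[R]_r :=
  (A - pi Q *m S) *m Q + Q *m (A - pi Q *m S)^T + Rm + pi Q *m S *m pi Q.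

Definition Gamma_pi S pi Q : 'M[R]_r := (pi Q - Q) *m S *m (pi Q - Q).

Definition ode_sol (F : 'M[R]_r -> 'M[R]_r) Q (p : R -> 'M[R]_r) : Prop :=
  [/\ p 0 = Q,
      forall t, 0 <= t -> psd (p t),
      {within `[0, +oo[, continuous p} &
      forall t : R, 0 < t -> is_derive t 1 p (F (p t))].

Definition is_flow (F : 'M[R]_r -> 'M[R]_r) (phi : R -> 'M[R]_r -> 'M[R]_r) :=
  (forall Q, psd Q -> ode_sol F Q (phi^~ Q)) /\
  (forall Q p, psd Q -> ode_sol F Q p -> forall t, 0 <= t -> p t = phi t Q).

(* Only the values of pi on psd matter; they are unconstrained elsewhere. *)
Definition psd_map pi : Prop :=
  (forall Q, psd Q -> psd (pi Q)) /\ {within psd, continuous pi}.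

Definition map_dist (pi1 pi2 : 'M[R]_r -> 'M[R]_r) : \bar R :=
  ereal_sup [set (opnorm2 (pi1 Q - pi2 Q))%:E | Q in psd].

Definition map_ball (Pi : set ('M[R]_r -> 'M[R]_r)) (delta : R) :=
  [set pi | Pi pi /\ (map_dist pi id <= delta%:E)%E].

Definition compact_maps (Pi : set ('M[R]_r -> 'M[R]_r)) : Prop :=
  compact (Pi : set {uniform` @psd R r -> 'M[R]_r}).

Definition rem_bound (Rem : 'M[R]_r -> 'M[R]_r) : R :=
  sup [set opnorm2 (Rem Q) | Q in psd].

Definition condQ S pi (B0 B1 B2 : 'M[R]_r) (Rem : 'M[R]_r -> 'M[R]_r) : Prop :=
  [/\ [/\ symmx B0, symmx B1, symmx B2 & B2 <=L S],
      forall Q, psd Q -> symmx (Rem Q),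
      has_ubound [set opnorm2 (Rem Q) | Q in psd] &
      forall Q, psd Q -> Gamma_pi S pi Q =
        B0 + B1 *m Q + Q *m B1^T + Q *m B2 *m Q + Rem Q].

Definition condK A Rm S (Pi : set ('M[R]_r -> 'M[R]_r))
    (Api Rpi Spi : ('M[R]_r -> 'M[R]_r) -> 'M[R]_r) : Prop :=
  forall eps alpha : R, 0 < eps <= 1 -> 0 < alpha < 1 ->
  exists2 delta : R, 0 < delta & forall pi, map_ball Pi delta pi ->
  [/\ alpha *: S <=L Spi pi /\ Spi pi <=L alpha^-1 *: S,
      alpha *: Rm <=L Rpi pi /\ Rpi pi <=L alpha^-1 *: Rm &
      opnorm2 (A - Api pi) <= eps].

End RiccatiFlows.

(* R^d with its Borel sigma-algebra. *)
Notation bvec R d := (g_sigma_algebraType (@open 'cV[R]_d)).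

Section Wasserstein.
Context {R : realType} {d : nat}.
Implicit Types nu : probability (bvec R d) R.

Definition coupling nu1 nu2 : set (probability (bvec R d * bvec R d)%type R) :=
  [set g | forall U : set (bvec R d), measurable U ->
     g (U `*` setT) = nu1 U /\ g (setT `*` U) = nu2 U].

Definition wasserstein (n : nat) nu1 nu2 : \bar R :=
  ereal_inf
    [set (\int[g]_z
           ((norm2 ((z.1 : 'cV[R]_d) - (z.2 : 'cV[R]_d)) ^+ n)%:E)) `^ n%:R^-1
    | g in coupling nu1 nu2]%E.

End Wasserstein.

Section Probability.
Context {R : realType} {disp : measure_display} {T : measurableType disp}.
Variable P : probability T R.

Definition rvec {d} (X : T -> 'cV[R]_d) : Prop :=
  measurable_fun setT (X : T -> bvec R d).

Definition sigma_proc {d} (D : set R) (X : R -> T -> 'cV[R]_d) : set (set T) :=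
  <<s [set B | exists2 u, D u &
        exists2 U : set (bvec R d), measurable U & B = X u @^-1` U] >>.

Definition sigma_vec {d} (X : T -> 'cV[R]_d) : set (set T) :=
  [set B | exists2 U : set (bvec R d), measurable U & B = X @^-1` U].

Definition indep (F G : set (set T)) : Prop :=
  forall B D, F B -> G D -> P (B `&` D) = (P B * P D)%E.

Definition mutual_indep {I : finType} (F : I -> set (set T)) : Prop :=
  forall E : I -> set T, (forall i, F i (E i)) ->
  P (\bigcap_i E i) = (\big[*%E/1]_i P (E i))%E.

(* N(m, v) on the line; the library's normal_prob is not a Dirac mass when the
   variance is zero. *)
Definition normal1 (m v : R) (U : set R) : \bar R :=
  if v == 0 then \d_m U else normal_prob m (Num.sqrt v) U.

Definition gaussian_vec {d} (X : T -> 'cV[R]_d) (m : 'cV[R]_d) (V : 'M[R]_d) :=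
  [/\ rvec X, psd V &
      forall (u : 'cV[R]_d) (U : set R), measurable U ->
      P [set w | U ((u^T *m X w) ord0 ord0)] =
      normal1 ((u^T *m m) ord0 ord0) (quadform V u) U].

Definition continuous_proc {d} (s : R) (X : R -> T -> 'cV[R]_d) : Prop :=
  (forall t, s <= t -> rvec (X t)) /\
  {ae P, forall w, {within `[s, +oo[, continuous (fun t => X t w)}}.

Definition brownian {d} (B : R -> T -> 'cV[R]_d) : Prop :=
  [/\ continuous_proc 0 B,
      {ae P, forall w, B 0 w = 0},
      forall s t, 0 <= s -> s <= t ->
        gaussian_vec (fun w => B t w - B s w) 0 (t - s)%:M &
      forall (n : nat) (t : nat -> R),
        0 <= t 0%N -> (forall k, t k <= t k.+1) ->
        mutual_indep
          (fun k : 'I_n => sigma_vec (fun w => B (t k.+1) w - B (t k) w))].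

Definition riemann_sum {p q} (K : R -> 'M[R]_(p, q)) (M : R -> T -> 'cV[R]_q)
    (a : R) (l : seq R) (w : T) : 'cV[R]_p :=
  \sum_(k < size l)
    K (nth a (a :: l) k) *m (M (nth a l k) w - M (nth a (a :: l) k) w).

Definition mesh_lt (a : R) (l : seq R) (delta : R) : Prop :=
  forall k, (k < size l)%N -> nth a l k - nth a (a :: l) k < delta.

(* J is the Ito integral over [a, b] of the deterministic continuous integrand
   K against the continuous semimartingale M, as the limit in probability of the
   left-point Riemann sums when the mesh tends to 0. K need not have bounded
   variation, so the integral cannot be taken path by path. *)
Definition ito_integral {p q} (K : R -> 'M[R]_(p, q)) (M : R -> T -> 'cV[R]_q)
    (a b : R) (J : T -> 'cV[R]_p) : Prop :=
  rvec J /\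
  forall eps : R, 0 < eps -> exists2 delta : R, 0 < delta &
  forall l : seq R, itv_partition a b l -> mesh_lt a l delta ->
    (P [set w | (eps < norm2 (riemann_sum K M a l w - J w))%R] <= eps%:E)%E.

(* On [s, +oo[, Z solves  dZ = A Z dt + dN + K (dM - C Z dt). *)
Definition solves_filter {r p} (A : 'M[R]_r) (C : 'M[R]_(p, r))
    (K : R -> 'M[R]_(r, p)) (s : R)
    (N : R -> T -> 'cV[R]_r) (M : R -> T -> 'cV[R]_p)
    (Z : R -> T -> 'cV[R]_r) : Prop :=
  continuous_proc s Z /\
  exists2 J : R -> T -> 'cV[R]_r,
    (forall t, s <= t -> ito_integral K M s t (J t)) &
    {ae P, forall w, forall t, s <= t ->
      Z t w = Z s w
              + mxint s t (fun u => A *m Z u w - K u *m (C *m Z u w))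
              + (N t w - N s w) + J t w}.

(* eta is a regular conditional law of X given the sigma-algebra F. *)
Definition cond_law {d} (F : set (set T)) (X : T -> 'cV[R]_d)
    (eta : T -> probability (bvec R d) R) : Prop :=
  forall U : set (bvec R d), measurable U ->
  (forall V : set R, measurable V -> F [set w | V (fine (eta w U))]) /\
  (forall B, F B -> (\int[P]_(w in B) eta w U = P (B `&` X @^-1` U))%E).

Definition signal_observation {r p} (A Rm : 'M[R]_r) (C : 'M[R]_(p, r))
    (Sigma : 'M[R]_p) (B : R -> T -> 'cV[R]_(r + p))
    (X : R -> T -> 'cV[R]_r) (Y : R -> T -> 'cV[R]_p) : Prop :=
  [/\ brownian B,
      (exists m V, gaussian_vec (X 0) m V),
      indep (sigma_vec (X 0)) (sigma_proc `[0, +oo[ B),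
      continuous_proc 0 X /\ continuous_proc 0 Y &
      {ae P, forall w, forall t, 0 <= t ->
        X t w = X 0 w + mxint 0 t (fun u => A *m X u w)
                + sqrtmx Rm *m usubmx (B t w) /\
        Y t w = mxint 0 t (fun u => C *m X u w)
                + sqrtmx Sigma *m dsubmx (B t w)}].

(* eta is the conditional law, given sigma(Y_u, s <= u <= t), of the time-t value
   of the Kalman-Bucy diffusion Z driven by Y with the gain matrix G, started at
   time s from N(x, Q); B' is the independent copy of the Brownian motion B. *)
Definition kalman_bucy_law {r p} (A Rm : 'M[R]_r) (C : 'M[R]_(p, r))
    (Sigma : 'M[R]_p) (B : R -> T -> 'cV[R]_(r + p))
    (X : R -> T -> 'cV[R]_r) (Y : R -> T -> 'cV[R]_p)
    (G : R -> 'M[R]_r) (s t : R) (x : 'cV[R]_r) (Q : 'M[R]_r)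
    (eta : T -> probability (bvec R r) R) : Prop :=
  exists (B' : R -> T -> 'cV[R]_(r + p)) (Z : R -> T -> 'cV[R]_r),
  [/\ brownian B' /\ gaussian_vec (Z s) x Q,
      indep (sigma_vec (Z s)) (sigma_proc `[0, +oo[ B'),
      indep <<s sigma_vec (X 0) `|` sigma_proc `[0, +oo[ B >>
            <<s sigma_vec (Z s) `|` sigma_proc `[0, +oo[ B' >>,
      solves_filter A C (fun u => G u *m C^T *m invmx Sigma) s
        (fun u w => sqrtmx Rm *m usubmx (B' u w))
        (fun u w => Y u w - sqrtmx Sigma *m dsubmx (B' u w)) Z &
      cond_law (sigma_proc `[s, t] Y) (Z t) eta].

End Probability.

(* Main.v *)
(* Let P = phi_{t-s}(Q), P' = phi^pi_{t-s}(Q). The difference Z - psi of the nonlinear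
   diffusion and the filter with the same gain solves a linear equation driven by the
   independent noise only; hence it is independent of the observations, centred
   Gaussian, and its covariance solves the same Lyapunov equation as P (resp. P'). As
   psi_t is, up to null sets, a function of the observations, eta is a.s. the law of
   psi_t + P^{1/2} xi with xi standard Gaussian (resp. etapi, with P').

   P' - P solves a Lyapunov equation with source Gamma_pi >= 0 and vanishes at time s, so
   P <= P'. For the first estimate couple psi_t + P^{1/2} xi with
   psi^pi_t + P^{1/2} xi + (P' - P)^{1/2} xi2, where xi2 is independent of xi; the
   squared distance has mean |psi^pi_t - psi_t|^2 + tr(P' - P), and the last term of the
   bound is nonnegative. For the second one use the same xi on both sides: the Gramian
   bounds give P' >= P >= b^-1 Id with b = woC + wc^-1, hence
   |P'^{1/2} - P^{1/2}| <= sqrt(b) |P' - P| / 2, and the moments of xi conclude. *)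
Require Import Defs.
From HB Require Import structures.
From mathcomp Require Import all_boot all_order all_algebra.
From mathcomp Require Import all_classical all_reals all_analysis.

From mathcomp Require Import measurable_realfun.
From mathcomp Require Import spectral complex.
From mathcomp Require Import ring lra.

Set Implicit Arguments.
Unset Strict Implicit.
Unset Printing Implicit Defensive.

Import Order.TTheory GRing.Theory Num.Theory.
Import numFieldNormedType.Exports.

Local Open Scope classical_set_scope.
Local Open Scope ring_scope.

(** * Euclidean norm, Loewner order and matrix square roots *)

(** The obstacle is the Ito integral. The gain [pi (phipi pi (u - s) Q)] is merely continuous, so
    the integral exists only as a limit in probability of Riemann sums, and the equation for
    [Z - psi] cannot be solved path by path. Pairing with a dual path [q' = - F^T q] removes the
    drift: [v^T z_t - q(s)^T z_s] becomes the integral of [q] against the noise, a limit of finite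
    sums. The same device yields measurability, since each sum uses finitely many values of the
    noise, and Gaussianity, since each sum is made of independent Gaussian increments whose
    variances are Riemann sums of the derivative of [q^T P q]. Laws are identified by expectations
    of cosine and sine. The characteristic function of N(0, v) is read off the first coordinate of
    the given Brownian motion, and only its value at 0, its semigroup property and its continuity in
    [v] enter. Limits being determined up to null sets, sigma-algebras are replaced by
    completions. *)

Section EuclideanNorm.
Context {R : realType}.
Implicit Types n : nat.

Lemma dotE n (u v : 'cV[R]_n) : (u^T *m v) ord0 ord0 = \sum_i u i ord0 * v i ord0.
Proof. by rewrite mxE; apply: eq_bigr => i _; rewrite mxE. Qed.

Lemma sqr_norm2 n (v : 'cV[R]_n) : norm2 v ^+ 2 = \sum_i v i ord0 ^+ 2.
Proof. by rewrite sqr_sqrtr// sumr_ge0// => i _; exact: sqr_ge0. Qed.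

Lemma sqr_norm2_dot n (v : 'cV[R]_n) : norm2 v ^+ 2 = (v^T *m v) ord0 ord0.
Proof. by rewrite sqr_norm2 dotE; apply: eq_bigr => i _; rewrite expr2. Qed.

Lemma norm2_ge0 n (v : 'cV[R]_n) : 0 <= norm2 v.
Proof. exact: sqrtr_ge0. Qed.

Lemma norm2_eq0 n (v : 'cV[R]_n) : (norm2 v == 0) = (v == 0).
Proof.
apply/eqP/eqP => [v0|->]; last first.
  by rewrite /norm2 big1 ?sqrtr0// => i _; rewrite mxE expr0n.
have /eqP : norm2 v ^+ 2 = 0 by rewrite v0 expr0n.
rewrite sqr_norm2 psumr_eq0; last by move=> i _; exact: sqr_ge0.
move=> /allP/= h; apply/matrixP => i j; rewrite ord1 mxE.
by have := h i (mem_index_enum _); rewrite sqrf_eq0 => /eqP.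
Qed.

Lemma norm2Z n (a : R) (v : 'cV[R]_n) : norm2 (a *: v) = `|a| * norm2 v.
Proof.
apply/eqP; rewrite -(eqrXn2 (ltn0Sn 1)) ?norm2_ge0//; last first.
  by rewrite mulr_ge0 ?norm2_ge0.
rewrite exprMn !sqr_norm2 real_normK ?num_real// mulr_sumr.
by apply/eqP/eq_bigr => i _; rewrite mxE exprMn.
Qed.

Lemma norm2N n (v : 'cV[R]_n) : norm2 (- v) = norm2 v.
Proof. by rewrite -scaleN1r norm2Z normrN1 mul1r. Qed.

Lemma dotC n (u v : 'cV[R]_n) : (u^T *m v) ord0 ord0 = (v^T *m u) ord0 ord0.
Proof. by rewrite !dotE; apply: eq_bigr => i _; rewrite mulrC. Qed.

Lemma sqr_norm2D n (u v : 'cV[R]_n) :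
  norm2 (u + v) ^+ 2 =
  norm2 u ^+ 2 + 2 * (u^T *m v) ord0 ord0 + norm2 v ^+ 2.
Proof.
rewrite !sqr_norm2 dotE mulr_sumr -!big_split/=.
by apply: eq_bigr => i _; rewrite mxE; ring.
Qed.

Lemma cauchy_schwarz_dot n (u v : 'cV[R]_n) :
  `|(u^T *m v) ord0 ord0| <= norm2 u * norm2 v.
Proof.
have [->|v0] := eqVneq v 0; first by rewrite mulmx0 mxE normr0 mulr_ge0 ?norm2_ge0.
have nv : 0 < norm2 v by rewrite lt_def norm2_eq0 v0 norm2_ge0.
set d := (_ *m _) _ _.
rewrite -ler_sqr ?nnegrE ?mulr_ge0 ?norm2_ge0// real_normK ?num_real// exprMn.
(* The residual of [u] after orthogonal projection on [v]; its squared norm is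
   [norm2 u ^+ 2 - d ^+ 2 / norm2 v ^+ 2]. *)
have := sqr_ge0 (norm2 (u + (- (d / norm2 v ^+ 2)) *: v)).
rewrite sqr_norm2D norm2Z -scalemxAr mxE -/d exprMn real_normK ?num_real//.
have v2 : 0 < norm2 v ^+ 2 by rewrite exprn_gt0.
rewrite sqrrN (_ : _ + _ = norm2 u ^+ 2 - d ^+ 2 / norm2 v ^+ 2); last first.
  by field; rewrite gt_eqF.
by rewrite subr_ge0 ler_pdivrMr.
Qed.

Lemma ler_norm2D n (u v : 'cV[R]_n) : norm2 (u + v) <= norm2 u + norm2 v.
Proof.
rewrite -ler_sqr ?nnegrE ?addr_ge0 ?norm2_ge0// sqr_norm2D.
have := le_trans (ler_norm _) (cauchy_schwarz_dot u v); lra.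
Qed.

Lemma coord_le_norm2 n (v : 'cV[R]_n) i : `|v i ord0| <= norm2 v.
Proof.
rewrite -ler_sqr ?nnegrE ?norm2_ge0// real_normK ?num_real// sqr_norm2.
by rewrite (bigD1 i)//= lerDl sumr_ge0// => j _; exact: sqr_ge0.
Qed.

Lemma norm2_le_sum n (v : 'cV[R]_n) : norm2 v <= \sum_i `|v i ord0|.
Proof.
rewrite -ler_sqr ?nnegrE ?norm2_ge0 ?sumr_ge0// sqr_norm2 expr2 mulr_suml.
apply: ler_sum => i _; rewrite -real_normK ?num_real// expr2 ler_wpM2l//.
by rewrite (bigD1 i)//= lerDl sumr_ge0.
Qed.

(** [sup] carries information only on nonempty bounded sets; the sum of all absolute entries is a
    crude but sufficient bound on the unit ball. *)
Lemma opnorm2_has_sup m n (M : 'M[R]_(m, n)) :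
  has_sup [set norm2 (M *m v) | v in [set v : 'cV[R]_n | norm2 v <= 1]].
Proof.
split.
  by exists (norm2 (M *m 0)), 0 => //=; rewrite /norm2 big1 ?sqrtr0// => i _;
    rewrite mxE expr0n.
exists (\sum_i \sum_j `|M i j|) => _ [v /= v1 <-].
apply: (le_trans (norm2_le_sum _)); apply: ler_sum => i _.
rewrite mxE; apply: (le_trans (ler_norm_sum _ _ _)); apply: ler_sum => j _.
rewrite normrM ler_piMr//; exact: le_trans (coord_le_norm2 v j) v1.
Qed.

Lemma opnorm2_ge0 m n (M : 'M[R]_(m, n)) : 0 <= opnorm2 M.
Proof.
apply: (@le_trans _ _ (norm2 (M *m 0))); first exact: norm2_ge0.
apply: sup_upper_bound; first exact: opnorm2_has_sup.
by exists 0 => //=; rewrite /norm2 big1 ?sqrtr0// => i _; rewrite mxE expr0n.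
Qed.

Lemma norm2_mulmx m n (M : 'M[R]_(m, n)) v :
  norm2 (M *m v) <= opnorm2 M * norm2 v.
Proof.
have [->|v0] := eqVneq v 0.
  by rewrite mulmx0 (eqP (_ : norm2 0 == 0)) ?norm2_eq0// mulr_ge0 ?norm2_ge0 ?opnorm2_ge0.
have nv : 0 < norm2 v by rewrite lt_def norm2_eq0 v0 norm2_ge0.
rewrite -ler_pdivrMr//.
have -> : norm2 (M *m v) / norm2 v = norm2 (M *m ((norm2 v)^-1 *: v)).
  by rewrite -scalemxAr norm2Z normfV ger0_norm ?norm2_ge0// mulrC.
apply: sup_upper_bound; first exact: opnorm2_has_sup.
exists ((norm2 v)^-1 *: v) => //=.
by rewrite norm2Z normfV ger0_norm ?norm2_ge0// mulVf ?gt_eqF.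
Qed.

Lemma mx11D (a b : 'M[R]_1) : (a + b) ord0 ord0 = a ord0 ord0 + b ord0 ord0.
Proof. by rewrite mxE. Qed.

Lemma mx11N (a : 'M[R]_1) : (- a) ord0 ord0 = - a ord0 ord0.
Proof. by rewrite mxE. Qed.

Lemma mx11T (a : 'M[R]_1) : a^T ord0 ord0 = a ord0 ord0.
Proof. by rewrite mxE. Qed.

Lemma mx11Z c (a : 'M[R]_1) : (c *: a) ord0 ord0 = c * a ord0 ord0.
Proof. by rewrite mxE. Qed.

Lemma quadformE n (M : 'M[R]_n) v : quadform M v = (v^T *m (M *m v)) ord0 ord0.
Proof. by rewrite /quadform mulmxA. Qed.

Lemma quadform_opnorm2 n (M : 'M[R]_n) v : `|quadform M v| <= opnorm2 M * norm2 v ^+ 2.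
Proof.
rewrite quadformE (le_trans (cauchy_schwarz_dot _ _))//.
rewrite expr2 mulrA [leRHS]mulrC ler_wpM2l ?norm2_ge0//; exact: norm2_mulmx.
Qed.

Lemma quadformD n (M N : 'M[R]_n) v : quadform (M + N) v = quadform M v + quadform N v.
Proof. by rewrite /quadform mulmxDr mulmxDl mxE. Qed.

Lemma quadformN n (M : 'M[R]_n) v : quadform (- M) v = - quadform M v.
Proof. by rewrite /quadform mulmxN mulNmx mxE. Qed.

Lemma quadformB n (M N : 'M[R]_n) v : quadform (M - N) v = quadform M v - quadform N v.
Proof. by rewrite quadformD quadformN. Qed.

Lemma quadform_scalar n (a : R) (v : 'cV[R]_n) : quadform a%:M v = a * norm2 v ^+ 2.
Proof. by rewrite quadformE mul_scalar_mx -scalemxAr mxE sqr_norm2_dot. Qed.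

Lemma loewner_quadform n (M N : 'M[R]_n) v : M <=L N -> quadform M v <= quadform N v.
Proof. by move=> [_ /(_ v)]; rewrite quadformB subr_ge0. Qed.

Lemma quadform_conj m n (N : 'M[R]_(m, n)) (M : 'M[R]_m) v :
  quadform (N^T *m M *m N) v = quadform M (N *m v).
Proof. by rewrite /quadform trmx_mul !mulmxA. Qed.

Lemma quadform_sqr n (M : 'M[R]_n) v : symmx M -> quadform (M *m M) v = norm2 (M *m v) ^+ 2.
Proof. by move=> sM; rewrite /quadform sqr_norm2_dot trmx_mul sM !mulmxA. Qed.

Lemma posdef_psd n (M : 'M[R]_n) : posdef M -> psd M.
Proof.
move=> [sM pM]; split=> // v; have [->|/pM/ltW//] := eqVneq v 0.
by rewrite /quadform mulmx0 mxE.
Qed.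

Lemma posdef_unit n (M : 'M[R]_n) : posdef M -> M \in unitmx.
Proof.
move=> [sM pM]; rewrite -row_free_unit -kermx_eq0; apply/eqP/row_matrixP => i.
rewrite row0; apply/eqP/negPn/negP => ki.
have /pM : (row i (kermx M))^T != 0 by rewrite -(inj_eq trmx_inj) trmxK trmx0.
by rewrite /quadform trmxK -row_mul mulmx_ker row0 mul0mx mxE ltxx.
Qed.

Lemma dot_sym n (M : 'M[R]_n) u v : symmx M ->
  (u^T *m (M *m v)) (@ord0 0) (@ord0 0) = (v^T *m (M *m u)) ord0 ord0.
Proof. by move=> sM; rewrite dotC trmx_mul sM -mulmxA. Qed.

End EuclideanNorm.

(** * Symmetric functional calculus and the positive square root *)

Section SquareRoot.
Context {R : realType}.

(** Meant for functional calculus: on a finite spectrum every function is a polynomial, and a real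
    polynomial in a real symmetric matrix is again real and symmetric. A new node is treated in
    Newton's way, by adding a multiple of the polynomial that vanishes at the old ones. *)
Lemma poly_interpolation (F : fieldType) (f : F -> F) (s : seq F) :
  exists q : {poly F}, forall x, x \in s -> q.[x] = f x.
Proof.
elim: s => [|a s [q qs]]; first by exists 0.
have [as_|as_] := boolP (a \in s).
  by exists q => x; rewrite inE => /predU1P[->|]; exact: qs.
pose p := \prod_(y <- s) ('X - y%:P).
have pa : p.[a] != 0.
  rewrite /p horner_prod prodf_seq_neq0; apply/allP => y ys /=.
  by rewrite !hornerE subr_eq0; apply: contraNneq as_ => ->.
exists (q + ((f a - q.[a]) / p.[a])%:P * p) => x; rewrite inE => /predU1P[->|xs].
  by rewrite !hornerE/= divfK// addrC subrK.
rewrite !hornerE/= (_ : p.[x] = 0) ?mulr0 ?addr0 ?qs//.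
by apply/eqP; rewrite -/(root p x) root_prod_XsubC.
Qed.

Lemma trmx_horner_mx n (M : 'M[R]_n.+1) (p : {poly R}) :
  (horner_mx M p)^T = horner_mx M^T p.
Proof.
elim/poly_ind: p => [|p c IH]; first by rewrite !rmorph0 trmx0.
rewrite !rmorphD !rmorphM /= !horner_mx_X !horner_mx_C linearD /= tr_scalar_mx.
rewrite -[_ * M]/(_ *m M) trmx_mul IH.
by congr (_ + _); exact: (comm_mx_horner _ (comm_mx_refl _)).
Qed.

Lemma eigenvalue_diag (F : fieldType) n (P D : 'M[F]_n) (d : 'rV[F]_n) (j : 'I_n) :
  P \in unitmx -> D = invmx P *m diag_mx d *m P -> eigenvalue D (d ord0 j).
Proof.
move=> uP ->; apply/eigenvalueP; exists (row j P); last first.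
  apply/eqP => r0; have := rowE j P; rewrite r0 => /esym.
  move=> /(congr1 (mulmx^~ (invmx P))); rewrite mulmxK// mul0mx.
  by move=> /matrixP/(_ ord0 j); rewrite !mxE !eqxx => /eqP; rewrite oner_eq0.
by rewrite !mulmxA -row_mul mulmxV// row1 -rowE row_diag_mx -scalemxAl -rowE.
Qed.

(** The spectral theorem lives over the complex numbers, so [M] is complexified, but the root is
    built as a real polynomial in [M] and only the identity [N *m N = M] is checked on the diagonal
    form. The hypothesis bears on eigenvalues rather than on the quadratic form because the lemma
    also serves to derive positivity of the latter from that of the former. *)
Lemma psd_sqrt_eigen n (M : 'M[R]_n) : symmx M ->
  (forall x, eigenvalue M x -> 0 <= x) -> exists N, psd N /\ N *m N = M.
Proof.
case: n M => [|n] M sM eM.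
  exists M; split; last by apply/matrixP => -[].
  by split=> // v; rewrite /quadform mxE big_ord0.
pose C : numClosedFieldType := R[i]%C.
pose toC : {rmorphism R -> C} := real_complex R.
pose A := map_mx toC M.
have hA : A \is hermsymmx.
  apply/is_hermitianmxP; rewrite expr0 scale1r.
  rewrite /A map_trmx sM -map_mx_comp; apply/matrixP => i j; rewrite !mxE.
  by apply/esym/CrealP; apply/complex_realP; exists (M i j).
have /hermitian_normalmx/orthomx_spectralP Aeq := hA.
have dreal := hermitian_spectral_diag_real hA.
set P := spectralmx A in Aeq; set d := spectral_diag A in Aeq dreal.
have uP : P \in unitmx by exact: spectral_unit.
have [x dx] : exists x : 'I_n.+1 -> R, forall j, d ord0 j = toC (x j).
  have h j : exists y : R, d ord0 j = toC y.
    have /mxOverP/(_ ord0 j)/complex_realP[y ->] := dreal.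
    by exists y.
  by exists (fun j => xget 0 [set y | d ord0 j = toC y]) => j; exact: xgetPex (h j).
have x0 j : 0 <= x j.
  apply: eM; have := eigenvalue_diag j uP Aeq.
  by rewrite dx /A eigenvalue_map.
(* The fourth root, so that [N := Q *m Q] is the square of a symmetric matrix and hence visibly
   psd. *)
have [q qx] := poly_interpolation (fun y => Num.sqrt (Num.sqrt y)) (codom x).
pose Q := horner_mx M q.
have sQ : symmx Q by rewrite /symmx /Q trmx_horner_mx sM.
exists (Q *m Q); split.
  split; first by rewrite /symmx trmx_mul sQ.
  by move=> v; rewrite quadform_sqr// sqr_ge0.
have -> : Q *m Q *m (Q *m Q) = horner_mx M (q ^+ 4).
  by rewrite rmorphXn/= -/Q !exprS expr0 mulr1 mulrA.
apply: (@map_mx_inj _ _ toC _ _).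
rewrite map_horner_mx -/A.
(* Polynomials act entrywise on the diagonal form; [q ^+ 4] reproduces the diagonal [d], since [q]
   interpolates the fourth root at the eigenvalues. *)
have hp (p : {poly C}) : horner_mx A p = invmx P *m diag_mx (map_mx (horner p) d) *m P.
  rewrite {1}Aeq -horner_mx_diag.
  elim/poly_ind: p => [|p c IH]; first by rewrite !rmorph0 mulmx0 mul0mx.
  rewrite !rmorphD !rmorphM /= !horner_mx_X !horner_mx_C IH.
  rewrite mulmxDr mulmxDl; congr (_ + _).
    rewrite -!/(_ *m _) -[LHS]/(_ *m _) -[X in _ = invmx P *m X *m P]/(_ *m _).
    by rewrite !mulmxA mulmxK.
  by rewrite scalar_mxC -mulmxA mulVmx// mulmx1.
rewrite hp; suff -> : map_mx (horner (map_poly toC (q ^+ 4))) d = d by exact/esym.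
apply/rowP => j; rewrite mxE dx horner_map/= horner_exp qx ?codom_f//.
congr (real_complex R _).
by rewrite -[4%N]/(2 * 2)%N exprM !sqr_sqrtr ?sqrtr_ge0.
Qed.

Lemma psd_eigenvalue n (M : 'M[R]_n) x : psd M -> eigenvalue M x -> 0 <= x.
Proof.
move=> [sM pM] /eigenvalueP[v vM v0].
have := pM v^T; rewrite /quadform trmxK vM -scalemxAl mxE -{1}(trmxK v) -sqr_norm2_dot.
by rewrite pmulr_lge0// exprn_gt0// lt_def norm2_ge0 norm2_eq0 -trmx0 (inj_eq trmx_inj) v0.
Qed.

Lemma psd_sqrt n (M : 'M[R]_n) : psd M -> exists N, psd N /\ N *m N = M.
Proof.
by move=> pM; apply: psd_sqrt_eigen; [case: pM|move=> x; exact: psd_eigenvalue].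
Qed.

Lemma psd_sqrtmx n (M : 'M[R]_n) : psd M -> psd (sqrtmx M).
Proof. by move=> /psd_sqrt/xgetPex-/(_ 0)[]. Qed.

Lemma sqr_sqrtmx n (M : 'M[R]_n) : psd M -> sqrtmx M *m sqrtmx M = M.
Proof. by move=> /psd_sqrt/xgetPex-/(_ 0)[]. Qed.

(** A symmetric matrix with nonnegative spectrum is the square of a symmetric one. Applied to
    matrices [a *: M + b%:M], this is how spectral bounds become Loewner bounds. *)
Lemma psd_eigenvalues n (M : 'M[R]_n) : symmx M ->
  (forall x, eigenvalue M x -> 0 <= x) -> psd M.
Proof.
move=> sM /(psd_sqrt_eigen sM)[N [[sN pN] NM]]; split=> // v.
by rewrite -NM quadform_sqr// sqr_ge0.
Qed.

Lemma eigenvalue_affine n (M : 'M[R]_n) (a b x : R) : a != 0 ->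
  eigenvalue (a *: M + b%:M) x -> eigenvalue M ((x - b) / a).
Proof.
move=> a0 /eigenvalueP[v vM v0]; apply/eigenvalueP; exists v => //.
move: vM; rewrite mulmxDr -scalemxAr mul_mx_scalar => /(congr1 (fun u => u - b *: v)).
rewrite addrK -scalerBl => h.
by rewrite mulrC -scalerA -h scalerA mulVf// scale1r.
Qed.

Lemma symmx_affine n (M : 'M[R]_n) (a b : R) : symmx M -> symmx (a *: M + b%:M).
Proof. by move=> sM; rewrite /symmx linearD linearZ/= tr_scalar_mx sM. Qed.

(** With [y := E *m v] and [s := norm2 y / norm2 v], add the quadratic forms of [k - E] at [y + s v]
    and of [k + E] at [y - s v], both nonnegative: the pure terms of [E] cancel and
    [4 s |y|^2 <= 4 k |y|^2] remains, that is [|y| <= k |v|]. *)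
Lemma norm2_mulmx_sym n (E : 'M[R]_n) (k : R) v : 0 <= k -> symmx E ->
  (forall x, eigenvalue E x -> `|x| <= k) -> norm2 (E *m v) <= k * norm2 v.
Proof.
move=> k0 sE eE.
have pE1 : psd (-1 *: E + k%:M).
  apply: psd_eigenvalues; first exact: symmx_affine.
  move=> x /eigenvalue_affine; rewrite oppr_eq0 oner_eq0 => /(_ isT)/eE.
  by rewrite invrN invr1 mulrN1 ler_norml => /andP[_]; lra.
have pE2 : psd (1 *: E + k%:M).
  apply: psd_eigenvalues; first exact: symmx_affine.
  move=> x /eigenvalue_affine; rewrite oner_eq0 => /(_ isT)/eE.
  by rewrite invr1 mulr1 ler_norml => /andP[+ _]; lra.
have [->|v0] := eqVneq v 0.
  by rewrite mulmx0 (eqP (_ : norm2 0 == 0)) ?norm2_eq0// mulr0.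
have nv : 0 < norm2 v by rewrite lt_def norm2_eq0 v0 norm2_ge0.
have [->|Ev0] := eqVneq (norm2 (E *m v)) 0; first by rewrite mulr_ge0 // norm2_ge0.
have nEv : 0 < norm2 (E *m v) by rewrite lt_def Ev0 norm2_ge0.
set y := E *m v; set s := norm2 y / norm2 v.
have := (pE2.2 (y - s *: v)); have := (pE1.2 (y + s *: v)).
rewrite !quadformD !quadform_scalar.
have qE (a : R) u : quadform (a *: E) u = a * quadform E u.
  by rewrite /quadform -scalemxAr -scalemxAl mxE.
rewrite !qE -(scaleNr s).
have qD (u w : 'cV[R]_n) : quadform E (u + w) = quadform E u + 2 * (u^T *m (E *m w)) ord0 ord0 + quadform E w.
  rewrite !quadformE linearD/= mulmxDr mulmxDr !mulmxDl !mx11D.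
  by rewrite (dot_sym w u sE); ring.
rewrite !qD -!scalemxAr -/y !sqr_norm2D !norm2Z -!scalemxAr.
have qZ (a : R) (u : 'cV[R]_n) : quadform E (a *: u) = a ^+ 2 * quadform E u.
  by rewrite !quadformE linearZ/= -scalemxAr -scalemxAr -scalemxAl !mxE; ring.
rewrite !qZ !mx11Z normrN -sqr_norm2_dot.
rewrite (_ : `|s| * norm2 v = norm2 y); last first.
  by rewrite ger0_norm ?divr_ge0 ?norm2_ge0// divfK ?gt_eqF.
move=> h1 h2.
have : 4 * s * norm2 y ^+ 2 <= 4 * k * norm2 y ^+ 2.
  by move: h1 h2; rewrite sqrrN; lra.
rewrite ler_pM2r ?exprn_gt0// ler_pM2l// /s ler_pdivrMr//.
Qed.

(** For an eigenvector [e] of [Y - X] with eigenvalue [x], the factorisation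
    [Y^2 - X^2 = Y (Y - X) + (Y - X) X] gives [e^T (Y^2 - X^2) e = x (e^T Y e + e^T X e)], and the
    bracket is at least [2 c |e|^2]. So every eigenvalue is, in absolute value, at most the operator
    norm divided by [2 c]. *)
Lemma sqrt_lipschitz n (X Y : 'M[R]_n) (c : R) v : 0 < c -> psd X -> psd Y ->
  (c ^+ 2)%:M <=L X *m X -> (c ^+ 2)%:M <=L Y *m Y ->
  norm2 ((Y - X) *m v) <= opnorm2 (Y *m Y - X *m X) / (2 * c) * norm2 v.
Proof.
move=> c0 pX pY cX cY.
(* The square root is monotone on eigenvalues: [x ^+ 2 >= c ^+ 2] with [x >= 0] yields [x >= c]. *)
have low (Z : 'M[R]_n) e : psd Z -> (c ^+ 2)%:M <=L Z *m Z ->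
    c * norm2 e ^+ 2 <= quadform Z e.
  move=> pZ cZ; suff [_ /(_ e)] : psd (1 *: Z + (- c)%:M).
    by rewrite scale1r quadformD quadform_scalar mulNr subr_ge0.
  apply: psd_eigenvalues; first by apply: symmx_affine; case: pZ.
  move=> x /eigenvalue_affine; rewrite oner_eq0 => /(_ isT).
  rewrite invr1 mulr1 opprK => eZ; have xc := psd_eigenvalue pZ eZ.
  move: eZ => /eigenvalueP[u uZ u0].
  have nu : 0 < norm2 u^T ^+ 2.
    by rewrite exprn_gt0// lt_def norm2_ge0 norm2_eq0 -trmx0 (inj_eq trmx_inj) u0.
  have := loewner_quadform u^T cZ.
  rewrite quadform_scalar /quadform trmxK mulmxA uZ -scalemxAl uZ scalerA -scalemxAl mxE.
  rewrite (_ : (u *m u^T) _ _ = norm2 u^T ^+ 2); last by rewrite sqr_norm2_dot trmxK.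
  rewrite ler_pM2r// -expr2 ler_sqr ?nnegrE ?(ltW c0)// => ?; lra.
apply: norm2_mulmx_sym; first by rewrite divr_ge0 ?opnorm2_ge0// mulr_ge0 // ltW.
  by rewrite /symmx linearB/= pX.1 pY.1.
move=> x /eigenvalueP[u uE u0]; rewrite ler_pdivlMr ?mulr_gt0//.
pose e := u^T.
have nu : 0 < norm2 e ^+ 2.
  by rewrite exprn_gt0// lt_def norm2_ge0 norm2_eq0 -trmx0 (inj_eq trmx_inj) u0.
have Ee : (Y - X) *m e = x *: e.
  by rewrite /e -[Y - X]trmxK -trmx_mul linearB/= pX.1 pY.1 uE linearZ.
rewrite -(ler_pM2r nu) (le_trans _ (quadform_opnorm2 _ e))//.
have -> : quadform (Y *m Y - X *m X) e = x * (quadform Y e + quadform X e).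
  rewrite (_ : _ - _ = Y *m (Y - X) + (Y - X) *m X); last first.
    by rewrite mulmxBr mulmxBl addrA subrK.
  rewrite quadformD /quadform -!mulmxA Ee -scalemxAr -scalemxAr mxE mulrDr.
  congr (_ + _); rewrite !mulmxA -[_ *m X *m e]mulmxA {1}/e trmxK uE -scalemxAl mxE.
  by rewrite mulmxA.
rewrite normrM (ger0_norm (addr_ge0 (pY.2 e) (pX.2 e))) -mulrA ler_wpM2l//.
have := low _ e pX cX; have := low _ e pY cY; lra.
Qed.

End SquareRoot.

(** * Matrix-valued paths and linear differential equations *)

Section MatrixPaths.
Context {R : realType}.

(** Entrywise, so that the real mean value and fundamental theorems apply directly; at [a] and [b]
    the continuity is one-sided. *)
Definition mxcont {m n} (a b : R) (f : R -> 'M[R]_(m, n)) : Prop :=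
  forall i j, {within `[a, b], continuous (fun s => f s i j)}.

Definition mxder {m n} (f : R -> 'M[R]_(m, n)) (t : R) (d : 'M[R]_(m, n)) : Prop :=
  forall i j, is_derive t 1 (fun s => f s i j) (d i j).

Lemma is_derive_congr (f g : R -> R) (t d e : R) :
  f =1 g -> d = e -> is_derive t 1 f d -> is_derive t 1 g e.
Proof. by move=> /funext -> ->. Qed.

Lemma within_congr (A : set R) (f g : R -> R) :
  f =1 g -> {within A, continuous f} -> {within A, continuous g}.
Proof. by move=> /funext ->. Qed.

Lemma within_sum (A : set R) (I : Type) (s : seq I) (f : I -> R -> R) :
  (forall i, {within A, continuous (f i)}) ->
  {within A, continuous (fun t => \sum_(i <- s) f i t)}.
Proof.
move=> cf; elim: s => [|i s IH].
  by apply: (@within_congr _ (cst 0)) => [t|x]; [rewrite big_nil|exact: cvg_cst].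
apply: (@within_congr _ (fun t => f i t + \sum_(i <- s) f i t)) => [t|x].
  by rewrite big_cons.
by apply: cvgD; [exact: cf|exact: IH].
Qed.

Lemma mxcont_cst m n a b (M : 'M[R]_(m, n)) : mxcont a b (fun=> M).
Proof. by move=> i j x; exact: cvg_cst. Qed.

Lemma mxcontD m n a b (f g : R -> 'M[R]_(m, n)) :
  mxcont a b f -> mxcont a b g -> mxcont a b (fun t => f t + g t).
Proof.
move=> cf cg i j; apply: (@within_congr _ (fun t => f t i j + g t i j)) => [t|x].
  by rewrite mxE.
by apply: cvgD; [exact: cf|exact: cg].
Qed.

Lemma mxcontN m n a b (f : R -> 'M[R]_(m, n)) :
  mxcont a b f -> mxcont a b (fun t => - f t).
Proof.
move=> cf i j; apply: (@within_congr _ (fun t => - f t i j)) => [t|x].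
  by rewrite mxE.
by apply: cvgN; exact: cf.
Qed.

Lemma mxcontB m n a b (f g : R -> 'M[R]_(m, n)) :
  mxcont a b f -> mxcont a b g -> mxcont a b (fun t => f t - g t).
Proof. by move=> cf cg; apply: mxcontD => //; exact: mxcontN. Qed.

Lemma mxcontM m n p a b (f : R -> 'M[R]_(m, n)) (g : R -> 'M[R]_(n, p)) :
  mxcont a b f -> mxcont a b g -> mxcont a b (fun t => f t *m g t).
Proof.
move=> cf cg i j.
apply: (@within_congr _ (fun t => \sum_k f t i k * g t k j)) => [t|].
  by rewrite mxE.
by apply: within_sum => k x; apply: cvgM; [exact: cf|exact: cg].
Qed.

Lemma mxcontT m n a b (f : R -> 'M[R]_(m, n)) :
  mxcont a b f -> mxcont a b (fun t => (f t)^T).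
Proof.
move=> cf i j; apply: (@within_congr _ (fun t => f t j i)) => [t|]; last exact: cf.
by rewrite mxE.
Qed.

Lemma mxcontS m n a b c d (f : R -> 'M[R]_(m, n)) :
  a <= c -> d <= b -> mxcont a b f -> mxcont c d f.
Proof.
move=> ac db cf i j; apply: continuous_subspaceW (cf i j) => x /=.
by rewrite !in_itv/= => /andP[cx xd]; rewrite (le_trans ac cx) (le_trans xd db).
Qed.

Lemma mxcont_within m n a b (f : R -> 'M[R]_(m, n)) :
  {within `[a, b], continuous f} -> mxcont a b f.
Proof.
move=> cf i j x; apply: (@cvg_comp _ _ _ f (fun M : 'M[R]_(m, n) => M i j)).
  exact: cf.
exact: coord_continuous.
Qed.

Lemma mxder_cst m n (M : 'M[R]_(m, n)) t : mxder (fun=> M) t 0.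
Proof. by move=> i j; rewrite mxE; exact: is_derive_cst. Qed.

Lemma mxderD m n (f g : R -> 'M[R]_(m, n)) t df dg :
  mxder f t df -> mxder g t dg -> mxder (fun t => f t + g t) t (df + dg).
Proof.
move=> hf hg i j; apply: (is_derive_congr _ _ (is_deriveD (hf i j) (hg i j))).
  by move=> s; rewrite mxE.
by rewrite mxE.
Qed.

Lemma mxderN m n (f : R -> 'M[R]_(m, n)) t df :
  mxder f t df -> mxder (fun t => - f t) t (- df).
Proof.
move=> hf i j; apply: (is_derive_congr _ _ (is_deriveN (hf i j))).
  by move=> s; rewrite mxE.
by rewrite mxE.
Qed.

Lemma mxderB m n (f g : R -> 'M[R]_(m, n)) t df dg :
  mxder f t df -> mxder g t dg -> mxder (fun t => f t - g t) t (df - dg).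
Proof. by move=> hf hg; apply: mxderD => //; exact: mxderN. Qed.

Lemma mxderM m n p (f : R -> 'M[R]_(m, n)) (g : R -> 'M[R]_(n, p)) t df dg :
  mxder f t df -> mxder g t dg ->
  mxder (fun t => f t *m g t) t (df *m g t + f t *m dg).
Proof.
move=> hf hg i j.
apply: (is_derive_congr _ _ (is_derive_sum (fun k => is_deriveM (hf i k) (hg k j)))).
  by move=> s; rewrite fct_sumE mxE.
rewrite mxE [X in _ = X + _]mxE [X in _ = _ + X]mxE -big_split/=.
by apply: eq_bigr => k _; rewrite /GRing.scale/= addrC [g t k j * _]mulrC.
Qed.

Lemma mxderT m n (f : R -> 'M[R]_(m, n)) t df :
  mxder f t df -> mxder (fun t => (f t)^T) t df^T.
Proof.
move=> hf i j; apply: (is_derive_congr _ _ (hf j i)).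
  by move=> s; rewrite mxE.
by rewrite mxE.
Qed.

Lemma mxder_congr m n (f g : R -> 'M[R]_(m, n)) t df dg :
  f =1 g -> df = dg -> mxder f t df -> mxder g t dg.
Proof. by move=> /funext -> ->. Qed.

Lemma mxder_is_derive m n (f : R -> 'M[R]_(m, n)) (t : R) df :
  is_derive t 1 f df -> mxder f t df.
Proof.
move=> [df1 fE] i j; split; first exact/(derivable_mxP f t 1).1.
by rewrite -fE derive_mx// mxE.
Qed.

Lemma derive_nondecr (a b : R) (f df : R -> R) : a <= b ->
  (forall x, a < x < b -> is_derive x 1 f (df x)) ->
  {within `[a, b], continuous f} ->
  (forall x, a < x < b -> 0 <= df x) -> f a <= f b.
Proof.
rewrite le_eqVlt => /predU1P[->//|ab] hd cf df0.
have hd' x : x \in `]a, b[ -> is_derive x 1 f (df x) by rewrite in_itv; exact: hd.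
have [c cab /eqP] := MVT ab hd' cf.
rewrite subr_eq => /eqP ->; rewrite lerDr mulr_ge0// ?subr_ge0 ?(ltW ab)//.
by apply: df0; rewrite in_itv in cab.
Qed.

Lemma derive_norm_le (a b k : R) (f df : R -> R) : a <= b ->
  (forall x, a < x < b -> is_derive x 1 f (df x)) ->
  {within `[a, b], continuous f} ->
  (forall x, a < x < b -> `|df x| <= k) -> `|f b - f a| <= k * (b - a).
Proof.
rewrite le_eqVlt => /predU1P[->|ab] hd cf dk.
  by rewrite !subrr normr0 mulr0.
have hd' x : x \in `]a, b[ -> is_derive x 1 f (df x) by rewrite in_itv; exact: hd.
have [c cab ->] := MVT ab hd' cf.
rewrite normrM (gtr0_norm (_ : 0 < b - a)) ?subr_gt0// ler_wpM2r ?subr_ge0 ?(ltW ab)//.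
by apply: dk; rewrite in_itv in cab.
Qed.

Lemma mxcont_bounded m n a b (f : R -> 'M[R]_(m, n)) : mxcont a b f ->
  exists2 k : R, 0 < k & forall t, a <= t <= b -> forall i j, `|f t i j| <= k.
Proof.
move=> cf; have [ab|ba] := leP a b; last first.
  by exists 1 => // t /andP[at_ tb]; have := le_trans at_ tb; rewrite leNgt ba.
have h i j : exists k : R, forall t, a <= t <= b -> `|f t i j| <= k.
  have [|c _ fc] := @EVT_max R (fun t => `|f t i j|) a b ab.
    by move=> x; apply: cvg_norm; exact: cf.
  by exists `|f c i j| => t tab; apply: fc; rewrite in_itv.
pose k i j := xget 0 [set k : R | forall t, a <= t <= b -> `|f t i j| <= k].
have hk i j t : a <= t <= b -> `|f t i j| <= k i j.
  by move=> tab; have /xgetPex-/(_ 0) := h i j; apply.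
exists (1 + \sum_i \sum_j `|k i j|).
  by rewrite ltr_pwDl// sumr_ge0// => i _; exact: sumr_ge0.
move=> t tab i j; apply: (le_trans (hk i j t tab)).
apply: (le_trans (ler_norm _)); rewrite (bigD1 i)//= (bigD1 j)//=.
set x := \sum_(_ < _ | _) _; set y := \sum_(_ < _ | _) _.
have x0 : 0 <= x by exact: sumr_ge0.
have y0 : 0 <= y by apply: sumr_ge0 => l _; exact: sumr_ge0.
by rewrite -/x -/y; lra.
Qed.

Lemma within_antiderivative (a b : R) (f : R -> R) : a < b ->
  {within `[a, b], continuous f} ->
  let F := fun t => \int[lebesgue_measure]_(u in `[a, t]) f u in
  {within `[a, b], continuous F} /\
  (forall t, a < t < b -> is_derive t 1 F (f t)).
Proof.
move=> ab cf F.
have intf : lebesgue_measure.-integrable `[a, b] (EFin \o f).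
  by apply: continuous_compact_integrable => //; exact: segment_compact.
split; first exact: (parameterized_integral_continuous (ltW ab) intf).
move=> t /andP[at_ tb].
have [|h1 h2] := continuous_FTC1_closed tb intf at_.
  have /(continuous_within_itvP _ ab)[+ _ _] := cf; apply.
  by rewrite in_itv/= at_ tb.
by apply: DeriveDef h1 _; rewrite -derive1E.
Qed.

Lemma mxint_antiderivative m n (a b : R) (f : R -> 'M[R]_(m, n)) : a < b ->
  mxcont a b f ->
  mxcont a b (fun t => mxint a t f) /\
  forall t, a < t < b -> mxder (fun t => mxint a t f) t (f t).
Proof.
move=> ab cf; split=> [i j|t tab i j].
  have [h _] := within_antiderivative ab (cf i j).
  by apply: within_congr h => t; rewrite mxE.
have [_ h] := within_antiderivative ab (cf i j).
by apply: is_derive_congr (h t tab) => // s; rewrite mxE.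
Qed.

Lemma mxint_point m n (a : R) (f : R -> 'M[R]_(m, n)) : mxint a a f = 0.
Proof.
by apply/matrixP => i j; rewrite !mxE set_itv1 Rintegral_set1.
Qed.

Lemma within_uniform_limit (a b : R) (f : R -> R) :
  (forall e : R, 0 < e -> exists2 g : R -> R, {within `[a, b], continuous g} &
    forall t, a <= t <= b -> `|f t - g t| <= e) ->
  {within `[a, b], continuous f}.
Proof.
move=> fg; apply/subspace_continuousP => x /= xab.
apply/cvgrPdist_le => e e0.
have [g cg hg] := fg (e / 3) (divr_gt0 e0 (ltr0n _ 3)).
have /subspace_continuousP/(_ x xab)/cvgrPdist_le/(_ (e / 3)) := cg.
rewrite divr_gt0// => /(_ isT) h.
near=> y.
have yab : a <= y <= b.
  suff : `[a, b]%classic y by rewrite /= in_itv.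
  by near: y; exact: withinT.
have h1 : `|g x - g y| <= e / 3 by near: y; exact: h.
have h2 := hg y yab; have h3 : `|f x - g x| <= e / 3 by apply: hg; rewrite in_itv in xab.
rewrite (_ : f x - f y = (f x - g x) + (g x - g y) + (g y - f y)); last by ring.
rewrite (le_trans (ler_normD _ _))//; rewrite distrC in h2.
have := ler_normD (f x - g x) (g x - g y); lra.
Unshelve. all: by end_near. Qed.

(** Heine's theorem by compactness in the form of near covering: the radius tends to 0 from the
    right, and around each [x] the radius [d / 2] works for all neighbouring base points at once. *)
Lemma within_uniformly_continuous (a b : R) (f : R -> R) :
  {within `[a, b], continuous f} -> forall e : R, 0 < e ->
  exists2 d : R, 0 < d & forall s t, a <= s <= b -> a <= t <= b ->
    `|s - t| < d -> `|f s - f t| <= e.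
Proof.
move=> cf e e0.
pose P (d x : R) := a <= x <= b ->
  forall y, a <= y <= b -> `|x - y| < d -> `|f x - f y| <= e.
have : \forall d \near (0 : R)^'+, `[a, b]%classic `<=` P d.
  apply: (compact_near_coveringP _).1; first exact: segment_compact.
  move=> x xab; have /subspace_continuousP/(_ x xab)/cvgrPdist_le/(_ (e / 2)) := cf.
  rewrite divr_gt0// => /(_ isT); rewrite /within/= => -[d /= d0 hd].
  exists ([set y | `|x - y| < d / 2], [set i | i < d / 2]) => /=.
    split; last by apply: nbhs_right_lt; rewrite divr_gt0.
    by exists (d / 2) => //=; rewrite divr_gt0.
  move=> [x' i] /= [xx' id2] x'ab y yab x'y.
  have h1 : `|f x - f x'| <= e / 2.
    by apply: hd; [rewrite /=; lra|rewrite in_itv].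
  have h2 : `|f x - f y| <= e / 2.
    apply: hd; last by rewrite in_itv.
    rewrite /= (_ : x - y = (x - x') + (x' - y)); last by ring.
    by apply: (le_lt_trans (ler_normD _ _)); lra.
  rewrite (_ : f x' - f y = (f x - f y) - (f x - f x')); last by ring.
  by apply: (le_trans (ler_normB _ _)); lra.
move=> h; have /filter_ex[d [d0 hd]] : \forall d \near (0 : R)^'+,
    0 < d /\ `[a, b]%classic `<=` P d.
  by near=> d; split; near: d; [exact: nbhs_right_gt|exact: h].
exists d => // s t sab tab st; apply: hd => //=; by rewrite in_itv.
Unshelve. all: by end_near. Qed.

Lemma mxcont_uniform m n (a b : R) (f : R -> 'M[R]_(m, n)) : mxcont a b f ->
  forall e : R, 0 < e -> exists2 d : R, 0 < d & forall s t, a <= s <= b ->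
    a <= t <= b -> `|s - t| < d -> forall i j, `|f s i j - f t i j| <= e.
Proof.
move=> cf e e0.
pose D i j := xget 0 [set d : R | 0 < d /\ forall s t, a <= s <= b ->
  a <= t <= b -> `|s - t| < d -> `|f s i j - f t i j| <= e].
have hD i j : 0 < D i j /\ forall s t, a <= s <= b ->
  a <= t <= b -> `|s - t| < D i j -> `|f s i j - f t i j| <= e.
  by apply: (@xgetPex _ 0 [set d : R | 0 < d /\ _]);
    have [d d0 hd] := within_uniformly_continuous (cf i j) e0; exists d.
pose d := \big[Num.min/1]_i \big[Num.min/1]_j D i j.
exists d.
  by apply/bigmin_gtP; split=> // i _; apply/bigmin_gtP; split=> // j _; case: (hD i j).
move=> s t sab tab std i j; apply: (hD i j).2 => //; apply: (lt_le_trans std).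
apply: (@le_trans _ _ (\big[Num.min/1]_j D i j)).
  by rewrite /d (bigD1 i)//= ge_min lexx.
by rewrite (bigD1 j)//= ge_min lexx.
Qed.

Lemma is_derive_expR_affine (D l a s : R) :
  is_derive s 1 (fun s : R => D * expR (l * (s - a))) (D * (l * expR (l * (s - a)))).
Proof.
apply: is_derive_eq; rewrite /GRing.scale/= ?mulr0 ?add0r ?addr0 ?mulr1 ?subr0.
by ring.
Qed.

Lemma geometric_small (k e : R) : 0 < e -> exists j : nat, k * 2^-1 ^+ j <= e.
Proof.
move=> e0.
have : (fun j => k * 2^-1 ^+ j) @ \oo --> k * (0 : R).
  apply: cvgMr; apply: cvg_expr; rewrite ger0_norm//; lra.
rewrite mulr0 => /cvgrPdist_le/(_ e e0)[N _ /(_ N (leqnn N))].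
by rewrite /= sub0r normrN => h; exists N; exact: le_trans (ler_norm _) h.
Qed.

(** The brackets [u j - 2 k / 2^j] and [u j + 2 k / 2^j] are monotone and nested, so the supremum of
    the lower ones is the limit, with an explicit rate. That rate, uniform in time, keeps the Picard
    limit continuous. *)
Lemma geometric_limit (u : nat -> R) (k : R) :
  (forall j, `|u j.+1 - u j| <= k * 2^-1 ^+ j) ->
  exists l : R, forall j, `|u j - l| <= 2 * k * 2^-1 ^+ j.
Proof.
move=> hu.
pose lo j := u j - 2 * k * 2^-1 ^+ j; pose up j := u j + 2 * k * 2^-1 ^+ j.
have lo1 j : lo j <= lo j.+1.
  have := hu j; rewrite /lo exprS ler_norml => /andP[+ _].
  by set x := _ ^+ j; lra.
have up1 j : up j.+1 <= up j.
  have := hu j; rewrite /up exprS ler_norml => /andP[_ +].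
  by set x := _ ^+ j; lra.
have lom i j : (i <= j)%N -> lo i <= lo j.
  by move=> /subnK <-; elim: (j - i)%N => // p /le_trans; apply; exact: lo1.
have upm i j : (i <= j)%N -> up j <= up i.
  by move=> /subnK <-; elim: (j - i)%N => // p; apply: le_trans; exact: up1.
have k0 j : 0 <= 2 * k * 2^-1 ^+ j.
  by have := le_trans (normr_ge0 _) (hu j); set x := _ * _ ^+ j; rewrite -mulrA -/x; lra.
have loup i j : lo i <= up j.
  apply: (le_trans (lom _ _ (leq_maxl i j))); apply: le_trans (upm _ _ (leq_maxr i j)).
  by rewrite /lo /up; have := k0 (maxn i j); set x := 2 * _ * _; lra.
have sl : has_sup (range lo) by split; [exists (lo 0%N), 0%N|exists (up 0%N) => _ [i _ <-]].
exists (sup (range lo)) => j; rewrite ler_norml.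
have h1 : lo j <= sup (range lo) by apply: sup_upper_bound => //; exists j.
have h2 : sup (range lo) <= up j.
  by apply: sup_le_ub => [|_ [i _ <-]//]; case: sl.
by move: h1 h2; rewrite /lo /up; set x := 2 * _ * _; lra.
Qed.

Lemma norm_mulmx_le m n p (M : 'M[R]_(m, n)) (N : 'M[R]_(n, p)) (k l : R) i j :
  (forall i j, `|M i j| <= k) -> (forall i, `|N i j| <= l) ->
  `|(M *m N) i j| <= n%:R * k * l.
Proof.
move=> hM hN; rewrite mxE (le_trans (ler_norm_sum _ _ _))//.
apply: (@le_trans _ _ (\sum_(h < n) k * l)).
  by apply: ler_sum => h _; rewrite normrM ler_pM.
by rewrite sumr_const card_ord -mulrA [leRHS]mulr_natl.
Qed.

(* Picard iteration, a contraction for a sup norm with exponential weight. *)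
Lemma linear_ode n (a b : R) (M : R -> 'M[R]_n) (v : 'cV[R]_n) : a < b ->
  mxcont a b M -> exists q : R -> 'cV[R]_n,
  [/\ mxcont a b q, q a = v & forall t, a < t < b -> mxder q t (M t *m q t)].
Proof.
move=> ab cM; have [k k0 Mk] := mxcont_bounded cM.
pose step (f : R -> 'cV[R]_n) t := v + mxint a t (fun u => M u *m f u).
pose qs := fix qs (j : nat) : R -> 'cV[R]_n := if j is j.+1 then step (qs j) else fun=> v.
have stepc f : mxcont a b f -> mxcont a b (step f).
  move=> cf; apply: mxcontD; first exact: mxcont_cst.
  exact: (mxint_antiderivative ab (mxcontM cM cf)).1.
have stepd f : mxcont a b f -> forall t, a < t < b -> mxder (step f) t (M t *m f t).
  move=> cf t tab; rewrite -[_ *m _]add0r; apply: mxderD; first exact: mxder_cst.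
  exact: (mxint_antiderivative ab (mxcontM cM cf)).2.
have stepa f : step f a = v by rewrite /step mxint_point addr0.
have cq j : mxcont a b (qs j).
  by elim: j => [|j IH] /=; [exact: mxcont_cst|exact: stepc].
have [c c0 hc] := mxcont_bounded (mxcontB (cq 1%N) (cq 0%N)).
(* Integrating the weight [expR (l * (t - a))] against a matrix with entries bounded by [k] costs a
   factor [n%:R * k / l], which this [l] keeps at most 1/2; the [+ 1] makes [l] positive even when
   [n = 0]. *)
pose l := 2 * n%:R * k + 1.
have l0 : 0 < l by rewrite ltr_pwDr// mulr_ge0 ?(ltW k0)// mulr_ge0.
have nk : n%:R * k <= l / 2 by rewrite /l; lra.
have dq j t i : a <= t <= b ->
    `|qs j.+1 t i ord0 - qs j t i ord0| <= c * 2^-1 ^+ j * expR (l * (t - a)).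
  elim: j t i => [|j IH] t i tab.
    have := hc t tab i ord0; rewrite [X in `|X|]mxE [X in _ + X]mxE => h.
    rewrite expr0 mulr1; apply: (le_trans h); rewrite ler_peMr ?(ltW c0)//.
    case/andP: tab => at_ _.
    by rewrite -expR0 ler_expR mulr_ge0 ?(ltW l0)// subr_ge0.
  pose D := c * 2^-1 ^+ j.+1; rewrite -/D.
  pose h s := D * expR (l * (s - a)).
  pose g s := qs j.+2 s i ord0 - qs j.+1 s i ord0.
  pose dg s := (M s *m qs j.+1 s) i ord0 - (M s *m qs j s) i ord0.
  have hder (s : R) : is_derive s 1 h (D * (l * expR (l * (s - a)))).
    exact: is_derive_expR_affine.
  have hcont : {within `[a, t], continuous h}.
    apply: derivable_within_continuous => s _; exact: (@ex_derive _ _ _ _ _ _ _ (hder s)).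
  have gder (s : R) : a < s < b -> is_derive s 1 g (dg s).
    move=> sab; apply: (is_derive_congr _ _ (is_deriveB (stepd _ (cq j.+1) s sab i ord0) (stepd _ (cq j) s sab i ord0))) => //.
  have gcont : {within `[a, t], continuous g}.
    case/andP: tab => at_ tb.
    have := mxcontB (mxcontS (lexx a) tb (cq j.+2)) (mxcontS (lexx a) tb (cq j.+1)).
    by move=> /(_ i ord0); apply: within_congr => s; rewrite [LHS]mxE [X in _ + X]mxE.
  have dgh s : a < s < b -> `|dg s| <= D * (l * expR (l * (s - a))).
    move=> sab; rewrite /dg (_ : _ - _ = (M s *m (qs j.+1 s - qs j s)) i ord0); last first.
      by rewrite mulmxBr [RHS]mxE [X in _ = _ + X]mxE.
    have sab' : a <= s <= b by case/andP: sab => /ltW-> /ltW->.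
    apply: (le_trans (@norm_mulmx_le _ _ _ _ _ k (c * 2^-1 ^+ j * expR (l * (s - a))) _ _ (Mk s sab') _)).
      by move=> p; rewrite mxE [X in _ + X]mxE; exact: IH.
    rewrite /D exprS; set x := _ ^+ j; set y := expR _.
    rewrite (_ : c * (2^-1 * x) * (l * y) = (l / 2) * (c * x * y)); last by ring.
    rewrite ler_wpM2r// mulr_ge0 ?expR_ge0// mulr_ge0 ?(ltW c0)// exprn_ge0// invr_ge0//.
  case/andP: (tab) => at_ tb.
  have ga : g a = 0 by rewrite /g /= !stepa subrr.
  have ha : 0 <= h a.
    by rewrite /h subrr mulr0 expR0 mulr1 mulr_ge0 ?(ltW c0)// exprn_ge0// invr_ge0.
  have sub s : a < s < t -> a < s < b by case/andP => -> /lt_le_trans ->.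
  rewrite ler_norml; apply/andP; split.
    rewrite -subr_ge0 opprK -/(g t) -/(h t).
    have := @derive_nondecr a t (g \+ h) (fun s => dg s + D * (l * expR (l * (s - a)))) at_.
    move=> H; apply: le_trans (H _ _ _).
    - by rewrite /= ga add0r.
    - by move=> s /sub sab; exact: (is_deriveD (gder s sab) (hder s)).
    - by move=> s; apply: cvgD; [exact: gcont|exact: hcont].
    - by move=> s /sub/dgh; rewrite ler_norml => /andP[+ _]; lra.
  rewrite -subr_ge0 -/(g t) -/(h t).
  have := @derive_nondecr a t (h \- g) (fun s => D * (l * expR (l * (s - a))) - dg s) at_.
  move=> H; apply: le_trans (H _ _ _).
  - by rewrite /= ga subr0.
  - by move=> s /sub sab; exact: (is_deriveB (hder s) (gder s sab)).
  - by move=> s; apply: cvgB; [exact: hcont|exact: gcont].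
  - by move=> s /sub/dgh; rewrite ler_norml => /andP[_]; lra.
pose K := c * expR (l * (b - a)).
have dqK t i : a <= t <= b -> forall j, `|qs j.+1 t i ord0 - qs j t i ord0| <= K * 2^-1 ^+ j.
  move=> tab j; apply: (le_trans (dq j t i tab)).
  rewrite /K -!mulrA ler_wpM2l ?(ltW c0)// mulrC ler_wpM2r ?exprn_ge0 ?invr_ge0//.
  by rewrite ler_expR ler_wpM2l ?(ltW l0)// lerB//; case/andP: tab.
have lim t i : a <= t <= b -> exists x : R, forall j, `|qs j t i ord0 - x| <= 2 * K * 2^-1 ^+ j.
  by move=> tab; exact: geometric_limit (dqK t i tab).
pose q t : 'cV[R]_n := \col_i xget 0 [set x : R | forall j, `|qs j t i ord0 - x| <= 2 * K * 2^-1 ^+ j].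
have hq t i j : a <= t <= b -> `|qs j t i ord0 - q t i ord0| <= 2 * K * 2^-1 ^+ j.
  by move=> tab; rewrite mxE; have /xgetPex-/(_ 0) := lim t i tab; apply.
have cQ : mxcont a b q.
  move=> i j; rewrite ord1; apply: within_uniform_limit => e e0.
  have [N hN] := geometric_small (2 * K) e0.
  exists (fun t => qs N t i ord0); first exact: cq.
  by move=> t tab; rewrite distrC (le_trans (hq _ _ _ _)).
have K0 : 0 <= K by rewrite mulr_ge0 ?expR_ge0 ?(ltW c0).
(* [q] is compared with [step q] through the iterate [qs N.+1 = step (qs N)]: both differences are
   of order [2^-N]. *)
have qE t : a <= t <= b -> step q t = q t.
  move=> tab; apply/matrixP => i j; rewrite ord1.
  apply/eqP; rewrite -subr_eq0 -normr_le0; apply/ler_addgt0Pr => e e0; rewrite add0r.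
  have [N hN] := geometric_small (n%:R * k * (2 * K) * (b - a) + 2 * K) e0.
  apply: le_trans hN.
  rewrite (_ : _ - _ = (step q t i ord0 - qs N.+1 t i ord0) + (qs N.+1 t i ord0 - q t i ord0)); last by ring.
  apply: (le_trans (ler_normD _ _)); rewrite mulrDl lerD//; last first.
    apply: (le_trans (hq _ _ _ tab)); apply: ler_wpM2l; first exact: mulr_ge0.
    rewrite exprS; by rewrite ler_piMl ?exprn_ge0 ?invr_ge0// invf_le1// ler1n.
  case/andP: (tab) => at_ tb.
  have := @derive_norm_le a t (n%:R * k * (2 * K * 2^-1 ^+ N)) (fun s => step q s i ord0 - qs N.+1 s i ord0) (fun s => (M s *m q s) i ord0 - (M s *m qs N s) i ord0) at_.
  have sub s : a < s < t -> a < s < b by case/andP => -> /lt_le_trans ->.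
  rewrite /= !stepa subrr subr0 => H; apply: le_trans (H _ _ _) _.
  - by move=> s /sub sab; exact: (is_deriveB (stepd _ cQ s sab i ord0) (stepd _ (cq N) s sab i ord0)).
  - have := mxcontB (mxcontS (lexx a) tb (stepc _ cQ)) (mxcontS (lexx a) tb (cq N.+1)).
    by move=> /(_ i ord0); apply: within_congr => s; rewrite [LHS]mxE [X in _ + X]mxE.
  - move=> s /sub sab.
    have sab' : a <= s <= b by case/andP: sab => /ltW-> /ltW->.
    rewrite (_ : _ - _ = (M s *m (q s - qs N s)) i ord0); last first.
      by rewrite mulmxBr [RHS]mxE [X in _ = _ + X]mxE.
    apply: norm_mulmx_le; first exact: Mk.
    by move=> p; rewrite mxE [X in _ + X]mxE distrC; exact: hq.
  - set y := 2^-1 ^+ N; have y0 : 0 <= y by rewrite exprn_ge0// invr_ge0.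
    rewrite (_ : _ * (t - a) = n%:R * k * (2 * K) * (t - a) * y); last by ring.
    apply: ler_wpM2r => //; apply: ler_wpM2l; last exact: lerB.
    by apply: mulr_ge0; apply: mulr_ge0 => //; exact: ltW.
(* [q] is a pointwise choice, known to equal [step q] on [[a, b]] only; the representative whose
   derivative the fundamental theorem provides is [step q]. *)
exists (step q); split; [exact: stepc|exact: stepa|].
move=> t tab; rewrite qE; last by case/andP: tab => /ltW-> /ltW->.
exact: stepd.
Qed.

Lemma within_reflect (a b : R) (f : R -> R) :
  {within `[a, b], continuous f} -> {within `[a, b], continuous (fun t => f (a + b - t))}.
Proof.
move=> /subspace_continuousP cf; apply/subspace_continuousP => x /= xab.
apply/cvgrPdist_le => e e0.
have x'ab : `[a, b]%classic (a + b - x).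
  by move: xab; rewrite /= !in_itv/=; lra.
have /cvgrPdist_le/(_ e e0) := cf _ x'ab; rewrite /within/= => -[d /= d0 hd].
exists d => //= y xy yab; apply: hd; last by move: yab; rewrite /= !in_itv/=; lra.
by rewrite /= (_ : _ - _ = y - x) 1?distrC//; ring.
Qed.

Lemma within_shift (a b c : R) (f : R -> R) :
  {within `[a, b], continuous f} -> {within `[a - c, b - c], continuous (fun t => f (c + t))}.
Proof.
move=> /subspace_continuousP cf; apply/subspace_continuousP => x /= xab.
apply/cvgrPdist_le => e e0.
have x'ab : `[a, b]%classic (c + x).
  by move: xab; rewrite /= !in_itv/=; lra.
have /cvgrPdist_le/(_ e e0) := cf _ x'ab; rewrite /within/= => -[d /= d0 hd].
exists d => //= y xy yab; apply: hd; last by move: yab; rewrite /= !in_itv/=; lra.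
by rewrite /= (_ : _ - _ = x - y)//; ring.
Qed.

Lemma is_derive_reflect (c t d : R) (f : R -> R) :
  is_derive (c - t) 1 f d -> is_derive t 1 (fun t => f (c - t)) (- d).
Proof.
move=> fd; have h : is_derive t 1 (fun t : R => c - t) (-1).
  by rewrite -[-1]add0r; apply: is_deriveB.
by have := @is_derive1_comp _ f (fun t => c - t) t _ _ fd h; rewrite mulrN1.
Qed.

Lemma is_derive_translate (c t d : R) (f : R -> R) :
  is_derive (c + t) 1 f d -> is_derive t 1 (fun t => f (c + t)) d.
Proof.
move=> fd; have h : is_derive t 1 (fun t : R => c + t) 1.
  by rewrite -[X in is_derive _ _ _ X]add0r; apply: is_deriveD.
by have := @is_derive1_comp _ f (fun t => c + t) t _ _ fd h; rewrite mulr1.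
Qed.

Lemma linear_ode_backward n (a b : R) (M : R -> 'M[R]_n) (v : 'cV[R]_n) : a < b ->
  mxcont a b M -> exists q : R -> 'cV[R]_n,
  [/\ mxcont a b q, q b = v & forall t, a < t < b -> mxder q t (M t *m q t)].
Proof.
move=> ab cM.
have cM' : mxcont a b (fun t => - M (a + b - t)).
  by apply: mxcontN => i j; exact: within_reflect (cM i j).
have [q [cq qa dq]] := linear_ode v ab cM'.
exists (fun t => q (a + b - t)); split.
- by move=> i j; exact: within_reflect (cq i j).
- by rewrite addrK.
- move=> t tab i j; have tab' : a < a + b - t < b by lra.
  have := is_derive_reflect (dq _ tab' i j); apply: is_derive_congr => //.
  by rewrite (_ : a + b - (a + b - t) = t); [rewrite mulNmx [X in - X]mxE opprK|ring].
Qed.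

Lemma is_derive_quadform n (q : R -> 'cV[R]_n) (D : R -> 'M[R]_n) (F G : 'M[R]_n) t :
  mxder q t (- (F^T *m q t)) -> mxder D t (F *m D t + D t *m F^T + G) ->
  is_derive t 1 (fun s => quadform (D s) (q s)) (quadform G (q t)).
Proof.
move=> hq hD; have := mxderM (mxderM (mxderT hq) hD) hq => /(_ ord0 ord0).
apply: is_derive_congr => //; congr (_ _ _).
rewrite linearN/= trmx_mul trmxK mulNmx !mulmxDr !mulmxN !mulmxDl !mulNmx !mulmxA.
by rewrite -[X in - _ + X]addrA addKr addrAC addrN add0r.
Qed.

Lemma mxcont_quadform n a b (D : R -> 'M[R]_n) (q : R -> 'cV[R]_n) :
  mxcont a b D -> mxcont a b q ->
  {within `[a, b], continuous (fun s => quadform (D s) (q s))}.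
Proof.
move=> cD cq; have := mxcontM (mxcontM (mxcontT cq) cD) cq.
by move=> /(_ ord0 ord0).
Qed.

(* Along the dual path q' = - F^T q the derivative of q^T D q is q^T G q. *)
Lemma lyapunov_quadform_ge0 n (a b : R) (F D G : R -> 'M[R]_n) v : a <= b ->
  mxcont a b F -> mxcont a b D ->
  (forall t, a < t < b -> mxder D t (F t *m D t + D t *m (F t)^T + G t)) ->
  (forall t w, a < t < b -> 0 <= quadform (G t) w) ->
  (forall w, 0 <= quadform (D a) w) -> 0 <= quadform (D b) v.
Proof.
rewrite le_eqVlt => /predU1P[->//|ab] cF cD dD G0 Da.
have [q [cq qb dq]] := linear_ode_backward v ab (mxcontN (mxcontT cF)).
rewrite -qb; apply: (le_trans (Da (q a))).
apply: (@derive_nondecr a b (fun s => quadform (D s) (q s)) (fun s => quadform (G s) (q s))).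
- exact: ltW.
- move=> x xab; apply: is_derive_quadform (dD x xab).
  by have := dq x xab; rewrite mulNmx.
- exact: mxcont_quadform.
- by move=> x xab; exact: G0.
Qed.

End MatrixPaths.

(** * Matrix exponential, Gramians and lower bounds for Riccati flows *)

Section MatrixExponential.
Context {R : realType}.

Lemma cvg_mx m n (u : nat -> 'M[R]_(m, n)) (L : 'M[R]_(m, n)) :
  (forall i j, (fun k => u k i j) @ \oo --> L i j) -> u @ \oo --> L.
Proof.
move=> h A [P hP PA].
suff : \forall k \near \oo, forall i j, P i j (u k i j).
  by apply: filterS => k; exact: (PA (u k)).
apply: filter_forall => i; apply: filter_forall => j.
exact: (h i j (P i j) (hP i j)).
Qed.

Lemma norm_expr_mx n (A : 'M[R]_n) : exists c : R, 0 < c /\ forall k i j, `|(A ^+ k) i j| <= c ^+ k.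
Proof.
pose K := \sum_i \sum_j `|A i j|.
have K0 : 0 <= K by apply: sumr_ge0 => i _; exact: sumr_ge0.
have AK i j : `|A i j| <= K.
  rewrite /K (bigD1 i)//= (bigD1 j)//=.
  set x := \sum_(_ < _ | _) _; set y := \sum_(_ < _ | _) _.
  have x0 : 0 <= x by exact: sumr_ge0.
  have y0 : 0 <= y by apply: sumr_ge0 => l _; exact: sumr_ge0.
  by rewrite -/x -/y; lra.
exists (n%:R * K + 1); split; first by rewrite ltr_pwDr// mulr_ge0.
elim=> [|k IH] i j.
  by rewrite !expr0 mxE; case: eqP => _; rewrite ?normr1 ?normr0.
rewrite [A ^+ _]exprS -[A * _]/(A *m _) [X in _ <= X]exprS; apply: (le_trans (norm_mulmx_le i AK (fun i => IH i j))).
rewrite mulrDl lerDl mul1r exprn_ge0// addr_ge0// mulr_ge0//.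
Qed.

Lemma exprZ_mx n (A : 'M[R]_n) (x : R) k : (x *: A) ^+ k = x ^+ k *: A ^+ k.
Proof.
elim: k => [|k IH]; first by rewrite !expr0 scale1r.
rewrite [LHS]exprS IH -[_ * _]/(_ *m _) -scalemxAl -scalemxAr scalerA -exprS.
by rewrite [A ^+ k.+1]exprS.
Qed.

Lemma cvg_bigsum (I : finType) (u : I -> nat -> R) (L : I -> R) :
  (forall l, u l @ \oo --> L l) ->
  (fun N => \sum_l u l N) @ \oo --> \sum_l L l.
Proof.
move=> h; elim: (index_enum I) => [|l s IH].
  rewrite big_nil (_ : (fun _ => _) = cst 0); first exact: cvg_cst.
  by apply/funext => N; rewrite big_nil.
rewrite big_cons (_ : (fun _ => _) = (fun N => u l N + \sum_(l <- s) u l N)).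
  by apply: cvgD.
by apply/funext => N; rewrite big_cons.
Qed.

(** The entry [(i, j)] of [expmx (x *: A)] is the real power series in [x] with these coefficients,
    so that termwise differentiation of scalar series applies. *)
Definition expmx_coef n (A : 'M[R]_n) i j : nat -> R := fun k => (A ^+ k) i j / k`!%:R.

Lemma is_cvg_expmx_coef n (A : 'M[R]_n) i j (x : R) : cvgn (pseries (expmx_coef A i j) x).
Proof.
have [c [c0 hc]] := norm_expr_mx A.
apply: normed_cvg; apply: (@series_le_cvg _ _ (exp_coeff (c * `|x|))).
- by move=> k; exact: normr_ge0.
- by move=> k; apply: exp_coeff_ge0; rewrite mulr_ge0// ltW.
- move=> k; rewrite /expmx_coef /exp_coeff/= exprMn normrM normrX.
  rewrite normrM normfV [`|k`!%:R|]ger0_norm// mulrAC.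
  by rewrite ler_wpM2r ?invr_ge0// ler_wpM2r ?exprn_ge0.
- exact: is_cvg_series_exp_coeff.
Qed.

Lemma expmx_coefE n (A : 'M[R]_n) i j (x : R) :
  expmx (x *: A) i j = limn (pseries (expmx_coef A i j) x).
Proof.
have h : series (fun k => k`!%:R^-1 *: (x *: A) ^+ k) @ \oo -->
   (\matrix_(i, j) limn (pseries (expmx_coef A i j) x) : 'M[R]_n).
  apply: cvg_mx => k l; rewrite mxE.
  rewrite (_ : (fun _ => _) = pseries (expmx_coef A k l) x).
    exact: is_cvg_expmx_coef.
  apply/funext => N; rewrite /series/= summxE; apply: eq_bigr => p _.
  by rewrite exprZ_mx mxE [X in _ * X]mxE /expmx_coef/=; ring.
by rewrite /expmx (cvg_lim _ h)// mxE.
Qed.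

Lemma pseries_diffs_expmx_coef n (A : 'M[R]_n) i j k :
  pseries_diffs (expmx_coef A i j) k = \sum_l A i l * expmx_coef A l j k.
Proof.
rewrite /pseries_diffs /expmx_coef factS natrM invfM exprS mxE !mulr_suml mulr_sumr.
apply: eq_bigr => l _; field.
by rewrite pnatr_eq0 -lt0n fact_gt0/= addrC natr1 pnatr_eq0.
Qed.

Lemma pseries_sum (I : finType) (c : I -> R) (f : I -> nat -> R) (x : R) :
  (forall l, cvgn (pseries (f l) x)) ->
  pseries (fun k => \sum_l c l * f l k) x @ \oo --> \sum_l c l * limn (pseries (f l) x).
Proof.
move=> cf; rewrite (_ : pseries _ x = (fun N => \sum_l c l * pseries (f l) x N)).
  by apply: cvg_bigsum => l; apply: cvgMr; exact: cf.
apply/funext => N; rewrite /pseries /series/=.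
under [RHS]eq_bigr do rewrite mulr_sumr.
rewrite exchange_big/=; apply: eq_bigr => k _.
by rewrite mulr_suml; apply: eq_bigr => l _; rewrite mulrA.
Qed.

Lemma lim_pseries_sum (I : finType) (c : I -> R) (f : I -> nat -> R) (x : R) :
  (forall l, cvgn (pseries (f l) x)) ->
  limn (pseries (fun k => \sum_l c l * f l k) x) = \sum_l c l * limn (pseries (f l) x).
Proof. by move=> cf; apply: cvg_lim => //; exact: pseries_sum. Qed.

(** Termwise differentiation asks for convergence of the series and of its first two formal
    derivatives. By [pseries_diffs_expmx_coef] a formal derivative is a linear combination of the
    series of the entries, so all of them converge. *)
Lemma mxder_expmx n (A : 'M[R]_n) (t : R) :
  mxder (fun s => expmx (s *: A)) t (A *m expmx (t *: A)).
Proof.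
have dE i j : pseries_diffs (expmx_coef A i j) = fun k => \sum_l A i l * expmx_coef A l j k.
  by apply/funext => k; exact: pseries_diffs_expmx_coef.
have dC i j x : cvgn (pseries (pseries_diffs (expmx_coef A i j)) x).
  rewrite dE; apply/cvg_ex; eexists; apply: pseries_sum => l; exact: is_cvg_expmx_coef.
move=> i j.
apply: (@is_derive_congr _ (fun s => limn (pseries (expmx_coef A i j) s)) _ _
   (limn (pseries (pseries_diffs (expmx_coef A i j)) t))).
- by move=> s; rewrite expmx_coefE.
- rewrite dE lim_pseries_sum; last first.
    by move=> l; exact: is_cvg_expmx_coef.
  by rewrite [RHS]mxE; apply: eq_bigr => l _; rewrite expmx_coefE.
- apply: (@pseries_snd_diffs _ _ (`|t| + 1)).
  + exact: is_cvg_expmx_coef.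
  + exact: dC.
  + rewrite dE (_ : pseries_diffs _ = fun k => \sum_l A i l * pseries_diffs (expmx_coef A l j) k).
      by apply/cvg_ex; eexists; apply: pseries_sum => l; exact: dC.
    apply/funext => k; rewrite /pseries_diffs mulr_sumr.
    by apply: eq_bigr => l _; ring.
  + by rewrite [ltRHS]ger0_norm ?addr_ge0// ltrDl.
Qed.

Lemma trmx_expmx n (A : 'M[R]_n) (t : R) : (expmx (t *: A))^T = expmx (t *: A^T).
Proof.
apply/matrixP => i j; rewrite mxE !expmx_coefE; congr (limn (pseries _ t)).
apply/funext => k; rewrite /expmx_coef; congr (_ / _).
have -> : A^T ^+ k = (A ^+ k)^T; last by rewrite mxE.
elim: k => [|k IH]; first by rewrite !expr0 trmx1.
by rewrite exprS IH [in RHS]exprSr [RHS]trmx_mul.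
Qed.

Lemma expmx0 n (A : 'M[R]_n) : expmx (0 *: A) = 1%:M.
Proof.
apply/matrixP => i j; rewrite expmx_coefE.
apply: cvg_lim => //; apply: cvg_near_cst.
near=> N; rewrite /pseries /series/=.
have N0 : (0 < N)%N by near: N; exists 1%N.
rewrite big_ltn// big1_seq ?addr0.
  by rewrite expr0 mulr1 /expmx_coef expr0 fact0 divr1.
move=> k /andP[_]; rewrite mem_index_iota => /andP[k0 _].
by rewrite expr0n gtn_eqF// mulr0.
Unshelve. all: by end_near. Qed.

Lemma expmx_comm n (A : 'M[R]_n) (t : R) : A *m expmx (t *: A) = expmx (t *: A) *m A.
Proof.
apply/matrixP => i j; rewrite !mxE.
under eq_bigr do rewrite expmx_coefE.
under [RHS]eq_bigr do rewrite expmx_coefE mulrC.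
rewrite -lim_pseries_sum; last by move=> l; exact: is_cvg_expmx_coef.
rewrite -lim_pseries_sum; last by move=> l; exact: is_cvg_expmx_coef.
congr (limn (pseries _ t)); apply/funext => k; rewrite /expmx_coef.
have := congr1 (fun M : 'M[R]_n => M i j / k`!%:R) (etrans (esym (exprS A k)) (exprSr A k)).
rewrite !mxE !mulr_suml => h.
under eq_bigr do rewrite mulrA.
by rewrite h; apply: eq_bigr => l _; ring.
Qed.

Lemma is_derive_within (f : R -> R) (df : R -> R) (a b : R) :
  (forall t : R, is_derive t 1 f (df t)) -> {within `[a, b], continuous f}.
Proof.
by move=> h; apply: derivable_within_continuous => t _; exact: (@ex_derive _ _ _ _ _ _ _ (h t)).
Qed.

Lemma mxcont_expmx n (A : 'M[R]_n) (a b : R) : mxcont a b (fun s => expmx (s *: A)).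
Proof.
by move=> i j; apply: (@is_derive_within _ (fun t => (A *m expmx (t *: A)) i j)) => t;
  exact: mxder_expmx.
Qed.

Lemma mxder_reflect m n (f : R -> 'M[R]_(m, n)) (c t : R) d :
  mxder f (c - t) d -> mxder (fun s => f (c - s)) t (- d).
Proof.
by move=> h i j; rewrite mxE; exact: is_derive_reflect (h i j).
Qed.

Lemma mxder_shift m n (f : R -> 'M[R]_(m, n)) (c t : R) d :
  mxder f (c + t) d -> mxder (fun s => f (c + s)) t d.
Proof. by move=> h i j; exact: (@is_derive_translate _ c t _ (fun s => f s i j) (h i j)). Qed.

Lemma mxcont_translate m n (f : R -> 'M[R]_(m, n)) (a b c : R) :
  mxcont a b f -> mxcont (a - c) (b - c) (fun s => f (c + s)).
Proof. by move=> h i j; exact: (@within_shift _ a b c (fun s => f s i j) (h i j)). Qed.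

Lemma mxcont_reflect m n (f : R -> 'M[R]_(m, n)) (a b : R) :
  mxcont a b f -> mxcont a b (fun s => f (a + b - s)).
Proof. by move=> h i j; exact: (within_reflect (h i j)). Qed.

Lemma mx_path_eq m n (a b : R) (f g d : R -> 'M[R]_(m, n)) : a <= b ->
  mxcont a b f -> mxcont a b g -> f a = g a ->
  (forall t, a < t < b -> mxder f t (d t)) ->
  (forall t, a < t < b -> mxder g t (d t)) -> f b = g b.
Proof.
move=> ab cf cg fga df dg; apply/matrixP => i j; apply/eqP.
rewrite -subr_eq0 -normr_le0 -(mul0r (b - a)).
rewrite (_ : f b i j - g b i j = (f b i j - g b i j) - (f a i j - g a i j)); last first.
  by rewrite fga subrr subr0.
apply: (@derive_norm_le _ a b 0 (fun s => f s i j - g s i j) (fun=> 0)) => //.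
- move=> x xab; rewrite -(subrr (d x i j)).
  exact: (is_deriveB (df x xab i j) (dg x xab i j)).
- by move=> x; apply: cvgB; [exact: cf|exact: cg].
- by move=> x _; rewrite normr0.
Qed.

End MatrixExponential.

(** * Controllability Gramian and uniform lower bound for the Riccati flow *)

Section RiccatiBounds.
Context {R : realType} {n : nat}.
Implicit Types (A S Rm : 'M[R]_n).

Lemma invmx_psd m (M : 'M[R]_m) : posdef M -> psd (invmx M).
Proof.
move=> pM; have uM := posdef_unit pM; have [sM _] := pM; split.
  by rewrite /symmx trmx_inv sM.
move=> v; have -> : invmx M = (invmx M)^T *m M *m invmx M.
  by rewrite trmx_inv sM mulVmx// mul1mx.
by rewrite quadform_conj; have [_] := posdef_psd pM; apply.
Qed.

Lemma conj_psd m p (M : 'M[R]_m) (N : 'M[R]_(m, p)) : psd M -> psd (N^T *m M *m N).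
Proof.
move=> [sM pM]; split; first by rewrite /symmx !trmx_mul trmxK sM mulmxA.
by move=> v; rewrite quadform_conj.
Qed.

Lemma psdD m (M N : 'M[R]_m) : psd M -> psd N -> psd (M + N).
Proof.
move=> [sM pM] [sN pN]; split; first by rewrite /symmx linearD/= sM sN.
by move=> v; rewrite quadformD addr_ge0.
Qed.

Lemma mxcont_gram A Rm (t : R) :
  mxcont 0 t (fun s => expmx (s *: A) *m Rm *m expmx (s *: A^T)).
Proof.
by apply: mxcontM; [apply: mxcontM; [exact: mxcont_expmx|exact: mxcont_cst]|exact: mxcont_expmx].
Qed.

Lemma mxder_gram A Rm (t : R) :
  mxder (fun s => expmx (s *: A) *m Rm *m expmx (s *: A^T)) t
    (A *m (expmx (t *: A) *m Rm *m expmx (t *: A^T)) +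
     (expmx (t *: A) *m Rm *m expmx (t *: A^T)) *m A^T).
Proof.
have := mxderM (mxderM (mxder_expmx A t) (mxder_cst Rm t)) (mxder_expmx A^T t).
apply: mxder_congr => //.
by rewrite mulmx0 addr0 (expmx_comm A^T) !mulmxA.
Qed.

Lemma ctl_gram_sym A Rm (t : R) : symmx Rm -> (ctl_gram A Rm t)^T = ctl_gram A Rm t.
Proof.
move=> sR; apply/matrixP => i j; rewrite !mxE; apply: eq_Rintegral => s _.
have : (expmx (s *: A) *m Rm *m expmx (s *: A^T))^T =
    expmx (s *: A) *m Rm *m expmx (s *: A^T).
  by rewrite !trmx_mul sR !trmx_expmx trmxK mulmxA.
by move=> /matrixP/(_ i j); rewrite mxE.
Qed.

Lemma mxcont_ctl_gram A Rm (t : R) : 0 < t -> mxcont 0 t (ctl_gram A Rm).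
Proof. by move=> t0; exact: (mxint_antiderivative t0 (@mxcont_gram A Rm t)).1. Qed.

(** The fundamental theorem gives the integrand as derivative. That integrand and the Lyapunov
    expression agree at 0 and have the same derivative, hence coincide. *)
Lemma mxder_ctl_gram A Rm (t s : R) : 0 < s < t ->
  mxder (ctl_gram A Rm) s (A *m ctl_gram A Rm s + ctl_gram A Rm s *m A^T + Rm).
Proof.
move=> st; have /andP[s0 s1] := st; have t0 := lt_trans s0 s1.
have E (u : R) : 0 < u -> expmx (u *: A) *m Rm *m expmx (u *: A^T) =
    A *m ctl_gram A Rm u + ctl_gram A Rm u *m A^T + Rm.
  move=> u0; apply: (@mx_path_eq _ _ _ 0 u
    (fun s => expmx (s *: A) *m Rm *m expmx (s *: A^T))
    (fun u => A *m ctl_gram A Rm u + ctl_gram A Rm u *m A^T + Rm)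
    (fun t => A *m (expmx (t *: A) *m Rm *m expmx (t *: A^T)) +
     (expmx (t *: A) *m Rm *m expmx (t *: A^T)) *m A^T)) => //.
  - exact: ltW.
  - exact: mxcont_gram.
  - apply: mxcontD; last exact: mxcont_cst.
    have h := @mxcont_ctl_gram A Rm _ u0.
    by apply: mxcontD; apply: mxcontM => //; exact: mxcont_cst.
  - by rewrite !expmx0 mul1mx mulmx1 /ctl_gram mxint_point mulmx0 mul0mx !add0r.
  - by move=> x _; exact: mxder_gram.
  - move=> x xu; have h := (mxint_antiderivative u0 (@mxcont_gram A Rm u)).2 x xu.
    have := mxderD (mxderD (mxderM (mxder_cst A x) h) (mxderM h (mxder_cst A^T x))) (mxder_cst Rm x).
    by apply: mxder_congr => //; rewrite mul0mx mulmx0 add0r !addr0.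
have := (mxint_antiderivative t0 (@mxcont_gram A Rm t)).2 s st.
by rewrite E.
Qed.

(** The scalar content of the implication from [C >= c] to [C^-1 <= c^-1]. It is applied with
    [w = C y], [a = y^T C y], [x = |w|] and [u = |y|]. *)
Lemma quadratic_inverse_bound (a x u c : R) : 0 < c -> 0 <= x -> 0 <= u ->
  c * u ^+ 2 <= a -> a <= x * u -> a <= c^-1 * x ^+ 2.
Proof.
move=> c0 x0 u0 h1 h2; rewrite ler_pdivlMl//.
have [u_eq|u_ne] := eqVneq u 0.
  apply: (@le_trans _ _ 0); last exact: sqr_ge0.
  by rewrite pmulr_rle0// (le_trans h2)// u_eq mulr0.
have u_p : 0 < u by rewrite lt_def u_ne.
have cux : c * u <= x by rewrite -(ler_pM2r u_p) -mulrA -expr2 (le_trans h1).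
apply: (@le_trans _ _ (c * (x * u))); first by rewrite ler_pM2l.
by rewrite mulrCA expr2 ler_wpM2l.
Qed.

Lemma trmxD m p (M N : 'M[R]_(m, p)) : (M + N)^T = M^T + N^T.
Proof. exact: linearD. Qed.

Lemma trmxN m p (M : 'M[R]_(m, p)) : (- M)^T = - M^T.
Proof. exact: linearN. Qed.

(** Completion of squares: this is the derivative of the functional
    [q^T P q - 2 q^T z + p^T z + \int z^T S z] along the dual path and the control pair. The left
    side is kept in the shape that the product rule produces. *)
Lemma riccati_control_identity A S Rm P (q p z : 'cV[R]_n) :
  symmx Rm -> symmx S -> symmx P ->
  (((- ((A - P *m S)^T *m q))^T *m P + q^T *m ricc A S Rm P) *m q +
     q^T *m P *m (- ((A - P *m S)^T *m q))
   - ((- ((A - P *m S)^T *m q))^T *m z + q^T *m (A *m z + Rm *m p))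
   - ((- ((A - P *m S)^T *m q))^T *m z + q^T *m (A *m z + Rm *m p))
   + ((- (A^T *m p))^T *m z + p^T *m (A *m z + Rm *m p))
   + z^T *m S *m z) ord0 ord0 =
  quadform Rm (q - p) + quadform S (P *m q - z).
Proof.
move=> sR sS sP.
have e1 : (p^T *m Rm *m q) ord0 ord0 = (q^T *m Rm *m p) (@ord0 0) (@ord0 0).
  by rewrite -[RHS]mx11T !trmx_mul trmxK sR mulmxA.
have e2 : (z^T *m S *m P *m q) ord0 ord0 = (q^T *m P *m S *m z) (@ord0 0) (@ord0 0).
  by rewrite -[RHS]mx11T !trmx_mul trmxK sP sS !mulmxA.
rewrite /quadform /ricc !(trmxD, trmxN, trmx_mul, trmxK) sP sS.
rewrite !(mulmxDl, mulmxDr, mulmxN, mulNmx, mulmxA) !(mx11D, mx11N) e1 e2.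
by ring.
Qed.

(* With p, z the optimal pair steering the dual control system from 0 to w, and
   q' = - (A - P S)^T q, q(ups) = v, the function
   q^T P q - 2 q^T z + p^T z + \int z^T S z is nondecreasing and nonnegative at 0.
   At time ups this reads 2 v^T w <= v^T P v + w^T (O(C) + C^-1) w; then
   w := v / (woC + wc^-1). No inverse of P is needed. *)
Lemma riccati_lower_bound A S Rm (ups wc woC : R) (P : R -> 'M[R]_n) v :
  0 < ups -> 0 < wc -> 0 < woC -> psd Rm -> psd S ->
  wc%:M <=L ctl_gram A Rm ups -> obs_gram_ctl A S Rm ups <=L woC%:M ->
  mxcont 0 ups P -> psd (P 0) -> (forall t, 0 < t < ups -> symmx (P t)) ->
  (forall t, 0 < t < ups -> mxder P t (ricc A S Rm (P t))) ->
  norm2 v ^+ 2 / (woC + wc^-1) <= quadform (P ups) v.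
Proof.
move=> u0 wc0 woC0 pR pS hc ho cP P0 sP dP.
pose Cu := ctl_gram A Rm ups; pose Ci := invmx Cu.
have sCu : Cu^T = Cu by apply: ctl_gram_sym; case: pR.
have Cpos : posdef Cu.
  split=> // w w0; apply: lt_le_trans (loewner_quadform w hc).
  by rewrite quadform_scalar mulr_gt0// exprn_gt0// lt_def norm2_ge0 norm2_eq0 w0.
have uC := posdef_unit Cpos.
have sCi : Ci^T = Ci by rewrite /Ci trmx_inv sCu.
have b0 : 0 < woC + wc^-1 by rewrite addr_gt0// invr_gt0.
pose w := (woC + wc^-1)^-1 *: v.
pose E s := expmx ((ups - s) *: A^T).
have cE : mxcont 0 ups E.
  have := mxcont_reflect (@mxcont_expmx _ n A^T 0 ups).
  by rewrite /E add0r.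
have dE s : mxder E s (- (A^T *m E s)).
  exact: (@mxder_reflect _ _ _ (fun s => expmx (s *: A^T)) ups s _ (mxder_expmx _ _)).
pose C s := ctl_gram A Rm s.
(* Minimal energy steering: [p' = - A^T p], and in [z = C p] the term [C A^T] of the Gramian
   equation cancels, which leaves [z' = A z + Rm p]; the factor [Ci *m w] makes [z] end at [w]. *)
pose p s := E s *m (Ci *m w).
pose z s := C s *m p s.
have cp : mxcont 0 ups p by apply: mxcontM => //; exact: mxcont_cst.
have cC : mxcont 0 ups C by exact: mxcont_ctl_gram.
have cz : mxcont 0 ups z by exact: mxcontM.
have dp s : mxder p s (- (A^T *m p s)).
  have := mxderM (dE s) (mxder_cst (Ci *m w) s).
  by apply: mxder_congr => //; rewrite mulmx0 addr0 mulNmx -mulmxA.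
have dz s : 0 < s < ups -> mxder z s (A *m z s + Rm *m p s).
  move=> su; have := mxderM (mxder_ctl_gram A Rm su) (dp s).
  apply: mxder_congr => //.
  rewrite /z !mulmxDl mulmxN !mulmxA -/(C s).
  by rewrite addrAC addrK.
pose G s := expmx ((ups - s) *: A) *m C s *m S *m C s *m E s.
have cG : mxcont 0 ups G.
  apply: mxcontM => //; apply: mxcontM => //.
  apply: mxcontM; last exact: mxcont_cst.
  apply: mxcontM => //.
  by have := mxcont_reflect (@mxcont_expmx _ n A 0 ups); rewrite add0r.
pose W s := (Ci *m w)^T *m mxint 0 s G *m (Ci *m w).
have cW : mxcont 0 ups W.
  apply: mxcontM; last exact: mxcont_cst.
  apply: mxcontM; first exact: mxcont_cst.
  exact: (mxint_antiderivative u0 cG).1.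
have dW s : 0 < s < ups -> mxder W s ((z s)^T *m S *m z s).
  move=> su; have h := (mxint_antiderivative u0 cG).2 s su.
  have := mxderM (mxderM (mxder_cst (Ci *m w)^T s) h) (mxder_cst (Ci *m w) s).
  apply: mxder_congr => //.
  rewrite mul0mx mulmx0 add0r addr0 /G /z /p [(C s *m _)^T]trmx_mul.
  rewrite [(E s *m _)^T]trmx_mul /E trmx_expmx trmxK /C ctl_gram_sym; last by case: pR.
  by rewrite !mulmxA.
pose F s := A - P s *m S.
have cF : mxcont 0 ups F.
  by apply: mxcontB; [exact: mxcont_cst|apply: mxcontM => //; exact: mxcont_cst].
have [q [cq qu dq]] := linear_ode_backward v u0 (mxcontN (mxcontT cF)).
pose Th s := (q s)^T *m P s *m q s - (q s)^T *m z s - (q s)^T *m z s + (p s)^T *m z s + W s.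
have Th_nd : Th 0 ord0 ord0 <= Th ups ord0 ord0.
  apply: (@derive_nondecr _ 0 ups (fun s => Th s ord0 ord0)
    (fun s => quadform Rm (q s - p s) + quadform S (P s *m q s - z s))).
  - exact: ltW.
  - move=> s su.
    have dqs : mxder q s (- ((F s)^T *m q s)) by have := dq s su; rewrite mulNmx.
    have h1 := mxderM (mxderM (mxderT dqs) (dP s su)) dqs.
    have h2 := mxderM (mxderT dqs) (dz s su).
    have h3 := mxderM (mxderT (dp s)) (dz s su).
    have := mxderD (mxderD (mxderB (mxderB h1 h2) h2) h3) (dW s su) => /(_ ord0 ord0).
    apply: is_derive_congr => //.
    exact: riccati_control_identity pR.1 pS.1 (sP s su).
  - have h := mxcontM (mxcontT cq) cz.
    have := mxcontD (mxcontD (mxcontB (mxcontB (mxcontM (mxcontM (mxcontT cq) cP) cq) h) h)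
       (mxcontM (mxcontT cp) cz)) cW.
    by move=> /(_ ord0 ord0).
  - by move=> s _; rewrite addr_ge0//; [exact: pR.2|exact: pS.2].
have Th0 : 0 <= Th 0 ord0 ord0.
  rewrite /Th /W /z /C /ctl_gram !mxint_point !(mul0mx, mulmx0) !subr0 !addr0.
  exact: P0.2.
have := le_trans Th0 Th_nd.
have zu : z ups = w.
  by rewrite /z /p /E subrr expmx0 mul1mx mulmxA mulmxV// mul1mx.
have pu : p ups = Ci *m w by rewrite /p /E subrr expmx0 mul1mx.
have Wu : W ups = w^T *m obs_gram_ctl A S Rm ups *m w.
  by rewrite /W /obs_gram_ctl trmx_mul sCi -/Ci !mulmxA.
rewrite /Th qu zu pu Wu !mx11D !mx11N trmx_mul sCi => h.
have h1 := loewner_quadform w ho; rewrite quadform_scalar in h1.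
have h2 : (w^T *m Ci *m w) ord0 ord0 <= wc^-1 * norm2 w ^+ 2.
  pose y := Ci *m w; have wy : w = Cu *m y by rewrite /y mulmxA mulmxV// mul1mx.
  have a1 : (w^T *m Ci *m w) ord0 ord0 = quadform Cu y.
    by rewrite -mulmxA -/y {1}wy trmx_mul sCu.
  have a2 := loewner_quadform y hc; rewrite quadform_scalar -/Cu in a2.
  have a3 : quadform Cu y <= norm2 w * norm2 y.
    by rewrite -a1 -mulmxA (le_trans (ler_norm _))// cauchy_schwarz_dot.
  by rewrite a1; apply: (quadratic_inverse_bound _ _ _ a2 a3) => //; exact: norm2_ge0.
have wv : (v^T *m w) ord0 ord0 = (woC + wc^-1)^-1 * norm2 v ^+ 2.
  by rewrite /w -scalemxAr mxE sqr_norm2_dot.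
have ww : norm2 w ^+ 2 = (woC + wc^-1)^-1 ^+ 2 * norm2 v ^+ 2.
  by rewrite /w norm2Z exprMn real_normK ?num_real.
move: h; rewrite -/(quadform (P ups) v) -/(quadform (obs_gram_ctl A S Rm ups) w) wv.
rewrite ww in h1 h2 => h.
move: h1 h2 h; rewrite (mulrC (norm2 v ^+ 2)); set k := woC + wc^-1; move=> h1 h2 h.
have kk : k * (k^-1 ^+ 2 * norm2 v ^+ 2) = k^-1 * norm2 v ^+ 2.
  by rewrite expr2 !mulrA divff ?gt_eqF// mul1r.
move: kk; rewrite {1}/k mulrDl => kk; lra.
Qed.

End RiccatiBounds.

(** * Borel sets of R^d and uniqueness of Fourier transforms *)

Section BorelVectors.
Context {R : realType}.

Lemma continuous_bvec_measurable d (f : 'cV[R]_d -> R) : continuous f ->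
  measurable_fun setT (f : bvec R d -> R).
Proof.
move=> cf; apply: (measurability (@RGenOpens.G R)); first exact: RGenOpens.measurableE.
move=> _ [_ [a [b ->] <-]]; rewrite setTI; apply: sub_sigma_algebra.
by apply: open_comp => // x _; exact: cf.
Qed.

Lemma measurable_bvec_coord d (i : 'I_d) :
  measurable_fun setT (fun y : bvec R d => (y : 'cV[R]_d) i ord0).
Proof. by apply: continuous_bvec_measurable => y; exact: coord_continuous. Qed.

Definition rat_box d (b : {ffun 'I_d -> rat * rat}) : set 'cV[R]_d :=
  [set y | forall i, ratr (b i).1 < y i ord0 < ratr (b i).2].

Lemma open_rat_box d (U : set 'cV[R]_d) y : open U -> U y ->
  exists b, rat_box b y /\ rat_box b `<=` U.
Proof.
move=> oU Uy; have [P hP PU] : nbhs y U by exact: open_nbhs_nbhs.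
have h i : exists b : rat * rat, ratr b.1 < y i ord0 < ratr b.2 /\
    (forall x : R, ratr b.1 < x < ratr b.2 -> P i ord0 x).
  have [e /= e0 he] := hP i ord0.
  have [|p] := @rat_in_itvoo R (y i ord0 - e) (y i ord0); first by rewrite ltrBlDr ltrDl.
  have [|q] := @rat_in_itvoo R (y i ord0) (y i ord0 + e); first by rewrite ltrDl.
  rewrite !in_itv/= => /andP[q1 q2] /andP[p1 p2].
  exists (p, q); split; first by rewrite /= p2 q1.
  move=> x /= /andP[px xq]; apply: he; rewrite /= ltr_norml; lra.
pose b := [ffun i => xget (0%Q, 0%Q) [set b : rat * rat | ratr b.1 < y i ord0 < ratr b.2 /\
    (forall x : R, ratr b.1 < x < ratr b.2 -> P i ord0 x)]].
have hb i : ratr (b i).1 < y i ord0 < ratr (b i).2 /\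
    (forall x : R, ratr (b i).1 < x < ratr (b i).2 -> P i ord0 x).
  by rewrite ffunE; exact: (xgetPex _ (h i)).
exists b; split=> [i|z zb]; first by case: (hb i).
by apply: PU => i j; rewrite ord1; apply: (hb i).2; exact: zb.
Qed.

(** [bvec] carries the sigma-algebra of the open sets, not a product one. An open set is the union
    of the rational boxes that it contains, and these are countable, whence coordinates suffice; [F]
    runs through the boxes along [unpickle]. *)
Lemma measurable_fun_bvec d' (T : measurableType d') d (X : T -> 'cV[R]_d) :
  (forall i, measurable_fun setT (fun w => X w i ord0)) ->
  measurable_fun setT (X : T -> bvec R d).
Proof.
move=> mX; apply: (@measurability _ _ T (bvec R d) setT X open erefl).
move=> _ [U oU <-]; rewrite setTI.
pose F (n : nat) : set T := if unpickle n is Some b then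
  (if pselect (rat_box b `<=` U) then X @^-1` (rat_box b) else set0) else set0.
rewrite (_ : X @^-1` U = \bigcup_n F n).
  apply: bigcup_measurable => n _; rewrite /F; case: (unpickle n) => // b.
  case: pselect => [_|_] /=; last exact: measurable0.
  rewrite (_ : X @^-1` rat_box b =
    \bigcap_(i in [set: 'I_d]) ((fun w => X w i ord0) @^-1` `]ratr (b i).1, ratr (b i).2[%classic)).
    apply: fin_bigcap_measurable; first exact: finite_finset.
    by move=> i _; rewrite -[X in measurable X]setTI; apply: mX.
  apply/seteqP; split=> w /= h i; last by have := h i I; rewrite /= in_itv.
  by move=> _; have := h i; rewrite /= in_itv.
apply/seteqP; split=> w.
  move=> /(open_rat_box oU)[b [bw bU]]; exists (pickle b) => //.
  by rewrite /F pickleK; case: pselect.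
move=> [n _]; rewrite /F; case: (unpickle n) => // b; case: pselect => // bU.
exact: bU.
Qed.

Lemma measurable_fun_coord d' (T : measurableType d') d (X : T -> 'cV[R]_d) i :
  measurable_fun setT (X : T -> bvec R d) -> measurable_fun setT (fun w => X w i ord0).
Proof. by move=> mX; exact: (measurableT_comp (measurable_bvec_coord i) mX). Qed.

Lemma measurable_fun_mulmx d' (T : measurableType d') m n p (M : 'M[R]_(m, n)) (X : T -> 'M[R]_(n, p)) i j :
  (forall i j, measurable_fun setT (fun w => X w i j)) ->
  measurable_fun setT (fun w => (M *m X w) i j).
Proof.
move=> mX; under eq_fun do rewrite mxE.
by apply: measurable_sum => k; apply: measurable_funM => //; exact: mX.
Qed.

(** A countable pi-system generating the Borel sets: rational corners allow almost sure identities
    to hold on all orthants outside a single null set. *)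
Definition orthant d (a : {ffun 'I_d -> rat}) : set 'cV[R]_d :=
  [set y | forall i, y i ord0 < ratr (a i)].

Lemma min_ratr (p q : rat) : ratr (Num.min p q) = Num.min (ratr p) (ratr q) :> R.
Proof. by rewrite !minEle ler_rat; case: ifP. Qed.

Lemma orthantI d : setI_closed (range (@orthant d)).
Proof.
move=> _ _ [a _ <-] [b _ <-]; exists [ffun i => Num.min (a i) (b i)] => //.
apply/seteqP; split=> [y h|y [h1 h2] i].
  by split=> i; have := h i; rewrite ffunE min_ratr lt_min => /andP[].
by rewrite ffunE min_ratr lt_min h1 h2.
Qed.

Lemma bvec_orthant d : @measurable _ (bvec R d) = <<s range (@orthant d) >>.
Proof.
apply/seteqP; split; last first.
  apply: smallest_sub; first exact: sigma_algebra_measurable.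
  move=> _ [a _ <-].
  rewrite (_ : orthant a = \bigcap_(i in [set: 'I_d])
    ((fun y : bvec R d => (y : 'cV[R]_d) i ord0) @^-1` `]-oo, ratr (a i)[%classic)).
    apply: fin_bigcap_measurable; first exact: finite_finset.
    by move=> i _; rewrite -[X in measurable X]setTI; apply: measurable_bvec_coord.
  by apply/seteqP; split=> y /= h i; [move=> _|]; have := h i; rewrite /= in_itv/=; [|apply].
pose T := g_sigma_algebraType (range (@orthant d)).
have idm : measurable_fun setT ((fun y => y) : T -> bvec R d).
  apply: measurable_fun_bvec => i.
  apply: (measurability (@RGenInftyO.G R)); first exact: RGenInftyO.measurableE.
  move=> _ [_ [x ->] <-]; rewrite setTI.
  (* The half-space [y_i < x] is the countable union of the orthants whose [i]-th corner is at most
     [x], the other corners being free. *)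
  pose F (n : nat) : set T := if (unpickle n : option {ffun 'I_d -> rat}) is Some a then
    (if ratr (a i) <= x then orthant a else set0) else set0.
  rewrite (_ : _ @^-1` _ = \bigcup_n F n).
    apply: bigcup_measurable => n _; rewrite /F; case: (unpickle n) => // a.
    by case: ifP => // _; apply: sub_sigma_algebra; exists a.
  apply/seteqP; split=> y /=; rewrite in_itv/=.
    move=> yx; have h j : exists q : rat, y j ord0 < ratr q /\ (j = i -> ratr q <= x).
      have [->|ji] := eqVneq j i.
        have [q] := rat_in_itvoo yx; rewrite in_itv/= => /andP[q1 q2].
        by exists q; split=> // _; exact: ltW.
      have [|q] := @rat_in_itvoo R (y j ord0) (y j ord0 + 1); first by rewrite ltrDl.
      by rewrite in_itv/= => /andP[q1 q2]; exists q; split=> // /eqP; rewrite (negPf ji).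
    pose a := [ffun j => xget 0%Q [set q : rat | y j ord0 < ratr q /\ (j = i -> ratr q <= x)]].
    have ha j : y j ord0 < ratr (a j) /\ (j = i -> ratr (a j) <= x).
      by rewrite ffunE; exact: (xgetPex _ (h j)).
    exists (pickle a) => //; rewrite /F pickleK (ha i).2// => j; exact: (ha j).1.
  move=> [n _]; rewrite /F; case: (unpickle n) => // a; case: ifP => // ax h.
  exact: lt_le_trans (h i) ax.
by move=> U mU; have := idm measurableT U mU; rewrite setTI.
Qed.

End BorelVectors.

(** * Uniqueness of Fourier transforms by closure under bounded limits *)

Section FourierUniqueness.
Context {R : realType} {d : nat}.
Implicit Types (f g : 'cV[R]_d -> R) (u y : 'cV[R]_d).

(* The bounded-limit closure of the span of the characters; it is an algebra and
   contains the indicators of orthants, whence uniqueness of Fourier transforms. *)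
Inductive trig_closure : ('cV[R]_d -> R) -> Prop :=
| trig_cos u : trig_closure (fun y => cos ((u^T *m y) ord0 ord0))
| trig_sin u : trig_closure (fun y => sin ((u^T *m y) ord0 ord0))
| trig_lin (a : R) f g : trig_closure f -> trig_closure g ->
    trig_closure (fun y => a * f y + g y)
| trig_lim (f_ : nat -> 'cV[R]_d -> R) f (M : R) :
    (forall n, trig_closure (f_ n)) -> (forall n y, `|f_ n y| <= M) ->
    (forall y, f_ ^~ y @ \oo --> f y) -> trig_closure f.

Lemma trig_closure_bounded f : trig_closure f -> exists M, forall y, `|f y| <= M.
Proof.
elim=> {f} [u|u|a f g _ [M hM] _ [N hN]|f_ f M _ _ hM cf].
- by exists 1 => y; rewrite ler_norml cos_geN1 cos_le1.
- by exists 1 => y; rewrite ler_norml sin_geN1 sin_le1.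
- exists (`|a| * M + N) => y; apply: (le_trans (ler_normD _ _)).
  by rewrite normrM lerD// ler_wpM2l.
- exists M => y; apply: (@closed_cvg _ _ \oo _ (fun n => `|f_ n y|) [set x | x <= M]).
  + exact: closed_le.
  + by apply: nearW => n; exact: hM.
  + exact: cvg_norm.
Qed.

Lemma trig_eq f g : f =1 g -> trig_closure f -> trig_closure g.
Proof. by move=> /funext ->. Qed.

Lemma trig_cst (c : R) : trig_closure (fun=> c).
Proof.
have h0 : trig_closure (fun=> 0).
  by apply: trig_eq (trig_sin 0) => y; rewrite trmx0 mul0mx mxE sin0.
apply: trig_eq (trig_lin c (trig_cos 0) h0) => y.
by rewrite trmx0 mul0mx mxE cos0 mulr1 addr0.
Qed.

Lemma trig_scale c f : trig_closure f -> trig_closure (fun y => c * f y).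
Proof. by move=> hf; apply: trig_eq (trig_lin c hf (trig_cst 0)) => y; rewrite addr0. Qed.

Lemma trig_add f g : trig_closure f -> trig_closure g -> trig_closure (fun y => f y + g y).
Proof. by move=> hf hg; apply: trig_eq (trig_lin 1 hf hg) => y; rewrite mul1r. Qed.

(** The left factor stays fixed while the right one is destructed. It is used first with [P] a
    single cosine or sine, then with [P := trig_closure]: the first round, multiplication by
    characters, settles the generators of the second. *)
Lemma trig_mul_of (P : ('cV[R]_d -> R) -> Prop) f : P f ->
  (forall f, P f -> exists M, forall y, `|f y| <= M) ->
  (forall f u, P f -> trig_closure (fun y => f y * cos ((u^T *m y) ord0 ord0))) ->
  (forall f u, P f -> trig_closure (fun y => f y * sin ((u^T *m y) ord0 ord0))) ->
  forall g, trig_closure g -> trig_closure (fun y => f y * g y).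
Proof.
move=> Pf bP Pc Ps g; elim=> {g} [u|u|a g h _ hg _ hh|g_ g M _ hg hM cg].
- exact: Pc.
- exact: Ps.
- by apply: trig_eq (trig_lin a hg hh) => y; ring.
- have [N hN] := bP f Pf.
  apply: (@trig_lim (fun n y => f y * g_ n y) _ (N * M)) => //.
  + by move=> n y; rewrite normrM ler_pM.
  + by move=> y; apply: cvgMr; exact: cg.
Qed.

Lemma trig_mul f g : trig_closure f -> trig_closure g -> trig_closure (fun y => f y * g y).
Proof.
pose dt u y := (u^T *m y) (@ord0 0) (@ord0 0).
have dtD u v y : dt (u + v) y = dt u y + dt v y by rewrite /dt linearD/= mulmxDl mxE.
have dtB u v y : dt (u - v) y = dt u y - dt v y.
  by rewrite /dt linearB/= mulmxDl mulNmx mxE [X in _ + X]mxE.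
have hc u f' : trig_closure f' -> trig_closure (fun y => cos (dt u y) * f' y).
  apply: (@trig_mul_of (fun f => f = (fun y => cos (dt u y)))) => //.
  - by move=> _ ->; exact: trig_closure_bounded (trig_cos u).
  - move=> _ v ->; apply: trig_eq (trig_lin (1/2) (trig_cos (u + v)) (trig_scale (1/2) (trig_cos (u - v)))) => y.
    by rewrite -!/(dt _ _) dtD dtB cosD cosB; field.
  - move=> _ v ->; apply: trig_eq (trig_lin (1/2) (trig_sin (u + v)) (trig_scale (-1/2) (trig_sin (u - v)))) => y.
    by rewrite -!/(dt _ _) dtD dtB sinD sinB; field.
have hs u f' : trig_closure f' -> trig_closure (fun y => sin (dt u y) * f' y).
  apply: (@trig_mul_of (fun f => f = (fun y => sin (dt u y)))) => //.
  - by move=> _ ->; exact: trig_closure_bounded (trig_sin u).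
  - move=> _ v ->; apply: trig_eq (trig_lin (1/2) (trig_sin (u + v)) (trig_scale (1/2) (trig_sin (u - v)))) => y.
    by rewrite -!/(dt _ _) dtD dtB sinD sinB; field.
  - move=> _ v ->; apply: trig_eq (trig_lin (-1/2) (trig_cos (u + v)) (trig_scale (1/2) (trig_cos (u - v)))) => y.
    by rewrite -!/(dt _ _) dtD dtB cosD cosB; field.
move=> hf hg; apply: (@trig_mul_of trig_closure f hf _ _ _ g hg).
- exact: trig_closure_bounded.
- by move=> f' u hf'; apply: trig_eq (hc u f' hf') => y; rewrite mulrC.
- by move=> f' u hf'; apply: trig_eq (hs u f' hf') => y; rewrite mulrC.
Qed.

Lemma trig_exp f n : trig_closure f -> trig_closure (fun y => f y ^+ n).
Proof.
move=> hf; elim: n => [|n IH].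
  by apply: trig_eq (trig_cst 1) => y; rewrite expr0.
by apply: trig_eq (trig_mul hf IH) => y; rewrite exprS.
Qed.

Lemma trig_sum (F : nat -> 'cV[R]_d -> R) n : (forall k, trig_closure (F k)) ->
  trig_closure (fun y => \sum_(0 <= k < n) F k y).
Proof.
move=> hF; elim: n => [|n IH].
  by apply: trig_eq (trig_cst 0) => y; rewrite big_geq.
by apply: trig_eq (trig_add IH (hF n)) => y; rewrite big_nat_recr.
Qed.

Lemma trig_prod (I : Type) (s : seq I) (F : I -> 'cV[R]_d -> R) :
  (forall i, trig_closure (F i)) -> trig_closure (fun y => \prod_(i <- s) F i y).
Proof.
move=> hF; elim: s => [|i s IH].
  by apply: trig_eq (trig_cst 1) => y; rewrite big_nil.
by apply: trig_eq (trig_mul (hF i) IH) => y; rewrite big_cons.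
Qed.

Lemma trig_expR f : trig_closure f -> trig_closure (fun y => expR (f y)).
Proof.
move=> hf; have [M hM] := trig_closure_bounded hf.
apply: (@trig_lim (fun n y => series (exp_coeff (f y)) n) _ (expR M)).
- move=> n; apply: (@trig_eq (fun y => \sum_(0 <= k < n) k`!%:R^-1 * f y ^+ k)).
    by move=> y; apply: eq_bigr => k _; rewrite /exp_coeff/= mulrC.
  by apply: trig_sum => k; apply: trig_scale; exact: trig_exp.
- move=> n y; apply: (@le_trans _ _ (series (exp_coeff M) n)).
    apply: (le_trans (ler_norm_sum _ _ _)); apply: ler_sum => k _.
    rewrite /exp_coeff/= normrM normrX normfV [`|k`!%:R|]ger0_norm//.
    rewrite ler_wpM2r ?invr_ge0//; apply: lerXn2r => //; rewrite nnegrE//.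
    exact: le_trans (hM y).
  apply: nondecreasing_cvgn_le; last exact: is_cvg_series_exp_coeff.
  apply: nondecreasing_series => k _ _; apply: exp_coeff_ge0.
  exact: le_trans (hM 0).
- by move=> y; exact: is_cvg_series_exp_coeff.
Qed.

(* exp(- exp x) is close to the indicator of x < 0 away from 0, and is a bounded
   limit of polynomials in any bounded x. *)
Lemma expR_expR_bound (x : R) : `|expR (- expR x) - (x < 0)%R%:R| <= (1 + `|x|)^-1.
Proof.
have [x0|x0] := ltP x 0; rewrite /= ?mulr1n ?mulr0n.
  rewrite distrC ger0_norm; last by rewrite subr_ge0 -expR0 ler_expR oppr_le0 expR_ge0.
  apply: (@le_trans _ _ (expR x)).
    by have := expR_ge1Dx (- expR x); lra.
  rewrite ltr0_norm// -{1}(opprK x) expRN lef_pV2 ?posrE ?expR_gt0//.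
    by have := expR_ge1Dx (- x); lra.
  by lra.
rewrite subr0 ger0_norm ?expR_ge0// expRN lef_pV2 ?posrE ?expR_gt0//.
  rewrite ger0_norm//; have := expR_ge1Dx (expR x); have := expR_ge1Dx x; lra.
Qed.

(** The term [n] decides the boundary case: at [z = 0] the inner argument goes to [+oo] as it does
    for [z > 0], whereas for [z < 0] the term [n^2 z] dominates. In every case its absolute value is
    eventually at least [n]. *)
Lemma cvg_indic_neg (z : R) :
  (fun n : nat => expR (- expR (n%:R ^+ 2 * z + n%:R))) @ \oo --> ((z < 0)%R%:R : R).
Proof.
apply/cvgrPdist_le => e e0.
pose c : R := if z < 0 then - z else 1.
have c0 : 0 < c by rewrite /c; case: ifPn => //; rewrite oppr_gt0.
near=> n.
have n1 : 2 / c <= n%:R by near: n; exact: nbhs_infty_ger.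
have n2 : e^-1 <= n%:R by near: n; exact: nbhs_infty_ger.
have n3 : (1 : R) <= n%:R by near: n; exact: nbhs_infty_ger.
set x := _ + n%:R.
have [sx nx] : (x < 0) = (z < 0) /\ n%:R <= `|x|.
  rewrite /x; move: n1; rewrite ler_pdivrMr// /c; case: ifPn => z0.
    move=> n1; have xn : n%:R ^+ 2 * z + n%:R <= - n%:R :> R.
      have : n%:R * (n%:R * - z) >= n%:R * 2 :> R by rewrite ler_wpM2l.
      by rewrite expr2; lra.
    split; first by apply/idP; lra.
    by rewrite ler0_norm; lra.
  rewrite -leNgt in z0 => _.
  have : 0 <= n%:R ^+ 2 * z :> R by rewrite mulr_ge0// sqr_ge0.
  move=> h; split; last by rewrite ger0_norm; lra.
  by apply/negbTE; rewrite -leNgt; lra.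
rewrite -sx distrC (le_trans (expR_expR_bound x))// -[e]invrK lef_pV2 ?posrE ?invr_gt0//; lra.
Unshelve. all: by end_near. Qed.

Lemma trig_neg f : trig_closure f -> trig_closure (fun y => (f y < 0)%R%:R).
Proof.
move=> hf; apply: (@trig_lim (fun n y => expR (- expR (n%:R ^+ 2 * f y + n%:R))) _ 1).
- move=> n; apply: trig_expR; apply: (@trig_eq (fun y => (-1) * expR (n%:R ^+ 2 * f y + n%:R))).
    by move=> y; rewrite mulN1r.
  by apply: trig_scale; apply: trig_expR; apply: trig_lin => //; exact: trig_cst.
- move=> n y; rewrite ger0_norm ?expR_ge0// -expR0 ler_expR oppr_le0 expR_ge0//.
- by move=> y; exact: cvg_indic_neg.
Qed.

(* sin is negative exactly left of 0 on ]-pi, pi[, so scaling recovers y_i < a. *)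
Lemma trig_coord_lt (i : 'I_d) (a : R) : trig_closure (fun y => (y i ord0 < a)%R%:R).
Proof.
pose u n : 'cV[R]_d := n.+1%:R^-1 *: delta_mx i ord0.
have uE n y : ((u n)^T *m y) ord0 ord0 = y i ord0 / n.+1%:R.
  rewrite /u linearZ/= -scalemxAl mxE trmx_delta -rowE mxE.
  by rewrite mulrC.
apply: (@trig_lim (fun n y => (sin ((y i ord0 - a) / n.+1%:R) < 0)%R%:R) _ 1).
- move=> n; apply: trig_neg.
  apply: trig_eq (trig_lin (cos (a / n.+1%:R)) (trig_sin (u n)) (trig_scale (- sin (a / n.+1%:R)) (trig_cos (u n)))) => y.
  by rewrite uE mulrBl sinB; ring.
- by move=> n y; case: (_ < _); rewrite ?normr1 ?normr0.
- move=> y; apply: cvg_near_cst; near=> n.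
  have n1 : `|y i ord0 - a| / pi < n.+1%:R.
    by rewrite (@le_lt_trans _ _ n%:R) ?ltr_nat//; near: n; exact: nbhs_infty_ger.
  have n0 : (0 : R) < n.+1%:R by [].
  move: n1; rewrite ltr_pdivrMr ?pi_gt0// => n1.
  congr (_%:R); set x := y i ord0 - a in n1 *.
  have xn : `|x / n.+1%:R| < pi by rewrite normrM normfV [`|n.+1%:R|]ger0_norm// ltr_pdivrMr// mulrC.
  have [x0|x0|x0] := ltgtP x 0.
  + have h : 0 < sin (- (x / n.+1%:R)).
      apply: sin_gt0_pi; rewrite oppr_gt0 ltr_pdivrMr// mul0r x0/=.
      by move: xn; rewrite ltr_norml ltrNl => /andP[].
    rewrite sinN oppr_gt0 in h; have E : y i ord0 < a by move: x0; rewrite /x; lra.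
    by rewrite h E.
  + have h : 0 < sin (x / n.+1%:R).
      apply: sin_gt0_pi; rewrite divr_gt0//=.
      by move: xn; rewrite ltr_norml => /andP[_ +].
    have E : (y i ord0 < a) = false by apply/negbTE; rewrite -leNgt; move: x0; rewrite /x; lra.
    by rewrite E ltNge (ltW h).
  + have E : (y i ord0 < a) = false by apply/negbTE; rewrite -leNgt; move: x0; rewrite /x; lra.
    by rewrite E x0 mul0r sin0 ltxx.
Unshelve. all: by end_near. Qed.

Lemma trig_orthant (a : {ffun 'I_d -> rat}) :
  trig_closure (fun y => \1_(orthant a) y).
Proof.
apply: trig_eq (trig_prod (index_enum 'I_d) (fun i => trig_coord_lt i (ratr (a i)))) => y.
rewrite indicE; have [h|h] := pselect (orthant a y).
  by rewrite mem_set// big1// => i _; rewrite h.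
rewrite memNset//; have [i hi] : exists i, ~ (y i ord0 < ratr (a i)).
  by apply/not_existsP => h'; apply: h => i; apply: contrapT; exact: h'.
by rewrite (bigD1 i)//= (negbTE (introN idP hi)) mul0r.
Qed.

Lemma trig_measurable f : trig_closure f -> measurable_fun setT (f : bvec R d -> R).
Proof.
have md u : measurable_fun setT (fun y : bvec R d => (u^T *m (y : 'cV[R]_d)) ord0 ord0).
  by apply: measurable_fun_mulmx => i j; rewrite ord1; exact: measurable_bvec_coord.
elim=> {f} [u|u|a f g _ mf _ mg|f_ f M _ mf _ cf].
- exact: (measurableT_comp (continuous_measurable_fun (@continuous_cos R)) (md u)).
- exact: (measurableT_comp (continuous_measurable_fun (@continuous_sin R)) (md u)).
- by apply: measurable_funD => //; apply: measurable_funM.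
- by apply: (@measurable_fun_cvg _ (bvec R d) R setT f_ f mf) => x _; exact: cf.
Qed.

Lemma trig_integrable (mu : probability (bvec R d) R) f : trig_closure f ->
  mu.-integrable setT (EFin \o (f : bvec R d -> R)).
Proof.
move=> hf; have [M hM] := trig_closure_bounded hf.
apply: measurable_bounded_integrable => //.
- by rewrite (le_lt_trans (probability_le1 mu measurableT)) ?ltry.
- exact: trig_measurable.
- exists M; split; first exact: num_real.
  by move=> x Mx y _; exact: le_trans (hM y) (ltW Mx).
Qed.

Lemma measurable_orthant a : measurable (orthant a : set (bvec R d)).
Proof. by rewrite bvec_orthant; apply: sub_sigma_algebra; exists a. Qed.

Lemma orthant_uniqueness (mu nu : probability (bvec R d) R) :
  (forall a, mu (orthant a) = nu (orthant a)) -> forall U, measurable U -> mu U = nu U.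
Proof.
move=> h U mU; apply: (@measure_unique _ R (bvec R d) (range (@orthant R d))
  (fun k => orthant [ffun=> k%:R]) _ _ _ _ mu nu _ _ U mU).
- exact: bvec_orthant.
- exact: orthantI.
- by move=> k; exists [ffun=> k%:R].
- apply/seteqP; split=> // y _.
  pose N := (\sum_i (Num.trunc `|(y : 'cV[R]_d) i ord0|).+1)%N.
  exists N => // i; rewrite ffunE ratr_nat.
  apply: (@lt_le_trans _ _ (Num.trunc `|(y : 'cV[R]_d) i ord0|).+1%:R).
    apply: (le_lt_trans (ler_norm _)); exact: truncnS_gt.
  by rewrite ler_nat /N (bigD1 i)//= leq_addr.
- by move=> _ [a _ <-]; exact: h.
- by move=> k; rewrite (le_lt_trans (probability_le1 mu (measurable_orthant _))) ?ltry.
Qed.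

(** Functions of the closure with equal integrals under [mu] and [nu] are stable under linear
    combinations and, by dominated convergence, under bounded limits; starting from the characters
    this reaches the indicators of orthants. *)
Lemma fourier_uniqueness (mu nu : probability (bvec R d) R) :
  (forall u, \int[mu]_y (cos ((u^T *m (y : 'cV[R]_d)) ord0 ord0))%:E =
             \int[nu]_y (cos ((u^T *m (y : 'cV[R]_d)) ord0 ord0))%:E)%E ->
  (forall u, \int[mu]_y (sin ((u^T *m (y : 'cV[R]_d)) ord0 ord0))%:E =
             \int[nu]_y (sin ((u^T *m (y : 'cV[R]_d)) ord0 ord0))%:E)%E ->
  forall U, measurable U -> mu U = nu U.
Proof.
move=> hc hs.
have h f : trig_closure f -> (\int[mu]_y (f y)%:E = \int[nu]_y (f y)%:E)%E.
  elim=> {f} [u|u|a f g tf hf tg hg|f_ f M tf hf hM cf].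
  - exact: hc.
  - exact: hs.
  - have E (m : probability (bvec R d) R) : (\int[m]_y (a * f y + g y)%:E =
        a%:E * \int[m]_y (f y)%:E + \int[m]_y (g y)%:E)%E.
      under eq_integral do rewrite EFinD EFinM.
      rewrite integralD//; last 2 first.
      + by apply: integrableZl => //; exact: trig_integrable.
      + exact: trig_integrable.
      by rewrite integralZl//; exact: trig_integrable.
    by rewrite !E hf hg.
  - have L (m : probability (bvec R d) R) :
        ((fun n => \int[m]_y (f_ n y)%:E) @ \oo --> \int[m]_y (f y)%:E)%E.
      have [] := @dominated_convergence _ _ _ m setT measurableT
        (fun n y => (f_ n y)%:E) (fun y => (f y)%:E) (cst M%:E).
      + by move=> n; apply/measurable_EFinP; exact: trig_measurable.
      + apply/measurable_EFinP; apply: trig_measurable; exact: (trig_lim tf hM cf).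
      + apply: aeW => y _; apply: cvg_EFin; first exact: nearW.
        exact: cf.
      + apply: measurable_bounded_integrable => //.
          by rewrite (le_lt_trans (probability_le1 m measurableT)) ?ltry.
        exists `|M|; split; first exact: num_real.
        by move=> x Mx y _ /=; exact: ltW.
      + by apply: aeW => y n _; rewrite lee_fin.
      + by [].
    have E : (fun n => \int[mu]_y (f_ n y)%:E)%E = (fun n => \int[nu]_y (f_ n y)%:E)%E.
      by apply/funext.
    have Lmu := L mu; rewrite E in Lmu; exact: (cvg_unique _ Lmu (L nu)).
apply: orthant_uniqueness => a; have := h _ (trig_orthant a).
have mo : measurable (orthant a : set (bvec R d)) by exact: measurable_orthant.
by rewrite !integral_indic// !setIT.
Qed.

End FourierUniqueness.

(** * Expectations of bounded variables *)

Section Expectation.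
Context {R : realType} {disp : measure_display} {T : measurableType disp}.
Variable P : probability T R.
Implicit Types (f g H : T -> R).

(** Boundedness gives integrability under a probability and, unlike integrability, is stable under
    products, so expectations can be handled as real numbers. *)
Definition bmeas f : Prop :=
  measurable_fun setT f /\ exists M : R, forall w, `|f w| <= M.

Definition expect f : R := \int[P]_w f w.

Lemma bmeas_integrable f : bmeas f -> P.-integrable setT (EFin \o f).
Proof.
move=> [mf [M hM]]; apply: measurable_bounded_integrable => //.
  by rewrite (le_lt_trans (probability_le1 P measurableT)) ?ltry.
exists M; split; first exact: num_real.
by move=> x Mx y _; exact: le_trans (hM y) (ltW Mx).
Qed.

Lemma bmeas_cst (c : R) : bmeas (fun=> c).
Proof. by split; [exact: measurable_cst|exists `|c|]. Qed.

Lemma bmeasD f g : bmeas f -> bmeas g -> bmeas (fun w => f w + g w).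
Proof.
move=> [mf [M hM]] [mg [N hN]]; split; first exact: measurable_funD.
by exists (M + N) => w; rewrite (le_trans (ler_normD _ _))// lerD.
Qed.

Lemma bmeasM f g : bmeas f -> bmeas g -> bmeas (fun w => f w * g w).
Proof.
move=> [mf [M hM]] [mg [N hN]]; split; first exact: measurable_funM.
by exists (M * N) => w; rewrite normrM ler_pM.
Qed.

Lemma bmeasZ c f : bmeas f -> bmeas (fun w => c * f w).
Proof. by move=> bf; apply: bmeasM => //; exact: bmeas_cst. Qed.

Lemma bmeasB f g : bmeas f -> bmeas g -> bmeas (fun w => f w - g w).
Proof.
move=> bf [mg [N hN]]; apply: bmeasD => //; split; first exact: measurable_funN.
by exists N => w; rewrite normrN.
Qed.

Lemma bmeas_indic A : measurable A -> bmeas (\1_A).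
Proof.
move=> mA; split; first exact: measurable_indic.
by exists 1 => w; rewrite indicE; case: (_ \in _); rewrite ?normr1 ?normr0.
Qed.

Lemma bmeas_sum (I : Type) (s : seq I) (F : I -> T -> R) :
  (forall i, bmeas (F i)) -> bmeas (fun w => \sum_(i <- s) F i w).
Proof.
move=> hF; elim: s => [|i s IH].
  by rewrite (_ : (fun _ => _) = (fun=> 0)); [exact: bmeas_cst|apply/funext => w; rewrite big_nil].
rewrite (_ : (fun _ => _) = (fun w => F i w + \sum_(i <- s) F i w)); first exact: bmeasD.
by apply/funext => w; rewrite big_cons.
Qed.

Lemma expectD f g : bmeas f -> bmeas g ->
  expect (fun w => f w + g w) = expect f + expect g.
Proof. by move=> bf bg; apply: RintegralD => //; exact: bmeas_integrable. Qed.

Lemma expectB f g : bmeas f -> bmeas g ->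
  expect (fun w => f w - g w) = expect f - expect g.
Proof. by move=> bf bg; apply: RintegralB => //; exact: bmeas_integrable. Qed.

Lemma expectZ c f : bmeas f -> expect (fun w => c * f w) = c * expect f.
Proof. by move=> bf; apply: RintegralZl => //; exact: bmeas_integrable. Qed.

Lemma expect_cst c : expect (fun=> c) = c.
Proof.
rewrite /expect Rintegral_cst// (_ : fine _ = 1) ?mulr1//.
exact: (congr1 fine (probability_setT P)).
Qed.

Lemma expect_sum (I : Type) (s : seq I) (F : I -> T -> R) :
  (forall i, bmeas (F i)) ->
  expect (fun w => \sum_(i <- s) F i w) = \sum_(i <- s) expect (F i).
Proof.
move=> hF; elim: s => [|i s IH].
  rewrite big_nil -[RHS](expect_cst 0); congr expect.
  by apply/funext => w; rewrite big_nil.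
rewrite big_cons -IH -expectD//; last exact: bmeas_sum.
by congr expect; apply/funext => w; rewrite big_cons.
Qed.

Lemma expect_le f g : bmeas f -> bmeas g -> (forall w, f w <= g w) -> expect f <= expect g.
Proof. by move=> bf bg fg; apply: le_Rintegral => //; exact: bmeas_integrable. Qed.

Lemma expect_norm_le f g : bmeas f -> bmeas g -> (forall w, `|f w| <= g w) ->
  `|expect f| <= expect g.
Proof.
move=> bf bg fg; rewrite ler_norml; apply/andP; split.
  rewrite -[leLHS]mulN1r -expectZ//; apply: expect_le => //; first exact: bmeasZ.
  by move=> w; rewrite mulN1r; have := fg w; rewrite ler_norml => /andP[].
by apply: expect_le => // w; have := fg w; rewrite ler_norml => /andP[].
Qed.

Lemma expect_indic A : measurable A -> expect (\1_A) = fine (P A).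
Proof. by move=> mA; rewrite /expect /Rintegral integral_indic// setIT. Qed.

Lemma expect_ae f g : bmeas f -> bmeas g -> {ae P, forall w, f w = g w} ->
  expect f = expect g.
Proof.
move=> [mf _] [mg _] fg; congr fine; apply: ae_eq_integral => //.
- exact/measurable_EFinP.
- exact/measurable_EFinP.
- by apply: filterS fg => w -> .
Qed.

Lemma small_eq (a b c : R) : 0 <= c -> (forall e : R, 0 < e -> `|a - b| <= c * e) -> a = b.
Proof.
move=> c0 h; apply/eqP; rewrite -subr_eq0 -normr_le0; apply/ler_addgt0Pr => e e0.
rewrite add0r (le_trans (h (e / (c + 1)) _))//; first by rewrite divr_gt0// ltr_wpDl.
by rewrite mulrA ler_pdivrMr ?ltr_wpDl// mulrC ler_pM2l// lerDl.
Qed.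

(* Approximate [g] uniformly by a step function with levels [- M + k e]. *)
Lemma expectM_decorrelated (D : set (set T)) H g : bmeas H -> bmeas g ->
  (forall E, D E -> measurable E /\ expect (fun w => H w * \1_E w) = expect H * fine (P E)) ->
  (forall a b : R, D (g @^-1` `[a, b[%classic)) ->
  expect (fun w => H w * g w) = expect H * expect g.
Proof.
move=> bH bg hD Dg; have [_ [K hK]] := bH; have [_ [M hM]] := bg.
have K0 : 0 <= K by have [w _] : [set: T] !=set0 by [apply/set0P/negP => /eqP h;
  have := probability_setT P; rewrite h measure0 => /eqP; rewrite eq_sym onee_eq0]; exact: le_trans (hK w).
apply: (@small_eq _ _ (2 * K)); first exact: mulr_ge0.
move=> e e0.
pose N := (Num.trunc (2 * M / e)).+1.
pose x (k : nat) : R := - M + k%:R * e.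
pose A k := g @^-1` `[x k, x k.+1[%classic.
pose ge w := \sum_(0 <= k < N) x k * \1_(A k) w.
have mA k : measurable (A k) by have [] := hD _ (Dg (x k) (x k.+1)).
have bA k : bmeas (\1_(A k)) by exact: bmeas_indic.
have bge : bmeas ge by apply: bmeas_sum => k; exact: bmeasZ.
have geg w : `|g w - ge w| <= e.
  have M0 : 0 <= M by exact: le_trans (hM w).
  have := hM w; rewrite ler_norml => /andP[gl gu].
  pose k0 := Num.trunc ((g w + M) / e).
  have z0 : 0 <= (g w + M) / e by rewrite divr_ge0 ?(ltW e0)//; lra.
  have /andP[k1 k2] := trunc_itv z0; rewrite -/k0 in k1 k2.
  rewrite ler_pdivlMr// in k1; rewrite ltr_pdivrMr// in k2.
  have k0N : (k0 < N)%N.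
    have := truncnS_gt (2 * M / e); rewrite -/N ltr_pdivrMr// => hN.
    by rewrite -(@ltr_nat R) -(ltr_pM2r e0); lra.
  have hk0 : A k0 w by rewrite /A /= in_itv/= /x; apply/andP; split; lra.
  have -> : ge w = x k0.
    rewrite /ge big_mkord (bigD1 (Ordinal k0N))//= indicE mem_set// mulr1 big1 ?addr0// => i ik0.
    rewrite indicE memNset ?mulr0// => -[]; rewrite /A /= in_itv/= /x => /andP[i1 i2].
    move/eqP : ik0; apply; apply/val_inj => /=; apply/eqP; rewrite eqn_leq.
    have lt1 : (i < k0.+1)%N.
      rewrite -(@ltr_nat R) -(ltr_pM2r e0); lra.
    have lt2 : (k0 < i.+1)%N.
      rewrite -(@ltr_nat R) -(ltr_pM2r e0); lra.
    by rewrite -ltnS lt1 -ltnS lt2.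
  by rewrite ger0_norm /x; [|lra]; rewrite -natr1 in k2; lra.
have EHge : expect (fun w => H w * ge w) = expect H * expect ge.
  rewrite /ge expect_sum; last by move=> k; exact: bmeasZ.
  rewrite mulr_sumr (_ : (fun w => _) = (fun w => \sum_(0 <= k < N) x k * (H w * \1_(A k) w))).
    rewrite expect_sum; last by move=> k; apply: bmeasZ; exact: bmeasM.
    apply: eq_bigr => k _; rewrite expectZ; last exact: bmeasM.
    by rewrite (hD _ (Dg (x k) (x k.+1))).2 expectZ// expect_indic// mulrCA.
  by apply/funext => w; rewrite mulr_sumr; apply: eq_bigr => k _; rewrite mulrCA.
have h1 : `|expect (fun w => H w * g w) - expect (fun w => H w * ge w)| <= K * e.
  rewrite -expectB; [|exact: bmeasM|exact: bmeasM].
  rewrite -[leRHS]expect_cst; apply: expect_norm_le; [|exact: bmeas_cst|].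
    by apply: bmeasB; exact: bmeasM.
  by move=> w; rewrite -mulrBr normrM ler_pM.
have h2 : `|expect H * expect ge - expect H * expect g| <= K * e.
  rewrite -mulrBr normrM; apply: ler_pM => //.
    rewrite -[leRHS]expect_cst; apply: expect_norm_le => //; exact: bmeas_cst.
  rewrite -expectB// -[leRHS]expect_cst; apply: expect_norm_le; [exact: bmeasB|exact: bmeas_cst|].
  by move=> w; rewrite distrC.
rewrite EHge in h1; have := ler_distD (expect H * expect ge) (expect (fun w => H w * g w)) (expect H * expect g).
by lra.
Qed.

Lemma indicM (A B : set T) w : \1_A w * \1_B w = \1_(A `&` B) w :> R.
Proof. by rewrite indicI. Qed.

(** Independence bears on events. One application of [expectM_decorrelated] replaces [g] by events
    of [G]; a second one, with an indicator as the fixed factor, replaces [f] by events of [F]. *)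
Lemma expectM_indep (F G : set (set T)) f g : indep P F G ->
  (forall A, F A -> measurable A) -> (forall A, G A -> measurable A) ->
  bmeas f -> bmeas g -> (forall a b : R, F (f @^-1` `[a, b[%classic)) ->
  (forall a b : R, G (g @^-1` `[a, b[%classic)) ->
  expect (fun w => f w * g w) = expect f * expect g.
Proof.
move=> iFG mF mG bf bg Ff Gg; apply: (@expectM_decorrelated G) => // E GE.
split; first exact: mG.
have mE := mG _ GE.
rewrite (_ : (fun w => f w * \1_E w) = (fun w => \1_E w * f w)); last first.
  by apply/funext => w; rewrite mulrC.
rewrite (@expectM_decorrelated F (\1_E) f)//; last 2 first.
- exact: bmeas_indic.
- move=> A FA; split; first exact: mF.
  have mA := mF _ FA.
  rewrite (_ : (fun w => _) = \1_(E `&` A)); last by apply/funext => w; rewrite indicM.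
  rewrite !expect_indic//; last exact: measurableI.
  by rewrite setIC iFG// fineM ?fin_num_measure// mulrC.
by rewrite expect_indic// mulrC.
Qed.

(** A single [e] bounds both the deviation and its probability, as in [ito_integral]; this amounts
    to the usual notion. *)
Definition cvg_prob (f_ : nat -> T -> R) f : Prop :=
  forall e : R, 0 < e -> exists N, forall n, (N <= n)%N ->
    (P [set w | (e < `|f_ n w - f w|)%R] <= e%:E)%E.

Lemma cvg_prob_expect (phi : R -> R) (f_ : nat -> T -> R) f H :
  (forall x y, `|phi x - phi y| <= `|x - y|) -> (forall x, `|phi x| <= 1) ->
  measurable_fun setT phi -> bmeas H ->
  (forall n, measurable_fun setT (f_ n)) -> measurable_fun setT f ->
  cvg_prob f_ f ->
  (fun n => expect (fun w => H w * phi (f_ n w))) @ \oo -->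
  expect (fun w => H w * phi (f w)).
Proof.
move=> lip bd mphi bH mf_ mf cf; have [_ [K hK]] := bH.
have bphi g : measurable_fun setT g -> bmeas (fun w => phi (g w)).
  by move=> mg; split; [exact: measurableT_comp|exists 1].
apply/cvgrPdist_le => e e0.
(* Three units of [e1]: one for the Lipschitz bound off [A], two because values of [phi] may differ
   by 2 on [A], whose probability is at most [e1]; the [+ 1] avoids a division by 0. *)
pose e1 := e / (3 * (`|K| + 1)).
have K1 : 0 < `|K| + 1 by rewrite ltr_wpDl.
have e10 : 0 < e1 by rewrite divr_gt0// mulr_gt0.
have [N hN] := cf _ e10.
exists N => // n /= Nn; have := hN n Nn.
set A := [set w | _] => PA.
have mA : measurable A.
  rewrite (_ : A = (fun w => `|f_ n w - f w|) @^-1` `]e1, +oo[%classic).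
    rewrite -[X in measurable X]setTI.
    have m1 : measurable_fun setT (fun w => `|f_ n w - f w|).
      by apply: measurableT_comp => //; exact: measurable_funB.
    exact: m1.
  by apply/seteqP; split=> w; rewrite /A /= in_itv/= andbT.
rewrite distrC -expectB; [|by apply: bmeasM => //; exact: bphi..].
apply: (@le_trans _ _ (expect (fun w => (`|K| + 1) * (e1 + 2 * \1_A w)))).
  apply: expect_norm_le.
  - by apply: bmeasB; apply: bmeasM => //; exact: bphi.
  - apply: bmeasZ; apply: bmeasD; first exact: bmeas_cst.
    by apply: bmeasZ; exact: bmeas_indic.
  move=> w; rewrite -mulrBr normrM; apply: ler_pM => //.
    by rewrite (le_trans (hK w))// (le_trans (ler_norm K))// lerDl.
  rewrite indicE; have [Aw|Aw] := pselect (A w).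
    rewrite mem_set// mulr1 (le_trans (ler_normB _ _))//.
    by have := bd (f_ n w); have := bd (f w); lra.
  rewrite memNset// mulr0 addr0 (le_trans (lip _ _))// leNgt.
  by apply/negP.
have bA : bmeas (\1_A) by exact: bmeas_indic.
rewrite expectZ; last by apply: bmeasD; [exact: bmeas_cst|exact: bmeasZ].
rewrite expectD; [|exact: bmeas_cst|exact: bmeasZ].
rewrite expect_cst expectZ// expect_indic//.
have : fine (P A) <= e1 by rewrite -lee_fin fineK ?fin_num_measure.
move=> h; apply: (@le_trans _ _ ((`|K| + 1) * (3 * e1))).
  by rewrite ler_pM2l//; lra.
by rewrite /e1 mulrCA (mulrC 3) -mulrA; have -> : (`|K| + 1) * (e / (3 * (`|K| + 1)) * 3) = e by field; lra.
Qed.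

Lemma cos_lipschitz (x y : R) : `|cos x - cos y| <= `|x - y|.
Proof.
wlog xy : x y / y <= x.
  by move=> h; have [/h//|/ltW/h] := leP y x; rewrite distrC (distrC y).
have := @derive_norm_le R y x 1 cos (fun z => - sin z) xy.
rewrite mul1r (ger0_norm (_ : 0 <= x - y)) ?subr_ge0//; apply.
- apply: continuous_subspaceT; exact: continuous_cos.
- by move=> z _; rewrite normrN ler_norml sin_geN1 sin_le1.
Qed.

Lemma sin_lipschitz (x y : R) : `|sin x - sin y| <= `|x - y|.
Proof.
wlog xy : x y / y <= x.
  by move=> h; have [/h//|/ltW/h] := leP y x; rewrite distrC (distrC y).
have := @derive_norm_le R y x 1 sin (fun z => cos z) xy.
rewrite mul1r (ger0_norm (_ : 0 <= x - y)) ?subr_ge0//; apply.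
- apply: continuous_subspaceT; exact: continuous_sin.
- by move=> z _; rewrite ler_norml cos_geN1 cos_le1.
Qed.

Lemma norm_cos_le1 (x : R) : `|cos x| <= 1.
Proof. by rewrite ler_norml cos_geN1 cos_le1. Qed.

Lemma norm_sin_le1 (x : R) : `|sin x| <= 1.
Proof. by rewrite ler_norml sin_geN1 sin_le1. Qed.

Lemma bmeas_cos f : measurable_fun setT f -> bmeas (fun w => cos (f w)).
Proof.
move=> mf; split; last by exists 1 => w; exact: norm_cos_le1.
exact: (measurableT_comp (continuous_measurable_fun (@continuous_cos R)) mf).
Qed.

Lemma bmeas_sin f : measurable_fun setT f -> bmeas (fun w => sin (f w)).
Proof.
move=> mf; split; last by exists 1 => w; exact: norm_sin_le1.
exact: (measurableT_comp (continuous_measurable_fun (@continuous_sin R)) mf).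
Qed.

Definition same_law f g := forall U : set R, measurable U -> P (f @^-1` U) = P (g @^-1` U).

Lemma same_law_integral f g (h : R -> \bar R) : measurable_fun setT f -> measurable_fun setT g ->
  same_law f g -> measurable_fun setT h -> (forall x, 0 <= h x)%E ->
  (\int[P]_w h (f w) = \int[P]_w h (g w))%E.
Proof.
move=> mf mg fg mh h0.
have E k : measurable_fun setT k -> (\int[P]_w h (k w) = \int[pushforward P k]_y h y)%E.
  by move=> mk; rewrite (ge0_integral_pushforward mk).
rewrite (E f)// (E g)//; apply: eq_measure_integral => A mA _; exact: fg.
Qed.

End Expectation.

(** * Adapted variables and completions *)

Section Adapted.
Context {R : realType} {disp : measure_display} {T : measurableType disp}.
Variable P : probability T R.
Implicit Types (D : set (set T)) (f g : T -> R).

(** Stated on preimages, hence meaningful for any family of sets; [sigma_adaptedP] turns it into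
    measurability when the family is a sigma-algebra. *)
Definition adapted D f : Prop := forall U : set R, measurable U -> D (f @^-1` U).

Definition vadapted D d (X : T -> 'cV[R]_d) : Prop :=
  forall U : set (bvec R d), measurable U -> D (X @^-1` U).

Lemma sigma_adaptedP D f : sigma_algebra setT D ->
  adapted D f <-> measurable_fun setT (f : g_sigma_algebraType D -> R).
Proof.
move=> sD; split=> [af _ U mU|mf U mU].
  by rewrite setTI; apply: sub_sigma_algebra; exact: af.
have := mf measurableT U mU; rewrite setTI => h.
by rewrite -(sigma_algebra_id sD).
Qed.

Lemma sigma_vadaptedP D d (X : T -> 'cV[R]_d) : sigma_algebra setT D ->
  vadapted D X <-> forall i, adapted D (fun w => X w i ord0).
Proof.
move=> sD; split=> [aX i U mU|aX U mU].
  apply: (aX (fun y : bvec R d => U ((y : 'cV[R]_d) i ord0))).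
  by rewrite -[X in measurable X]setTI; apply: measurable_bvec_coord.
have : measurable_fun setT (X : g_sigma_algebraType D -> bvec R d).
  by apply: measurable_fun_bvec => i; apply/sigma_adaptedP.
move=> /(_ measurableT U mU); rewrite setTI => h.
by rewrite -(sigma_algebra_id sD).
Qed.

(** Filters and Ito integrals are limits in probability, hence measurable only up to null sets.
    Members are required to be measurable in [T], so that the completion stays inside the ambient
    sigma-algebra. *)
Definition completion D : set (set T) :=
  [set F | measurable F /\ exists2 F', D F' & {ae P, forall w, F w <-> F' w}].

Lemma sub_completion D : D `<=` measurable -> D `<=` completion D.
Proof. by move=> Dm F DF; split; [exact: Dm|exists F => //; exact: aeW]. Qed.

Lemma completion_measurable D : completion D `<=` measurable.
Proof. by move=> F []. Qed.

Lemma completionS D E : D `<=` E -> completion D `<=` completion E.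
Proof. by move=> DE F [mF [F' DF' FF']]; split=> //; exists F' => //; exact: DE. Qed.

Lemma completion_idem D : completion (completion D) `<=` completion D.
Proof.
move=> F [mF [F' [mF' [F'' DF'' h2]] h1]]; split=> //; exists F'' => //.
by apply: filterS2 h1 h2 => w -> ->.
Qed.

Lemma completion_ae D A B : completion D A -> measurable B ->
  {ae P, forall w, A w <-> B w} -> completion D B.
Proof.
move=> [mA [A' DA' AA']] mB AB; split=> //; exists A' => //.
by apply: filterS2 AA' AB => w <- <-.
Qed.

Lemma completion_sigma_algebra D : sigma_algebra setT D ->
  sigma_algebra setT (completion D).
Proof.
move=> [D0 DC DU]; split.
- by split=> //; exists set0 => //; exact: aeW.
- move=> A [mA [A' DA' AA']]; split; first exact: measurableD.
  by exists (setT `\` A'); [exact: DC|apply: filterS AA' => w /= ->].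
- move=> F hF; split; first by apply: bigcup_measurable => n _; case: (hF n).
  pose F' n := xget set0 [set B | D B /\ {ae P, forall w, F n w <-> B w}].
  have hF' n : D (F' n) /\ {ae P, forall w, F n w <-> F' n w}.
    apply: (@xgetPex _ set0 [set B | D B /\ {ae P, forall w, F n w <-> B w}]).
    by case: (hF n) => _ [B DB FB]; exists B.
  exists (\bigcup_n F' n); first by apply: DU => n; case: (hF' n).
  have : {ae P, forall w, forall n, F n w <-> F' n w}.
    by apply: ae_foralln => n; case: (hF' n).
  by apply: filterS => w h; split=> -[n _ hn]; exists n => //; apply/(h n).
Qed.

Lemma ae_measure_eq A B : measurable A -> measurable B ->
  {ae P, forall w, A w <-> B w} -> P A = P B.
Proof.
move=> mA mB AB.
rewrite -[LHS]fineK ?fin_num_measure// -[RHS]fineK ?fin_num_measure//; congr EFin.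
rewrite -!expect_indic//; apply: expect_ae; [exact: bmeas_indic..|].
apply: filterS AB => w AB; rewrite !indicE; have [Aw|Aw] := pselect (A w).
  by rewrite !mem_set//; exact/AB.
by rewrite !memNset// => /AB.
Qed.

Lemma completion_indep D E : D `<=` measurable -> E `<=` measurable ->
  indep P D E -> indep P (completion D) (completion E).
Proof.
move=> mD mE iDE A B [mA [A' DA' AA']] [mB [B' EB' BB']].
rewrite (ae_measure_eq mA (mD _ DA') AA') (ae_measure_eq mB (mE _ EB') BB') -iDE//.
apply: ae_measure_eq.
- exact: measurableI.
- by apply: measurableI; [exact: mD|exact: mE].
- by apply: filterS2 AA' BB' => w h1 h2; split=> -[/h1 ? /h2 ?].
Qed.

Lemma adapted_measurable D f : D `<=` measurable -> adapted D f -> measurable_fun setT f.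
Proof. by move=> mD af _ U mU; rewrite setTI; apply: mD; exact: af. Qed.

Lemma adapted_sub D E f : D `<=` E -> adapted D f -> adapted E f.
Proof. by move=> DE af U mU; apply: DE; exact: af. Qed.

Lemma adapted_cvg_ae D (f_ : nat -> T -> R) f : sigma_algebra setT D ->
  (forall n, adapted (completion D) (f_ n)) -> measurable_fun setT f ->
  {ae P, forall w, f_ ^~ w @ \oo --> f w} -> adapted (completion D) f.
Proof.
move=> sD af mf [N [mN PN hN]].
have sC := completion_sigma_algebra sD.
(* On the null set [N] the sequence is replaced by its limit, so that convergence holds everywhere;
   [g n] stays adapted to the completion because it differs from [f_ n] only on [N]. *)
pose g n w := if w \in N then f w else f_ n w.
have mf_ n : measurable_fun setT (f_ n).
  exact: adapted_measurable (@completion_measurable D) (af n).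
have NE n (U : set R) : g n @^-1` U = (N `&` f @^-1` U) `|` (~` N `&` f_ n @^-1` U).
  rewrite /g; apply/seteqP; split=> w /=.
    have [wN|wN] := pselect (N w); first by rewrite mem_set// => h; left.
    by rewrite memNset// => h; right.
  by case=> -[wN h]; [rewrite mem_set|rewrite memNset].
have ag n : adapted (completion D) (g n).
  move=> U mU; apply: completion_ae (af n U mU) _ _.
    rewrite NE; apply: measurableU; apply: measurableI => //.
    - by rewrite -[X in measurable X]setTI; exact: mf.
    - exact: measurableC.
    - by rewrite -[X in measurable X]setTI; exact: mf_.
  exists N; split=> // w /= nh; apply: contrapT => wN; apply: nh.
  by rewrite /g memNset.
apply/sigma_adaptedP => //.
apply: (@measurable_fun_cvg _ (g_sigma_algebraType (completion D)) R setT g).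
  by move=> n; apply/sigma_adaptedP.
move=> w _; rewrite /g; have [wN|wN] := pselect (N w).
  by rewrite mem_set//; exact: cvg_cst.
rewrite memNset//; apply: contrapT => h; apply: wN; exact: hN.
Qed.

(** Borel-Cantelli: along [k] the exceptional events have probabilities at most [2^-(n+1)], which
    are summable, so almost surely only finitely many of them occur. *)
Lemma cvg_prob_ae_subseq (f_ : nat -> T -> R) f :
  (forall n, measurable_fun setT (f_ n)) -> measurable_fun setT f -> cvg_prob P f_ f ->
  exists k : nat -> nat, {ae P, forall w, (fun n => f_ (k n) w) @ \oo --> f w}.
Proof.
move=> mf_ mf cf.
pose e n : R := 1 / (2 ^ n.+1)%:R.
have e0 n : 0 < e n by rewrite divr_gt0// ltr0n expn_gt0.
pose k n := xget 0%N [set N | forall m, (N <= m)%N -> (P [set w | (e n < `|f_ m w - f w|)%R] <= (e n)%:E)%E].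
have hk n : (P [set w | (e n < `|f_ (k n) w - f w|)%R] <= (e n)%:E)%E.
  have : [set N | forall m, (N <= m)%N -> (P [set w | (e n < `|f_ m w - f w|)%R] <= (e n)%:E)%E] (k n).
    by apply: xgetPex; exact: cf.
  exact.
exists k; pose F n := [set w | (e n < `|f_ (k n) w - f w|)%R].
have mF n : measurable (F n).
  rewrite (_ : F n = (fun w => `|f_ (k n) w - f w|) @^-1` `]e n, +oo[%classic).
    rewrite -[X in measurable X]setTI.
    have m1 : measurable_fun setT (fun w => `|f_ (k n) w - f w|).
      by apply: measurableT_comp => //; exact: measurable_funB.
    exact: m1.
  by apply/seteqP; split=> w; rewrite /F /= in_itv/= andbT.
exists (lim_sup_set F); split.
- by apply: bigcap_measurable => // n _; exact: bigcup_measurable.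
- apply: lim_sup_set_cvg0 => //.
  apply: (@le_lt_trans _ _ (\sum_(0 <= n <oo) (e n)%:E)%E).
    by apply: lee_nneseries => n _ //; exact: hk.
  apply: (@le_lt_trans _ _ 1%:E); last by rewrite ltry.
  exact: (epsilon_trick0 xpredT (ler01)).
- move=> w /= hw; apply: contrapT => nl; apply: hw.
  have [n hn] : exists n, forall m, (n <= m)%N -> ~ F m w.
    apply: contrapT => h; apply: nl => n _.
    have [m hm] : exists m, ~ ((n <= m)%N -> ~ F m w).
      by apply/not_existsP => h'; apply: h; exists n => m; apply: contrapT; exact: h'.
    move/not_implyP : hm => [nm /contrapT Fm]; by exists m.
  apply/cvgrPdist_le => d d0.
  have [j hj] := geometric_small 1 d0.
  exists (maxn n j) => // m /=; rewrite geq_max => /andP[nm jm].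
  have := hn m nm; rewrite /F /= => /negP; rewrite -leNgt distrC => /le_trans; apply.
  apply: le_trans hj; rewrite /e mul1r mul1r natrX -exprVn.
  apply: ler_wiXn2l; rewrite ?invr_ge0// ?invf_le1// ?ler1n//.
  exact: leq_trans jm _.
Qed.

Lemma adapted_cvg_prob D (f_ : nat -> T -> R) f : sigma_algebra setT D ->
  (forall n, adapted (completion D) (f_ n)) -> measurable_fun setT f ->
  cvg_prob P f_ f -> adapted (completion D) f.
Proof.
move=> sD af mf cf.
have mf_ n : measurable_fun setT (f_ n).
  exact: adapted_measurable (@completion_measurable D) (af n).
have [k hk] := cvg_prob_ae_subseq mf_ mf cf.
by apply: (@adapted_cvg_ae D (fun n => f_ (k n)) f).
Qed.

(** Dominated convergence for the indicators of the deviation events. *)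
Lemma cvg_ae_prob (f_ : nat -> T -> R) f :
  (forall n, measurable_fun setT (f_ n)) -> measurable_fun setT f ->
  {ae P, forall w, f_ ^~ w @ \oo --> f w} -> cvg_prob P f_ f.
Proof.
move=> mf_ mf cf e e0.
pose A n := [set w | (e < `|f_ n w - f w|)%R].
have mA n : measurable (A n).
  rewrite (_ : A n = (fun w => `|f_ n w - f w|) @^-1` `]e, +oo[%classic).
    rewrite -[X in measurable X]setTI.
    have m1 : measurable_fun setT (fun w => `|f_ n w - f w|).
      by apply: measurableT_comp => //; exact: measurable_funB.
    exact: m1.
  by apply/seteqP; split=> w; rewrite /A /= in_itv/= andbT.
have h : (P \o A) @ \oo --> 0%E.
  have [] := @dominated_convergence _ _ _ P setT measurableT
    (fun n w => (\1_(A n) w)%:E) (cst 0%E) (cst 1%:E).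
  - by move=> n; apply/measurable_EFinP; exact: measurable_indic.
  - exact: measurable_cst.
  - apply: filterS cf => w hw _; apply: cvg_near_cst.
    near=> n; have hn : `|f w - f_ n w| <= e.
      by near: n; exact: ((cvgrPdist_le _ _).1 hw e e0).
    by rewrite /= indicE memNset// /A /= => h; move: hn; rewrite distrC leNgt h.
  - exact: (bmeas_integrable P (bmeas_cst 1)).
  - apply: aeW => w n _; rewrite lee_fin indicE; case: (_ \in _); by rewrite ?normr1 ?normr0.
  move=> _ _; rewrite integral0; apply: cvg_trans; apply: near_eq_cvg.
  by apply: nearW => n /=; rewrite integral_indic// setIT.
have /fine_cvgP[_ /cvgrPdist_le/(_ e e0)[N _ hN]] := h.
exists N => n Nn; have := hN n Nn; rewrite /= sub0r normrN => h'.
by rewrite -/(A n) -[leLHS]fineK ?fin_num_measure// lee_fin (le_trans (ler_norm _)).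
Unshelve. all: by end_near. Qed.

Lemma adapted_lin D (I : Type) (s : seq I) (c : I -> R) (F : I -> T -> R) (a : R) :
  sigma_algebra setT D -> (forall i, adapted D (F i)) ->
  adapted D (fun w => a + \sum_(i <- s) c i * F i w).
Proof.
move=> sD aF; apply/sigma_adaptedP => //.
apply: measurable_funD; first exact: measurable_cst.
elim: s => [|i s IH].
  rewrite (_ : (fun _ => _) = cst 0); first exact: measurable_cst.
  by apply/funext => w; rewrite big_nil.
rewrite (_ : (fun _ => _) = (fun w => c i * F i w + \sum_(i <- s) c i * F i w)).
  apply: measurable_funD => //; apply: measurable_funM; first exact: measurable_cst.
  by apply/sigma_adaptedP.
by apply/funext => w; rewrite big_cons.
Qed.

Lemma vadapted_dot D d (X : T -> 'cV[R]_d) (u : 'cV[R]_d) : sigma_algebra setT D ->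
  vadapted D X -> adapted D (fun w => (u^T *m X w) ord0 ord0).
Proof.
move=> sD /(sigma_vadaptedP _ sD) aX.
have := @adapted_lin D _ (index_enum 'I_d) (fun i => u i ord0) (fun i w => X w i ord0) 0 sD aX.
rewrite (_ : (fun w => _) = (fun w => (u^T *m X w) ord0 ord0))//.
by apply/funext => w; rewrite add0r dotE.
Qed.

End Adapted.

(** * Integrals against one-dimensional normal laws *)

Section GaussianMoments.
Context {R : realType}.

Lemma integral_normal_prob (m s : R) (f : R -> \bar R) : s != 0 ->
  measurable_fun setT f -> (forall x, 0 <= f x)%E ->
  (\int[normal_prob m s]_x f x = \int[lebesgue_measure]_x (f x * (normal_pdf m s x)%:E))%E.
Proof.
move=> s0 mf f0.
rewrite -(Radon_Nikodym_SigmaFinite.change_of_variables (normal_prob_dominates m s))//.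
apply: ae_eq_integral => //.
- apply: emeasurable_funM => //; apply: measurable_int.
  exact: Radon_Nikodym_SigmaFinite.f_integrable (normal_prob_dominates m s).
- by apply: emeasurable_funM => //; apply/measurable_EFinP; exact: measurable_normal_pdf.
- apply: ae_eqe_mul2l; apply: integral_ae_eq => //.
  + exact: Radon_Nikodym_SigmaFinite.f_integrable (normal_prob_dominates m s).
  + by apply/measurable_EFinP; exact: measurable_normal_pdf.
  + move=> E _ mE.
    by rewrite -(Radon_Nikodym_SigmaFinite.f_integral (normal_prob_dominates m s)).
Qed.

Lemma integral_normal_shift (m s : R) (h : R -> R) : s != 0 -> continuous h ->
  (forall x, 0 <= h x) ->
  (\int[normal_prob m s]_y (h (y - m))%:E = \int[normal_prob 0 s]_y (h y)%:E)%E.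
Proof.
move=> s0 ch h0.
have mh : measurable_fun setT h by exact: continuous_measurable_fun.
have m1 : measurable_fun setT (fun y : R => (h (y - m))%:E).
  apply/measurable_EFinP; apply: (measurableT_comp mh).
  by apply: measurable_funB => //; exact: measurable_cst.
have m2 : measurable_fun setT (fun y : R => (h y)%:E) by exact/measurable_EFinP.
have p1 (y : R) : (0 <= (h (y - m))%:E)%E by rewrite lee_fin.
have p2 (y : R) : (0 <= (h y)%:E)%E by rewrite lee_fin.
rewrite (integral_normal_prob m s0 m1 p1) (integral_normal_prob 0 s0 m2 p2).
pose G x := h x * normal_pdf 0 s x.
have cG : continuous G by move=> x; apply: cvgM; [exact: ch|exact: continuous_normal_pdf].
pose F (x : R) := x - m.
have dF (x : R) : is_derive x 1 F 1 by rewrite -[X in is_derive _ _ _ X]subr0; apply: is_deriveB.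
have dF1 : (F^`())%classic = cst 1 by apply/funext => x; rewrite derive1E; exact: derive_val.
rewrite (@increasing_ge0_integration_by_substitutionT R F G).
- apply: eq_integral => x _; rewrite /= /G dF1/= mulr1 -EFinM; congr ((_ * _)%:E).
  by rewrite !normal_pdfE// /F /normal_fun subr0.
- by move=> x y xy; rewrite /F ltrD2r.
- by rewrite dF1 => x; exact: cvg_cst.
- by rewrite dF1; exact: is_cvg_cst.
- by rewrite dF1; exact: is_cvg_cst.
- by move=> x; exact: (@ex_derive _ _ _ _ _ _ _ (dF x)).
- by apply: cvg_addrr_Ny.
- by apply: cvg_addrr.
- exact: cG.
- by move=> x; rewrite mulr_ge0// normal_pdf_ge0.
Qed.

(** Multiplying the density of N(0, s^2) by the exponential gives [q^-1] times the density of N(0,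
    (s / q)^2), with [q = sqrt (1 - e)], and the latter has mass 1. The Gaussian moment bounds all
    come from this integral. *)
Lemma integral_normal_expR (s e : R) : 0 < s -> 0 <= e < 1 ->
  (\int[normal_prob 0 s]_x (expR (e * x ^+ 2 / (2 * s ^+ 2)))%:E =
   (Num.sqrt (1 - e))^-1%:E)%E.
Proof.
move=> s0 /andP[e0 e1]; have sn : s != 0 by rewrite gt_eqF.
have m1 : measurable_fun setT (fun x : R => (expR (e * x ^+ 2 / (2 * s ^+ 2)))%:E).
  apply/measurable_EFinP; apply: continuous_measurable_fun => x.
  apply: (@cvg_comp _ _ _ (fun x => e * x ^+ 2 / (2 * s ^+ 2)) expR); last exact: continuous_expR.
  apply: cvgMl; apply: cvgMr; exact: (@exprn_continuous R 2).
have p1 (x : R) : (0 <= (expR (e * x ^+ 2 / (2 * s ^+ 2)))%:E)%E by rewrite lee_fin expR_ge0.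
rewrite (integral_normal_prob 0 sn m1 p1).
pose q := Num.sqrt (1 - e).
have q0 : 0 < q by rewrite sqrtr_gt0; lra.
have q2 : q ^+ 2 = 1 - e by rewrite sqr_sqrtr//; lra.
have s'0 : s / q != 0 by rewrite gt_eqF// divr_gt0.
have E x : expR (e * x ^+ 2 / (2 * s ^+ 2)) * normal_pdf 0 s x =
   q^-1 * normal_pdf 0 (s / q) x.
  rewrite !normal_pdfE// mulrCA /normal_fun -expRD /normal_peak.
  have -> : e * x ^+ 2 / (2 * s ^+ 2) + - (x - 0) ^+ 2 / (s ^+ 2 *+ 2) =
            - (x - 0) ^+ 2 / ((s / q) ^+ 2 *+ 2).
    have e1n : 1 - e != 0 by rewrite gt_eqF//; lra.
    by rewrite subr0 expr_div_n q2; field; rewrite sn e1n.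
  rewrite mulrA; congr (_ * _).
  rewrite expr_div_n.
  have -> : (s ^+ 2 / q ^+ 2 * pi *+ 2) = (s ^+ 2 * pi *+ 2) / q ^+ 2.
    by field; rewrite gt_eqF.
  have p0 : 0 <= s ^+ 2 * pi *+ 2 by rewrite mulrn_wge0// mulr_ge0 ?sqr_ge0// pi_ge0.
  rewrite sqrtrM// -exprVn sqrtr_sqr ger0_norm ?invr_ge0 ?(ltW q0)//.
  by rewrite invfM invrK mulrCA mulVf ?mulr1// gt_eqF.
under eq_integral do rewrite -EFinM E EFinM.
rewrite ge0_integralZl//.
- by rewrite integral_normal_pdf mule1.
- by apply/measurable_EFinP; exact: measurable_normal_pdf.
- by move=> x _; rewrite lee_fin normal_pdf_ge0.
- by rewrite lee_fin invr_ge0 ltW.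
Qed.

End GaussianMoments.

(** * Gaussian variables and Brownian increments *)

Section GaussianLaw.
Context {R : realType} {disp : measure_display} {T : measurableType disp}.
Variable P : probability T R.
Implicit Types (X Y : T -> R).

Definition gauss_law Y (c v : R) : Prop :=
  measurable_fun setT Y /\ forall U : set R, measurable U -> P (Y @^-1` U) = normal1 c v U.

Lemma gaussian_vec_dot d (X : T -> 'cV[R]_d) m V (u : 'cV[R]_d) : gaussian_vec P X m V ->
  gauss_law (fun w => (u^T *m X w) ord0 ord0) ((u^T *m m) ord0 ord0) (quadform V u).
Proof.
move=> [mX pV gX]; split; last exact: gX.
by apply: measurable_fun_mulmx => i j; rewrite ord1; exact: measurable_fun_coord.
Qed.

Lemma gauss_law_same X Y c v : gauss_law X c v -> gauss_law Y c v -> same_law P X Y.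
Proof. by move=> [_ hX] [_ hY] U mU; rewrite hX// hY. Qed.

Lemma gauss_law0 Y c : gauss_law Y c 0 -> {ae P, forall w, Y w = c}.
Proof.
move=> [mY hY]; exists (Y @^-1` [set~ c]); split.
- rewrite -[X in measurable X]setTI; apply: mY => //; exact: measurableC.
- rewrite hY; last exact: measurableC.
  by rewrite /normal1 eqxx diracE memNset//= => /(_ erefl).
- by move=> w /= h; exact: h.
Qed.

Lemma integral_prob_cst (c : \bar R) : (\int[P]_w cst c w = c)%E.
Proof.
transitivity (c * P setT)%E; first exact: integral_cst.
by rewrite probability_setT mule1.
Qed.

Lemma integral_law d' (T' : measurableType d') (Y : T -> T') (mu : {measure set T' -> \bar R})
    (h : T' -> \bar R) :
  measurable_fun setT Y -> (forall U, measurable U -> P (Y @^-1` U) = mu U) ->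
  measurable_fun setT h -> (forall y, 0 <= h y)%E ->
  (\int[P]_w h (Y w) = \int[mu]_y h y)%E.
Proof.
move=> mY hY mh h0; pose Y' : {mfun T >-> T'} := mfun_Sub (mem_set mY).
rewrite -(@ge0_integral_distribution _ _ T T' R P Y' h)//.
by apply: eq_measure_integral => U mU _; rewrite /= /distribution /pushforward hY.
Qed.

Lemma gauss_law_integral Y c v (h : R -> R) : 0 <= v -> gauss_law Y c v -> continuous h ->
  (forall x, 0 <= h x) ->
  (\int[P]_w (h (Y w - c))%:E = if v == 0%R then (h 0%R)%:E else
     \int[normal_prob 0 (Num.sqrt v)]_y (h y)%:E)%E.
Proof.
move=> v0 gY ch h0; have [mY hY] := gY.
have mh : measurable_fun setT h by exact: continuous_measurable_fun.
have mhY : measurable_fun setT (fun w => (h (Y w - c))%:E).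
  apply/measurable_EFinP; apply: (measurableT_comp mh).
  by apply: measurable_funB => //; exact: measurable_cst.
case: ifPn => [/eqP v_0|vn0].
  rewrite v_0 in gY; transitivity (\int[P]_w (h 0)%:E)%E.
    apply: ae_eq_integral => //.
    by apply: filterS (gauss_law0 gY) => w -> _; rewrite subrr.
  by rewrite integral_prob_cst.
have sn : Num.sqrt v != 0 by rewrite gt_eqF// sqrtr_gt0 lt_def vn0.
rewrite -(integral_normal_shift c sn ch h0).
have mhc : measurable_fun setT (fun y : R => (h (y - c))%:E).
  apply/measurable_EFinP; apply: (measurableT_comp mh).
  by apply: measurable_funB => //; exact: measurable_cst.
apply: (@integral_law _ (measurableTypeR R) Y (normal_prob c (Num.sqrt v)) (fun y => (h (y - c))%:E)) => //.
- by move=> U mU; rewrite hY// /normal1 (negbTE vn0).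
- by move=> y; rewrite lee_fin.
Qed.

Lemma gauss_law_expect X Y c v (h : R -> R) : 0 <= v -> gauss_law X 0 v -> gauss_law Y c v ->
  continuous h -> (forall x, `|h x| <= 1) ->
  expect P (fun w => h (Y w - c)) = expect P (fun w => h (X w)).
Proof.
move=> v0 gX gY ch h1; have [mX _] := gX; have [mY _] := gY.
have mh : measurable_fun setT h by exact: continuous_measurable_fun.
have b Z : measurable_fun setT Z -> bmeas (fun w => h (Z w)).
  by move=> mZ; split; [exact: measurableT_comp|exists 1].
(* The integral formula is stated for nonnegative integrands; [h + 1] is one since [|h| <= 1]. *)
have E Z : measurable_fun setT Z -> expect P (fun w => h (Z w)) = expect P (fun w => h (Z w) + 1) - 1.
  by move=> mZ; rewrite expectD ?expect_cst ?addrK//; [exact: b|exact: bmeas_cst].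
have mYc : measurable_fun setT (fun w => Y w - c).
  by apply: measurable_funB => //; exact: measurable_cst.
rewrite (E _ mYc) (E _ mX); congr (fine _ - _).
have ch1 : continuous (fun x : R => h x + 1).
  by move=> x; apply: cvgD; [exact: ch|exact: cvg_cst].
have h10 x : 0 <= h x + 1 by have := h1 x; rewrite ler_norml => /andP[+ _]; lra.
rewrite (gauss_law_integral v0 gY ch1 h10) -(gauss_law_integral v0 gX ch1 h10).
by apply: eq_integral => w _; rewrite subr0.
Qed.

Lemma gauss_law_exp_moment Y v (e : R) : 0 < v -> gauss_law Y 0 v -> 0 <= e < 1 ->
  (\int[P]_w (expR (e * Y w ^+ 2 / (2 * v)))%:E = (Num.sqrt (1 - e))^-1%:E)%E.
Proof.
move=> v0 gY e01.
have ch : continuous (fun x : R => expR (e * x ^+ 2 / (2 * v))).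
  move=> x; apply: (@cvg_comp _ _ _ (fun x => e * x ^+ 2 / (2 * v)) expR); last exact: continuous_expR.
  apply: cvgMl; apply: cvgMr; exact: (@exprn_continuous R 2).
have := gauss_law_integral (ltW v0) gY ch (fun x => expR_ge0 _).
rewrite gt_eqF//; under eq_integral do rewrite subr0.
move=> ->; have sv0 : 0 < Num.sqrt v by rewrite sqrtr_gt0.
by have := integral_normal_expR sv0 e01; rewrite (sqr_sqrtr (ltW v0)).
Qed.

(** The exponential moment expanded to first order: [1 + (e / 2v) E Y^2 <= (1 - e)^(-1/2) <= 1 + e/2
    + e^2], hence [E Y^2 <= v + 2 v e], and [e] is arbitrarily small. *)
Lemma gauss_law_sqr Y v : 0 <= v -> gauss_law Y 0 v ->
  (\int[P]_w (Y w ^+ 2)%:E <= v%:E)%E.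
Proof.
rewrite le_eqVlt => /predU1P[<-|v0] gY.
  have [mY _] := gY.
  rewrite (ae_eq_integral (cst 0%E))//; first by rewrite integral0.
  - by apply/measurable_EFinP; apply: measurable_funX.
  - by apply: filterS (gauss_law0 gY) => w -> _; rewrite expr0n.
have [mY _] := gY.
have mY2 : measurable_fun setT (fun w => (Y w ^+ 2)%:E).
  by apply/measurable_EFinP; apply: measurable_funX.
apply/lee_addgt0Pr => d d0.
(* [e <= 1/2] makes the quadratic bound on [(1 - e)^(-1/2)] valid, and [2 v e <= d] absorbs the
   error. *)
pose e := Num.min (1/2) (d / (2 * v)).
have e0 : 0 < e by rewrite lt_min divr_gt0//= divr_gt0// mulr_gt0.
have e12 : e <= 1/2 by rewrite ge_min lexx.
have ed : e * (2 * v) <= d by rewrite -ler_pdivlMr ?mulr_gt0// ge_min lexx orbT.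
have e01 : 0 <= e < 1 by apply/andP; split; lra.
have hE := gauss_law_exp_moment v0 gY e01.
have q0 : 0 < Num.sqrt (1 - e) by rewrite sqrtr_gt0; lra.
have hq : (Num.sqrt (1 - e))^-1 <= 1 + e / 2 + e ^+ 2.
  rewrite -[leRHS]invrK lef_pV2 ?posrE//; last first.
    by rewrite invr_gt0; have := sqr_ge0 e; lra.
  rewrite -ler_sqr ?nnegrE ?(ltW q0)//; last by rewrite invr_ge0; have := sqr_ge0 e; lra.
  rewrite sqr_sqrtr; last lra.
  rewrite exprVn -div1r ler_pdivrMr; last by rewrite exprn_gt0//; have := sqr_ge0 e; lra.
  have -> : (1 - e) * (1 + e / 2 + e ^+ 2) ^+ 2 =
      1 + e ^+ 2 * (5 / 4 - 5 / 4 * e - e ^+ 3) by field.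
  have e3 : e ^+ 3 <= (1 / 2) ^+ 3 by apply: lerXn2r => //; rewrite nnegrE; lra.
  rewrite lerDl mulr_ge0 ?sqr_ge0//; have -> : (5 / 4 : R) = 1 + (1/2) ^+ 2 by field.
  have : (1 / 2 : R) ^+ 3 = 1 / 8 by field.
  have : (1 / 2 : R) ^+ 2 = 1 / 4 by field.
  move=> h4 h8; rewrite h8 in e3; rewrite h4; lra.
have k0 : 0 < e / (2 * v) by rewrite divr_gt0// mulr_gt0.
have : ((e / (2 * v))%:E * \int[P]_w (Y w ^+ 2)%:E + 1 <= (1 + e / 2 + e ^+ 2)%:E)%E.
  apply: (@le_trans _ _ (\int[P]_w (expR (e * Y w ^+ 2 / (2 * v)))%:E)%E); last first.
    by rewrite hE lee_fin.
  rewrite -ge0_integralZl//; last 2 first.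
  - by move=> w _; rewrite lee_fin sqr_ge0.
  - by rewrite lee_fin ltW.
  rewrite -[X in (_ + X)%E](integral_prob_cst 1%E).
  rewrite -ge0_integralD//; last 2 first.
  - by move=> w _; rewrite -EFinM lee_fin mulr_ge0 ?sqr_ge0 ?(ltW k0).
  - by apply: emeasurable_funM => //; exact: measurable_cst.
  apply: ge0_le_integral => //.
  - move=> w _; rewrite -EFinM -EFinD lee_fin addr_ge0// mulr_ge0 ?sqr_ge0 ?(ltW k0)//.
  - apply: emeasurable_funD; last exact: measurable_cst.
    by apply: emeasurable_funM => //; exact: measurable_cst.
  - apply/measurable_EFinP; apply: (measurableT_comp (@measurable_expR R)).
    apply: measurable_funM; last exact: measurable_cst.
    by apply: measurable_funM; [exact: measurable_cst|exact: measurable_funX].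
  - move=> w _; rewrite -EFinM -EFinD lee_fin /= addrC mulrAC.
    exact: expR_ge1Dx.
have : (0 <= \int[P]_w (Y w ^+ 2)%:E)%E by apply: integral_ge0 => w _; rewrite lee_fin sqr_ge0.
case: (\int[P]_w _)%E => [z| |]//= z0.
  rewrite -EFinM -!EFinD !lee_fin => h.
  have : e / (2 * v) * z <= e / (2 * v) * (v + 2 * v * e).
    have -> : e / (2 * v) * (v + 2 * v * e) = e / 2 + e ^+ 2.
      by field; rewrite gt_eqF.
    lra.
  by rewrite ler_pM2l// => /le_trans; apply; lra.
by rewrite gt0_muley ?lte_fin// addye// leye_eq.
Qed.

(** With [t = Y^2 / (4 v)], the inequality [t^n <= n! exp t] bounds the power by an exponential
    whose expectation, at [e = 1/2], is [sqrt 2]. The result exceeds the true moment but fits the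
    constant of the theorem. *)
Lemma gauss_law_moment Y v n : 0 <= v -> gauss_law Y 0 v ->
  (\int[P]_w (Y w ^+ (2 * n))%:E <= (Num.sqrt 2 * (4 * v) ^+ n * n`!%:R)%:E)%E.
Proof.
rewrite le_eqVlt => /predU1P[<-|v0] gY; have [mY _] := gY.
  rewrite (ae_eq_integral (cst ((0 : R) ^+ (2 * n))%:E))//.
  - rewrite integral_prob_cst lee_fin mulr0.
    case: n => [|n]; last by rewrite muln0 || rewrite mulnS expr0n/= expr0n/= mulr0 mul0r.
    by rewrite muln0 !expr0 fact0 !mulr1 -{1}sqrtr1 ler_sqrt//; lra.
  - by apply/measurable_EFinP; apply: measurable_funX.
  - by apply: filterS (gauss_law0 gY) => w -> _.
have h2 : 0 <= (1/2 : R) < 1 by apply/andP; split; lra.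
have := gauss_law_exp_moment v0 gY h2.
have -> : (Num.sqrt (1 - 1 / 2))^-1 = Num.sqrt 2 :> R.
  by rewrite (_ : 1 - 1/2 = 2^-1 :> R) ?sqrtrV// ?invrK//; lra.
move=> hE; pose c := (4 * v) ^+ n * n`!%:R.
have c0 : 0 <= c by rewrite mulr_ge0// exprn_ge0// mulr_ge0// ltW.
apply: (@le_trans _ _ (\int[P]_w (c%:E * (expR (1 / 2 * Y w ^+ 2 / (2 * v)))%:E))%E).
  apply: ge0_le_integral => //.
  - by move=> w _; rewrite lee_fin exprM exprn_ge0// sqr_ge0.
  - by apply/measurable_EFinP; apply: measurable_funX.
  - apply: emeasurable_funM; first exact: measurable_cst.
    apply/measurable_EFinP; apply: (measurableT_comp (@measurable_expR R)).
    apply: measurable_funM; last exact: measurable_cst.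
    by apply: measurable_funM; [exact: measurable_cst|exact: measurable_funX].
  - move=> w _; rewrite -EFinM lee_fin exprM.
    set y := Y w ^+ 2; have y0 : 0 <= y by exact: sqr_ge0.
    set t := 1 / 2 * y / (2 * v).
    have yE : y = 4 * v * t by rewrite /t; field; rewrite gt_eqF.
    have t0 : 0 <= t.
      by rewrite /t divr_ge0//; [rewrite mulr_ge0|rewrite mulr_ge0 ?(ltW v0)].
    rewrite {1}yE exprMn /c -mulrA ler_wpM2l//.
      by rewrite exprn_ge0// mulr_ge0// ltW.
    rewrite mulrC -ler_pdivrMr ?ltr0n ?fact_gt0//.
    apply: (@le_trans _ _ (series (exp_coeff t) n.+1)).
      rewrite /series/= big_nat_recr//= /exp_coeff/= lerDr sumr_ge0// => k _.
      by rewrite divr_ge0 ?exprn_ge0.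
    apply: nondecreasing_cvgn_le; last exact: is_cvg_series_exp_coeff.
    by apply: nondecreasing_series => k _ _; exact: exp_coeff_ge0.
rewrite ge0_integralZl//.
- by rewrite hE -EFinM lee_fin /c mulrC mulrA.
- apply/measurable_EFinP; apply: (measurableT_comp (@measurable_expR R)).
  apply: measurable_funM; last exact: measurable_cst.
  by apply: measurable_funM; [exact: measurable_cst|exact: measurable_funX].
Qed.

End GaussianLaw.

(** * Gaussian laws relative to a reference Brownian motion *)

Section BrownianIncrements.
Context {R : realType} {disp : measure_display} {T : measurableType disp}.
Variable P : probability T R.
Context {d : nat}.
Variable W : R -> T -> 'cV[R]_d.+1.
Hypothesis hW : brownian P W.
Implicit Types (X Y : T -> R).

Let e0 : 'cV[R]_d.+1 := delta_mx ord0 ord0.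
Let ref (s t : R) (w : T) : R := (e0^T *m (W t w - W s w)) ord0 ord0.

Definition gchar (v : R) : R := expect P (fun w => cos (ref 0 v w)).

Let norm_e0 : norm2 e0 ^+ 2 = 1.
Proof. by rewrite sqr_norm2_dot trmx_delta mul_delta_mx mxE !eqxx. Qed.

Let gauss_ref s t : 0 <= s -> s <= t -> gauss_law P (ref s t) 0 (t - s).
Proof.
move=> s0 st; have [_ _ h _] := hW.
have := gaussian_vec_dot e0 (h s t s0 st).
by rewrite mulmx0 mxE quadform_scalar norm_e0 mulr1.
Qed.

Let measurable_ref s t : 0 <= s -> s <= t -> measurable_fun setT (ref s t).
Proof. by move=> s0 st; have [] := gauss_ref s0 st. Qed.

(* The first coordinate of [W] serves as a reference Gaussian family: [gchar v]
   is the characteristic function of N(0, v) at 1. *)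
Definition char_gauss Y (v : R) : Prop :=
  [/\ measurable_fun setT Y, 0 <= v, expect P (fun w => cos (Y w)) = gchar v &
      expect P (fun w => sin (Y w)) = 0].

(** The centred increment and its opposite have the same law, and the sine is odd. *)
Let sin_ref v : 0 <= v -> expect P (fun w => sin (ref 0 v w)) = 0.
Proof.
move=> v0; have [_ _ h _] := hW.
have g1 := gauss_ref (lexx 0) v0; rewrite subr0 in g1.
have g2 : gauss_law P (fun w => - ref 0 v w) 0 v.
  have := gaussian_vec_dot (- e0) (h 0 v (lexx 0) v0).
  rewrite mulmx0 mxE quadform_scalar norm2N norm_e0 mulr1 subr0.
  rewrite (_ : (fun w => _) = (fun w => - ref 0 v w))//.
  by apply/funext => w; rewrite linearN/= mulNmx mxE.
have := gauss_law_expect v0 g1 g2 (@continuous_sin R) (@norm_sin_le1 R).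
rewrite (_ : (fun w => sin _) = (fun w => (-1) * sin (ref 0 v w))); last first.
  by apply/funext => w; rewrite subr0 sinN mulN1r.
rewrite expectZ; last exact: bmeas_sin (measurable_ref (lexx 0) v0).
by lra.
Qed.

Lemma gauss_law_char Y c v : 0 <= v -> gauss_law P Y c v -> char_gauss (fun w => Y w - c) v.
Proof.
move=> v0 gY; have [mY _] := gY.
have g1 := gauss_ref (lexx 0) v0; rewrite subr0 in g1.
split => //.
- by apply: measurable_funB => //; exact: measurable_cst.
- exact: (gauss_law_expect v0 g1 gY (@continuous_cos R) (@norm_cos_le1 R)).
- rewrite (gauss_law_expect v0 g1 gY (@continuous_sin R) (@norm_sin_le1 R)).
  exact: sin_ref.
Qed.

Lemma gchar0 : gchar 0 = 1.
Proof.
rewrite /gchar -[RHS](expect_cst P 1); congr expect; apply/funext => w.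
by rewrite /ref subrr mulmx0 mxE cos0.
Qed.

Lemma sub_sigma_vec_measurable n (X : T -> 'cV[R]_n) : rvec X -> sigma_vec X `<=` measurable.
Proof.
move=> mX _ [U mU ->]; rewrite -[X in measurable X]setTI; exact: mX.
Qed.

Lemma sigma_vec_sigma_algebra n (X : T -> 'cV[R]_n) : sigma_algebra setT (sigma_vec X).
Proof.
split.
- by exists set0 => //; rewrite preimage_set0.
- move=> _ [U mU ->]; exists (~` U); first exact: measurableC.
  by rewrite setTD preimage_setC.
- move=> F hF; have hU n0 : exists U : set (bvec R n), measurable U /\ F n0 = X @^-1` U.
    by have [U mU FU] := hF n0; exists U.
  pose U k := xget set0 [set U : set (bvec R n) | measurable U /\ F k = X @^-1` U].
  have hU' k : measurable (U k) /\ F k = X @^-1` U k.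
    exact: (xgetPex set0 (hU k)).
  exists (\bigcup_k U k); first by apply: bigcup_measurable => k _; case: (hU' k).
  by rewrite preimage_bigcup; apply: eq_bigcup => // k _; case: (hU' k).
Qed.

Lemma sigma_vec_dot n (X : T -> 'cV[R]_n) (u : 'cV[R]_n) :
  adapted (sigma_vec X) (fun w => (u^T *m X w) ord0 ord0).
Proof.
apply: vadapted_dot; first exact: sigma_vec_sigma_algebra.
by move=> U mU; exists U.
Qed.

(** Addition theorems stand in for products of complex characteristic functions: independence
    factors each term, and the terms with a sine vanish. *)
Lemma char_gaussD (D E : set (set T)) X Y v u : indep P D E ->
  D `<=` measurable -> E `<=` measurable -> adapted D X -> adapted E Y ->
  char_gauss X v -> char_gauss Y u ->
  (0 <= v -> 0 <= u -> gchar (v + u) = gchar v * gchar u) ->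
  char_gauss (fun w => X w + Y w) (v + u).
Proof.
move=> iDE mD mE aX aY [mX v0 cX sX] [mY u0 cY sY] gD.
have mXY : measurable_fun setT (fun w => X w + Y w) by exact: measurable_funD.
have prod (f g : R -> R) : continuous f -> continuous g -> (forall x, `|f x| <= 1) ->
    (forall x, `|g x| <= 1) ->
    expect P (fun w => f (X w) * g (Y w)) = expect P (fun w => f (X w)) * expect P (fun w => g (Y w)).
  move=> cf cg f1 g1.
  have mf : measurable_fun setT f by exact: continuous_measurable_fun.
  have mg : measurable_fun setT g by exact: continuous_measurable_fun.
  apply: (expectM_indep iDE) => //.
  - by split; [exact: measurableT_comp|exists 1].
  - by split; [exact: measurableT_comp|exists 1].
  - move=> a b; apply: (aX (f @^-1` `[a, b[%classic)).
    by rewrite -[X in measurable X]setTI; exact: mf.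
  - move=> a b; apply: (aY (g @^-1` `[a, b[%classic)).
    by rewrite -[X in measurable X]setTI; exact: mg.
have cc := @continuous_cos R; have cs := @continuous_sin R.
have nc := @norm_cos_le1 R; have ns := @norm_sin_le1 R.
split => //; first exact: addr_ge0.
- under eq_fun do rewrite cosD.
  rewrite expectB; [|by apply: bmeasM; exact: bmeas_cos|by apply: bmeasM; exact: bmeas_sin].
  by rewrite !prod// cX cY sX mul0r subr0 gD.
- under eq_fun do rewrite sinD.
  rewrite expectD; [|by apply: bmeasM; [exact: bmeas_sin|exact: bmeas_cos]|by apply: bmeasM; [exact: bmeas_cos|exact: bmeas_sin]].
  by rewrite !prod// sX sY mul0r mulr0 addr0.
Qed.

(** The increment over [[0, v + u]] is cut at time [v] into two independent parts: the convolution
    property of normal laws, obtained from Brownian motion. *)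
Lemma gcharD v u : 0 <= v -> 0 <= u -> gchar (v + u) = gchar v * gchar u.
Proof.
move=> v0 u0; have [_ _ h hi] := hW.
(* The times 0, [v], [v + u], constant from then on so as to remain nondecreasing. *)
pose t (k : nat) : R := if k is k'.+1 then (if k' is _.+1 then v + u else v) else 0.
have tn k : t k <= t k.+1.
  by case: k => [|[|k]] //=; rewrite lerDl.
have iW := hi 2%N t (lexx 0) tn.
have i2 : indep P (sigma_vec (fun w => W (t 1%N) w - W (t 0%N) w))
                  (sigma_vec (fun w => W (t 2%N) w - W (t 1%N) w)).
  move=> A B hA hB; pose E (i : 'I_2) := if i == ord0 then A else B.
  have := iW E; rewrite (_ : \bigcap_i E i = A `&` B); last first.
    apply/seteqP; split=> [w h'|w [Aw Bw] i _].
      by split; [exact: (h' ord0)|exact: (h' ord_max)].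
    by rewrite /E; case: ifP.
  rewrite big_ord_recl big_ord1 => -> // i; rewrite /E.
  by case: i => [[|[|//]]] //= i2.
have g1 := gauss_ref (lexx 0) v0; rewrite subr0 in g1.
have vu : v <= v + u by rewrite lerDl.
have g2 := gauss_ref v0 vu; rewrite (_ : v + u - v = u) in g2; last by ring.
have g3 := gauss_ref (lexx 0) (addr_ge0 v0 u0); rewrite subr0 in g3.
have c1 := gauss_law_char v0 g1; have c2 := gauss_law_char u0 g2.
have mW a b : 0 <= a -> a <= b -> rvec (fun w => W b w - W a w).
  by move=> a0 ab; have [] := h a b a0 ab.
have [m1 _ cc1 s1] := c1; have [m2 _ cc2 s2] := c2.
have pr (f g : R -> R) : continuous f -> continuous g -> (forall x, `|f x| <= 1) ->
    (forall x, `|g x| <= 1) ->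
    expect P (fun w => f (ref 0 v w) * g (ref v (v + u) w)) =
    expect P (fun w => f (ref 0 v w)) * expect P (fun w => g (ref v (v + u) w)).
  move=> cf cg f1 g1'.
  have mf : measurable_fun setT f by exact: continuous_measurable_fun.
  have mg : measurable_fun setT g by exact: continuous_measurable_fun.
  apply: (expectM_indep i2).
  - by apply: sub_sigma_vec_measurable; exact: mW.
  - by apply: sub_sigma_vec_measurable; exact: mW.
  - by split; [apply: measurableT_comp => //; exact: measurable_ref|exists 1].
  - by split; [apply: measurableT_comp => //; exact: measurable_ref|exists 1].
  - move=> a b; apply: (@sigma_vec_dot _ (fun w => W v w - W 0 w) e0 (f @^-1` `[a, b[%classic)).
    by rewrite -[X in measurable X]setTI; exact: mf.
  - move=> a b; apply: (@sigma_vec_dot _ (fun w => W (v + u) w - W v w) e0 (g @^-1` `[a, b[%classic)).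
    by rewrite -[X in measurable X]setTI; exact: mg.
rewrite {1}/gchar.
have -> : (fun w => cos (ref 0 (v + u) w)) = (fun w => cos (ref 0 v w) * cos (ref v (v + u) w)
     - sin (ref 0 v w) * sin (ref v (v + u) w)).
  apply/funext => w; rewrite -cosD; congr cos.
  rewrite /ref -mx11D -mulmxDr; congr ((_ *m _) _ _).
  by rewrite [RHS]addrC subrKA.
have cc := @continuous_cos R; have cs := @continuous_sin R.
have nc := @norm_cos_le1 R; have ns := @norm_sin_le1 R.
have m1' := measurable_ref (lexx 0) v0; have m2' := measurable_ref v0 vu.
rewrite expectB; [|by apply: bmeasM; exact: bmeas_cos|by apply: bmeasM; exact: bmeas_sin].
rewrite !pr// sin_ref// mul0r subr0; congr (_ * _).
by rewrite -cc2; congr expect; apply/funext => w; rewrite subr0.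
Qed.

(** Almost sure continuity of the paths of [W] carries the limit from the variances to the reference
    variables; the cosine, bounded and Lipschitz, carries it to the expectations. *)
Lemma gchar_continuous (v_ : nat -> R) (v : R) : (forall n, 0 <= v_ n) -> 0 <= v ->
  v_ @ \oo --> v -> gchar \o v_ @ \oo --> gchar v.
Proof.
move=> vn0 v0 vv; have [[_ cW] _ _ _] := hW.
have mr n := measurable_ref (lexx 0) (vn0 n).
have mr0 := measurable_ref (lexx 0) v0.
have hp : cvg_prob P (fun n => ref 0 (v_ n)) (ref 0 v).
  apply: cvg_ae_prob => //; apply: filterS cW => w cw.
  have hc : (fun n => W (v_ n) w) @ \oo --> W v w.
    have /subspace_continuousP/(_ v) := cw.
    rewrite /= in_itv/= andbT => /(_ v0) h.
    apply: (@cvg_comp _ _ _ v_ (fun t => W t w) \oo (within `[0, +oo[ (nbhs v))) => //.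
    move=> A /= hA; have [N _ hN] := vv _ hA; exists N => // n Nn.
    by apply: hN => //=; rewrite in_itv/= vn0.
  rewrite (_ : (fun n => _) = (fun n => W (v_ n) w ord0 ord0 - W 0 w ord0 ord0)); last first.
    by apply/funext => n; rewrite /ref trmx_delta -rowE !mxE.
  rewrite (_ : ref 0 v w = W v w ord0 ord0 - W 0 w ord0 ord0); last first.
    by rewrite /ref trmx_delta -rowE !mxE.
  apply: cvgB; last exact: cvg_cst.
  exact: (@cvg_comp _ _ _ _ (fun M : 'cV[R]_d.+1 => M ord0 ord0) _ _ _ hc (@coord_continuous _ _ _ _ _ _)).
have := @cvg_prob_expect _ _ _ P (@cos R) (fun n => ref 0 (v_ n)) (ref 0 v) (fun=> 1)
  (@cos_lipschitz R) (@norm_cos_le1 R) (continuous_measurable_fun (@continuous_cos R)) (bmeas_cst 1) mr mr0 hp.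
rewrite /gchar (_ : (fun w => 1 * _) = (fun w => cos (ref 0 v w))); last first.
  by apply/funext => w; rewrite mul1r.
rewrite (_ : (fun n => expect P _) = (fun n => expect P (fun w => cos (ref 0 (v_ n) w))))//.
by apply/funext => n; congr expect; apply/funext => w; rewrite mul1r.
Qed.

Lemma char_gauss_cvg (Y_ : nat -> T -> R) (v_ : nat -> R) Y (v : R) :
  (forall n, char_gauss (Y_ n) (v_ n)) -> measurable_fun setT Y -> cvg_prob P Y_ Y ->
  0 <= v -> v_ @ \oo --> v -> char_gauss Y v.
Proof.
move=> cY mY YY v0 vv.
have mY_ n : measurable_fun setT (Y_ n) by case: (cY n).
have vn0 n : 0 <= v_ n by case: (cY n).
have lim (phi : R -> R) : (forall x y, `|phi x - phi y| <= `|x - y|) -> (forall x, `|phi x| <= 1) ->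
    continuous phi -> (fun n => expect P (fun w => phi (Y_ n w))) @ \oo --> expect P (fun w => phi (Y w)).
  move=> lp p1 cp.
  have := @cvg_prob_expect _ _ _ P phi Y_ Y (fun=> 1) lp p1 (continuous_measurable_fun cp) (bmeas_cst 1) mY_ mY YY.
  rewrite (_ : (fun w => 1 * _) = (fun w => phi (Y w))); last first.
    by apply/funext => w; rewrite mul1r.
  rewrite (_ : (fun n => expect P _) = (fun n => expect P (fun w => phi (Y_ n w))))//.
  by apply/funext => n; congr expect; apply/funext => w; rewrite mul1r.
split => //.
- have := lim _ (@cos_lipschitz R) (@norm_cos_le1 R) (@continuous_cos R).
  rewrite (_ : (fun n => _) = gchar \o v_); last by apply/funext => n; case: (cY n).
  by move=> h; exact: (cvg_unique _ h (gchar_continuous vn0 v0 vv)).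
- have := lim _ (@sin_lipschitz R) (@norm_sin_le1 R) (@continuous_sin R).
  rewrite (_ : (fun n => _) = cst 0); last by apply/funext => n; case: (cY n).
  by move=> h; exact: (cvg_unique _ h (cvg_cst _)).
Qed.

End BrownianIncrements.

(** * Weighted sums of independent Brownian increments *)

Section BrownianSums.
Context {R : realType} {disp : measure_display} {T : measurableType disp}.
Variable P : probability T R.
Context {d : nat}.
Variable W : R -> T -> 'cV[R]_d.+1.
Hypothesis hW : brownian P W.

Lemma char_gauss_ae (X Y : T -> R) v : char_gauss P W X v -> measurable_fun setT Y ->
  {ae P, forall w, X w = Y w} -> char_gauss P W Y v.
Proof.
move=> [mX v0 cX sX] mY XY; split => //.
- rewrite -cX; apply: expect_ae; [exact: bmeas_cos|exact: bmeas_cos|].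
  by apply: filterS XY => w ->.
- rewrite -sX; apply: expect_ae; [exact: bmeas_sin|exact: bmeas_sin|].
  by apply: filterS XY => w ->.
Qed.

Context {n : nat}.
Variable B : R -> T -> 'cV[R]_n.
Hypothesis hB : brownian P B.

Let inc (t : nat -> R) k w := B (t k.+1) w - B (t k) w.

Lemma brownian_increment_char (u : 'cV[R]_n) (s t : R) : 0 <= s -> s <= t ->
  char_gauss P W (fun w => (u^T *m (B t w - B s w)) ord0 ord0) (norm2 u ^+ 2 * (t - s)).
Proof.
move=> s0 st; have [_ _ h _] := hB.
have := gaussian_vec_dot u (h s t s0 st); rewrite mulmx0 mxE quadform_scalar mulrC => g.
have v0 : 0 <= norm2 u ^+ 2 * (t - s) by rewrite mulr_ge0 ?sqr_ge0// subr_ge0.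
have := gauss_law_char hW v0 g.
by rewrite (_ : (fun w => _ - 0) = (fun w => (u^T *m (B t w - B s w)) ord0 ord0))//; apply/funext => w; rewrite subr0.
Qed.

Lemma brownian_rvec (s t : R) : 0 <= s -> s <= t -> rvec (fun w => B t w - B s w).
Proof. by move=> s0 st; have [_ _ h _] := hB; have [] := h s t s0 st. Qed.

Let prodEFin (I : Type) (l : seq I) (F : I -> set T) : (forall i, measurable (F i)) ->
  (\big[*%E/1]_(i <- l) P (F i) = (\prod_(i <- l) fine (P (F i)))%:E)%E.
Proof.
move=> mF; elim: l => [|i l IH]; first by rewrite !big_nil.
by rewrite !big_cons IH EFinM fineK// fin_num_measure.
Qed.

Lemma brownian_sum_char (t : nat -> R) (a : nat -> 'cV[R]_n) N : 0 <= t 0%N ->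
  (forall k, t k <= t k.+1) ->
  char_gauss P W (fun w => \sum_(k < N) ((a k)^T *m (B (t k.+1) w - B (t k) w)) ord0 ord0)
   (\sum_(k < N) norm2 (a k) ^+ 2 * (t k.+1 - t k)).
Proof.
move=> t0 tm; have [_ _ _ hi] := hB.
have tk0 k : 0 <= t k by elim: k => // k /le_trans; apply.
pose X k w := ((a k)^T *m inc t k w) ord0 ord0.
pose S m w := \sum_(k < m) X k w.
pose V m := \sum_(k < m) norm2 (a k) ^+ 2 * (t k.+1 - t k).
have V0 m : 0 <= V m by apply: sumr_ge0 => k _; rewrite mulr_ge0 ?sqr_ge0// subr_ge0.
have cX k := brownian_increment_char (a k) (tk0 k) (tm k).
have mX k : measurable_fun setT (X k) by case: (cX k).
have mS m : measurable_fun setT (S m) by apply: measurable_sum => k; exact: mX.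
pose F (E : nat -> set T) := forall i, sigma_vec (inc t i) (E i).
have FT m E G : F E -> sigma_vec (inc t m) G -> F (fun i => if i == m then G else E i).
  by move=> FE hG i; case: eqP => [->|_].
have mF E i : F E -> measurable (E i).
  move=> FE; apply: (@sub_sigma_vec_measurable _ _ _ _ (inc t i)) => //.
  exact: brownian_rvec.
pose Ev m (E : nat -> set T) := [set w | forall i, (m <= i < N)%N -> E i w].
pose pr m (E : nat -> set T) := \prod_(m <= i < N) fine (P (E i)).
have mEv m E : F E -> measurable (Ev m E).
  move=> FE; rewrite (_ : Ev m E = \bigcap_(i in [set i | (m <= i < N)%N]) E i); last first.
    by apply/seteqP; split => w h i; exact: h.
  by apply: bigcap_measurableType => i _; exact: mF.
have bE m E : F E -> bmeas (\1_(Ev m E) : T -> R) by move=> FE; apply: bmeas_indic; exact: mEv.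
have EvS m E G w : (m < N)%N -> \1_(Ev m.+1 E) w * \1_G w =
    \1_(Ev m (fun i => if i == m then G else E i)) w :> R.
  move=> mN; rewrite indicM; congr (\1__ w); apply/seteqP; split=> {}w.
    move=> [h Gw] i /andP[mi iN]; case: eqP => // /eqP im; apply: h.
    by rewrite iN andbT ltn_neqAle eq_sym im.
  move=> h; split; last by have := h m; rewrite leqnn eqxx; exact.
  move=> i /andP[mi iN]; have := h i; rewrite (ltnW mi) iN (gtn_eqF mi); exact.
have prS m E G : (m < N)%N -> pr m (fun i => if i == m then G else E i) = fine (P G) * pr m.+1 E.
  move=> mN; rewrite /pr big_ltn//= eqxx; congr (_ * _).
  rewrite big_nat [RHS]big_nat; apply: eq_bigr => i /andP[mi _].
  by rewrite gtn_eqF.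
(* Keeping the indicators of events on the later increments makes the induction
   go through without independence of generated sigma-algebras. *)
have claim m : (m <= N)%N -> forall E, F E ->
    expect P (fun w => cos (S m w) * \1_(Ev m E) w) = gchar P W (V m) * pr m E /\
    expect P (fun w => sin (S m w) * \1_(Ev m E) w) = 0.
  elim: m => [_|m IH mN] E FE.
    have S0 w : S 0%N w = 0 by rewrite /S big_ord0.
    have V00 : V 0%N = 0 by rewrite /V big_ord0.
    split; last first.
      rewrite -[RHS](expect_cst P 0); congr expect; apply/funext => w.
      by rewrite S0 sin0 mul0r.
    rewrite (_ : (fun w => _) = \1_(Ev 0%N E)); last first.
      by apply/funext => w; rewrite S0 cos0 mul1r.
    rewrite expect_indic; last exact: mEv.
    rewrite V00 (gchar0 P W) mul1r.
    have := hi N t t0 tm (fun i => E i) (fun i => FE i).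
    rewrite (_ : \bigcap_(i : 'I_N) E i = Ev 0%N E); last first.
      apply/seteqP; split=> w h i; last by move=> _; apply: h => /=.
      by move=> /= iN; exact: (h (Ordinal iN)).
    by move=> ->; rewrite prodEFin/=; [rewrite /pr big_mkord|move=> i; exact: mF].
  have {}IH := IH (ltnW mN).
  have SS w : S m.+1 w = S m w + X m w by rewrite /S big_ord_recr.
  have VS : V m.+1 = V m + norm2 (a m) ^+ 2 * (t m.+1 - t m) by rewrite /V big_ord_recr.
  have [_ v0 ccX ssX] := cX m.
  have bcS : bmeas (fun w => cos (S m w)) by exact: bmeas_cos.
  have bsS : bmeas (fun w => sin (S m w)) by exact: bmeas_sin.
  have bcX : bmeas (fun w => cos (X m w)) by exact: bmeas_cos.
  have bsX : bmeas (fun w => sin (X m w)) by exact: bmeas_sin.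
  have hT : sigma_vec (inc t m) setT by exists setT => //; rewrite preimage_setT.
  have E1 w : \1_(Ev m.+1 E) w = \1_(Ev m (fun i => if i == m then setT else E i)) w :> R.
    by rewrite -(EvS m E setT w mN) indicT mulr1.
  have PT : fine (P setT) = 1 by exact: (congr1 fine (probability_setT P)).
  have HE : expect P (fun w => cos (S m w) * \1_(Ev m.+1 E) w) = gchar P W (V m) * pr m.+1 E.
    have [h _] := IH _ (FT m E setT FE hT).
    under eq_fun do rewrite E1.
    by rewrite h prS// PT mul1r.
  have HE' : expect P (fun w => sin (S m w) * \1_(Ev m.+1 E) w) = 0.
    have [_ h] := IH _ (FT m E setT FE hT).
    by under eq_fun do rewrite E1.
  have aX (g : R -> R) : measurable_fun setT g -> forall b c : R,
      sigma_vec (inc t m) ((fun w => g (X m w)) @^-1` `[b, c[%classic).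
    move=> mg b c; apply: (@sigma_vec_dot _ _ _ _ (inc t m) (a m) (g @^-1` `[b, c[%classic)).
    by rewrite -[X in measurable X]setTI; exact: mg.
  have mcos : measurable_fun setT (@cos R) by exact: continuous_measurable_fun (@continuous_cos R).
  have msin : measurable_fun setT (@sin R) by exact: continuous_measurable_fun (@continuous_sin R).
  (* An event [G] of increment [m] is stored at index [m] of the family [E]; the induction
     hypothesis for this enlarged family says that the partial sum, weighted by the later events, is
     uncorrelated with [G]. *)
  have dec (f g : R -> R) c : measurable_fun setT g -> bmeas (fun w => f (S m w)) ->
      bmeas (fun w => g (X m w)) ->
      (forall E, F E -> expect P (fun w => f (S m w) * \1_(Ev m E) w) = c * pr m E) ->
      expect P (fun w => (f (S m w) * \1_(Ev m.+1 E) w) * g (X m w)) =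
      expect P (fun w => f (S m w) * \1_(Ev m.+1 E) w) * expect P (fun w => g (X m w)).
    move=> mg bf bg hf.
    apply: (@expectM_decorrelated _ _ _ P (sigma_vec (inc t m))) => //; last exact: aX.
      by apply: bmeasM => //; exact: bE.
    move=> G hG; split.
      by apply: (@sub_sigma_vec_measurable _ _ _ _ (inc t m)) hG; exact: brownian_rvec.
    under eq_fun do rewrite -mulrA EvS//.
    rewrite hf; last exact: FT.
    under [in RHS]eq_fun do rewrite E1.
    rewrite hf; last exact: FT.
    by rewrite !prS// PT mul1r [fine _ * _]mulrC mulrA.
  have hs E' : F E' -> expect P (fun w => sin (S m w) * \1_(Ev m E') w) = 0 * pr m E'.
    by move=> /IH[_ ->]; rewrite mul0r.
  have hc E' : F E' -> expect P (fun w => cos (S m w) * \1_(Ev m E') w) = gchar P W (V m) * pr m E'.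
    by move=> /IH[-> _].
  have bM (f g : T -> R) : bmeas f -> bmeas g -> bmeas (fun w => f w * \1_(Ev m.+1 E) w * g w).
    by move=> bf bg; apply: bmeasM => //; apply: bmeasM => //; exact: bE.
  split.
    rewrite (_ : (fun w => _) = (fun w => cos (S m w) * \1_(Ev m.+1 E) w * cos (X m w)
        - sin (S m w) * \1_(Ev m.+1 E) w * sin (X m w))); last first.
      by apply/funext => w; rewrite SS cosD; ring.
    rewrite expectB; [|exact: bM|exact: bM].
    rewrite (dec (@cos R) (@cos R) _ mcos bcS bcX hc) (dec (@sin R) (@sin R) _ msin bsS bsX hs).
    by rewrite HE HE' mul0r subr0 ccX VS (gcharD hW)// mulrAC.
  rewrite (_ : (fun w => _) = (fun w => sin (S m w) * \1_(Ev m.+1 E) w * cos (X m w)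
      + cos (S m w) * \1_(Ev m.+1 E) w * sin (X m w))); last first.
    by apply/funext => w; rewrite SS sinD; ring.
  rewrite expectD; [|exact: bM|exact: bM].
  rewrite (dec (@cos R) (@sin R) _ msin bcS bsX hc) (dec (@sin R) (@cos R) _ mcos bsS bcX hs).
  by rewrite HE HE' ssX mul0r mulr0 addr0.
have FTT : F (fun=> setT) by move=> i; exists setT => //; rewrite preimage_setT.
have E1 w : \1_(Ev N (fun=> setT)) w = 1 :> R by rewrite indicE mem_set.
have [hc hs] := claim N (leqnn N) _ FTT.
split; [exact: mS|exact: V0| |].
- rewrite -/(V N); transitivity (gchar P W (V N) * pr N (fun=> setT)); last by rewrite /pr big_geq// mulr1.
  rewrite -hc; congr expect; apply/funext => w; by rewrite E1 mulr1.
- by rewrite -[RHS]hs; congr expect; apply/funext => w; rewrite E1 mulr1.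
Qed.

End BrownianSums.

(** * Calculus of limits in probability *)

Section ProbLimits.
Context {R : realType} {disp : measure_display} {T : measurableType disp}.
Variable P : probability T R.
Implicit Types (f g h : T -> R).

Lemma measurable_gt_norm f g (e : R) : measurable_fun setT f -> measurable_fun setT g ->
  measurable [set w | (e < `|f w - g w|)%R].
Proof.
move=> mf mg.
rewrite (_ : [set w | _] = (fun w => `|f w - g w|) @^-1` `]e, +oo[%classic).
  rewrite -[X in measurable X]setTI.
  have m1 : measurable_fun setT (fun w => `|f w - g w|).
    by apply: measurableT_comp => //; exact: measurable_funB.
  exact: m1.
by apply/seteqP; split=> w /=; rewrite in_itv/= andbT.
Qed.

Lemma prob_dist_triangle f g h (a b : R) : measurable_fun setT f -> measurable_fun setT g ->
  measurable_fun setT h ->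
  (P [set w | (a + b < `|f w - h w|)%R] <=
   P [set w | (a < `|f w - g w|)%R] + P [set w | (b < `|g w - h w|)%R])%E.
Proof.
move=> mf mg mh.
apply: le_trans (measureU2 _ _ _); [|exact: measurable_gt_norm..].
apply: le_measure; rewrite ?inE; [exact: measurable_gt_norm|apply: measurableU; exact: measurable_gt_norm|].
move=> w /=; have [h1|h1] := ltP a `|f w - g w|; first by left.
have [h2|h2] := ltP b `|g w - h w|; first by right.
by move=> h3; have := ler_distD (g w) (f w) (h w); lra.
Qed.

Lemma cvg_probD (f_ g_ : nat -> T -> R) f g :
  (forall n, measurable_fun setT (f_ n)) -> (forall n, measurable_fun setT (g_ n)) ->
  measurable_fun setT f -> measurable_fun setT g ->
  cvg_prob P f_ f -> cvg_prob P g_ g ->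
  cvg_prob P (fun n w => f_ n w + g_ n w) (fun w => f w + g w).
Proof.
move=> mf_ mg_ mf mg cf cg e e0.
have e20 : 0 < e / 2 by rewrite divr_gt0.
have [N hN] := cf _ e20; have [M hM] := cg _ e20.
exists (maxn N M) => n; rewrite geq_max => /andP[Nn Mn].
have := @prob_dist_triangle (fun w => f_ n w + g_ n w) (fun w => f w + g_ n w) (fun w => f w + g w) (e/2) (e/2).
rewrite -splitr => /(_ (measurable_funD (mf_ n) (mg_ n)) (measurable_funD mf (mg_ n)) (measurable_funD mf mg)) h.
apply: (le_trans h); rewrite [in leRHS](splitr e) EFinD; apply: leeD.
- apply: le_trans (hN n Nn); rewrite le_eqVlt; apply/orP; left; apply/eqP; congr (P _).
  by apply/funext => w; rewrite /= (_ : f_ n w + g_ n w - _ = f_ n w - f w)//; ring.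
- apply: le_trans (hM n Mn); rewrite le_eqVlt; apply/orP; left; apply/eqP; congr (P _).
  by apply/funext => w; rewrite /= (_ : f w + g_ n w - _ = g_ n w - g w)//; ring.
Qed.

Lemma cvg_prob_cst f : cvg_prob P (fun=> f) f.
Proof.
move=> e e0; exists 0%N => n _; rewrite (_ : [set w | _] = set0) ?measure0 ?lee_fin ?(ltW e0)//.
by apply/seteqP; split=> w //=; rewrite subrr normr0 ltNge (ltW e0).
Qed.

Lemma cvg_prob_sum (I : Type) (l : seq I) (f_ : I -> nat -> T -> R) (f : I -> T -> R) :
  (forall i n, measurable_fun setT (f_ i n)) -> (forall i, measurable_fun setT (f i)) ->
  (forall i, cvg_prob P (f_ i) (f i)) ->
  cvg_prob P (fun n w => \sum_(i <- l) f_ i n w) (fun w => \sum_(i <- l) f i w).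
Proof.
move=> mf_ mf cf; elim: l => [|i l IH].
  rewrite (_ : (fun n w => _) = fun=> (fun w => \sum_(i <- [::]) f i w)); first exact: cvg_prob_cst.
  by apply/funext => n; apply/funext => w; rewrite !big_nil.
rewrite (_ : (fun n w => _) = (fun n w => f_ i n w + \sum_(j <- l) f_ j n w)); last first.
  by apply/funext => n; apply/funext => w; rewrite big_cons.
rewrite (_ : (fun w => \sum_(j <- i :: l) _) = (fun w => f i w + \sum_(j <- l) f j w)); last first.
  by apply/funext => w; rewrite big_cons.
by apply: cvg_probD => // n; apply: measurable_sum.
Qed.

(** Turns an iterated limit, fine grid inside coarse grid, into a limit along one sequence: for each
    [m] the inner index is chosen so that the error is at most [2^-m]. *)
Lemma cvg_prob_diag (f_ : nat -> nat -> T -> R) (g_ : nat -> T -> R) g :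
  (forall m n, measurable_fun setT (f_ m n)) -> (forall n, measurable_fun setT (g_ n)) ->
  measurable_fun setT g ->
  (forall m, cvg_prob P (f_ m) (g_ m)) -> cvg_prob P g_ g ->
  exists M : nat -> nat, cvg_prob P (fun m => f_ m (M m)) g.
Proof.
move=> mf_ mg_ mg cf cg.
pose e m : R := 1 / (2 ^ m)%:R.
have e0 m : 0 < e m by rewrite divr_gt0// ltr0n expn_gt0.
pose M m := xget 0%N [set N | (P [set w | (e m < `|f_ m N w - g_ m w|)%R] <= (e m)%:E)%E].
have hM m : (P [set w | (e m < `|f_ m (M m) w - g_ m w|)%R] <= (e m)%:E)%E.
  apply: (@xgetPex _ 0%N [set N | (P [set w | (e m < `|f_ m N w - g_ m w|)%R] <= (e m)%:E)%E]).
  by have [N hN] := cf m _ (e0 m); exists N; exact: hN.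
exists M => d d0; have d20 : 0 < d / 2 by rewrite divr_gt0.
have [N hN] := cg _ d20; have [K hK] := geometric_small 1 d20.
exists (maxn N K) => n; rewrite geq_max => /andP[Nn Kn].
have en : e n <= d / 2.
  apply: le_trans hK; rewrite /e !mul1r natrX -exprVn.
  by apply: ler_wiXn2l => //; rewrite ?invr_ge0// ?invf_le1// ?ler1n.
have := @prob_dist_triangle (f_ n (M n)) (g_ n) g (d/2) (d/2) (mf_ _ _) (mg_ _) mg.
rewrite -splitr => /le_trans; apply.
rewrite [in leRHS](splitr d) EFinD; apply: leeD; last exact: hN.
apply: (@le_trans _ _ (e n)%:E); last by rewrite lee_fin.
apply: le_trans (hM n); apply: le_measure; rewrite ?inE; [exact: measurable_gt_norm..|].
by move=> w /=; exact: le_lt_trans.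
Qed.

End ProbLimits.

(** * Dual paths and Riemann sums *)

Section Grids.
Context {R : realType}.

Definition ugrid (a b : R) (n k : nat) : R := a + k%:R * ((b - a) / n%:R).

Lemma ugrid0 (a b : R) n : ugrid a b n 0 = a.
Proof. by rewrite /ugrid mul0r addr0. Qed.

Lemma ugridn (a b : R) n : (0 < n)%N -> ugrid a b n n = b.
Proof. by move=> n0; rewrite /ugrid mulrC divfK ?pnatr_eq0 -?lt0n// addrC subrK. Qed.

Lemma ugridS (a b : R) n k : ugrid a b n k.+1 = ugrid a b n k + (b - a) / n%:R.
Proof. by rewrite /ugrid -natr1; ring. Qed.

Lemma ugrid_le (a b : R) n : a <= b -> {homo ugrid a b n : i j / (i <= j)%N >-> i <= j}.
Proof.
move=> ab i j ij; rewrite lerD2l ler_wpM2r ?ler_nat//.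
by rewrite divr_ge0 ?subr_ge0.
Qed.

Lemma ugrid_itv (a b : R) n k : a <= b -> (k <= n)%N -> (0 < n)%N -> a <= ugrid a b n k <= b.
Proof.
move=> ab kn n0; have h1 : ugrid a b n 0 <= ugrid a b n k by exact: ugrid_le.
have h2 : ugrid a b n k <= ugrid a b n n by exact: ugrid_le.
by rewrite ugrid0 in h1; rewrite ugridn// in h2; rewrite h1.
Qed.

Lemma ugrid_mul (a b : R) n k m : (0 < m)%N -> ugrid a b (n * m) (k * m) = ugrid a b n k.
Proof.
move=> m0; rewrite /ugrid; congr (_ + _); rewrite !natrM.
have m1 : m%:R != 0 :> R by rewrite pnatr_eq0 -lt0n.
by rewrite invfM -mulrA; congr (_ * _); rewrite mulrC -!mulrA mulVf// mulr1.
Qed.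

Lemma mesh_small (a b d : R) : 0 < d -> exists N, forall n, (N <= n)%N -> (b - a) / n.+1%:R < d.
Proof.
move=> d0; pose N := (Num.trunc (`|b - a| / d)).+1.
exists N => n Nn; rewrite ltr_pdivrMr ?ltr0n// mulrC -ltr_pdivrMr//.
apply: le_lt_trans (_ : `|b - a| / d < _).
  by rewrite ler_pM2r ?invr_gt0// ler_norm.
by apply: lt_le_trans (truncnS_gt _) _; rewrite ler_nat (leq_trans Nn).
Qed.

Lemma cell_dist (c u t v h d : R) : c <= u -> u < t -> t < v -> v <= c + h -> h < d ->
  `|c - t| < d.
Proof. by move=> cu ut tv vh hd; rewrite ltr_norml; apply/andP; split; lra. Qed.

Lemma cell_dist_end (c t h : R) : c < t -> t < c + h -> `|t - (c + h)| < h.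
Proof. by move=> cu ut; rewrite ltr_norml; apply/andP; split; lra. Qed.

(** The mean value inequality cell by cell; [G k] may change with the cell, which allows
    coefficients frozen at grid points. *)
Lemma sum_increments_le (n : nat) (tau : nat -> R) (G dG : nat -> R -> R) (e : R) :
  (forall k, (k < n)%N -> tau k <= tau k.+1) ->
  (forall k, (k < n)%N -> {within `[tau k, tau k.+1], continuous (G k)}) ->
  (forall k x, (k < n)%N -> tau k < x < tau k.+1 -> is_derive x 1 (G k) (dG k x)) ->
  (forall k x, (k < n)%N -> tau k < x < tau k.+1 -> `|dG k x| <= e) ->
  `|\sum_(k < n) (G k (tau k.+1) - G k (tau k))| <= e * (tau n - tau 0%N).
Proof.
elim: n => [|n IH] tm cG hG he; first by rewrite big_ord0 subrr mulr0 normr0.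
rewrite big_ord_recr/= (le_trans (ler_normD _ _))//.
have := @derive_norm_le R (tau n) (tau n.+1) e (G n) (dG n) (tm n (leqnn _))
  (fun x => hG n x (leqnn _)) (cG n (leqnn _)) (fun x => he n x (leqnn _)).
have := IH (fun k kn => tm k (leqW kn)) (fun k kn => cG k (leqW kn))
  (fun k x kn => hG k x (leqW kn)) (fun k x kn => he k x (leqW kn)).
rewrite !mulrBr; lra.
Qed.

Lemma norm_bilinear_le n (u v : 'cV[R]_n) (M : 'M[R]_n) (a b c : R) :
  (forall i, `|u i ord0| <= a) -> (forall i j, `|M i j| <= b) -> (forall i, `|v i ord0| <= c) ->
  `|(u^T *m (M *m v)) ord0 ord0| <= n%:R * a * (n%:R * b * c).
Proof.
move=> ua Mb vc; apply: norm_mulmx_le; first by move=> i j; rewrite ord1 mxE.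
by move=> i; apply: norm_mulmx_le.
Qed.

Lemma within_subinterval (a b c d : R) (f : R -> R) : a <= c -> d <= b ->
  {within `[a, b], continuous f} -> {within `[c, d], continuous f}.
Proof.
move=> ac db; apply: continuous_subspaceW => x /=; rewrite !in_itv/= => /andP[h1 h2].
by rewrite (le_trans ac h1) (le_trans h2 db).
Qed.

Lemma bilinear_dist n (M M' : 'M[R]_n) (p q : 'cV[R]_n) :
  quadform M p - quadform M' q =
  (p^T *m ((M - M') *m p)) ord0 ord0 + ((p - q)^T *m (M' *m p)) ord0 ord0
  + (q^T *m (M' *m (p - q))) ord0 ord0.
Proof.
rewrite !quadformE -!mx11D -mx11N -mx11D; congr (_ _ _).
rewrite mulmxBl mulmxBr linearB/= mulmxBl !mulmxBr.
by rewrite !subrKA.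
Qed.

(** The times of [q] and [M] vary independently because the dual path is frozen on the coarse grid
    and the matrix on the fine one. *)
Lemma quadform_uniform n (a b : R) (M : R -> 'M[R]_n) (q : R -> 'cV[R]_n) :
  mxcont a b M -> mxcont a b q -> forall e : R, 0 < e -> exists2 d : R, 0 < d &
  forall s u t, a <= s <= b -> a <= u <= b -> a <= t <= b -> `|s - t| < d -> `|u - t| < d ->
  `|quadform (M u) (q s) - quadform (M t) (q t)| <= e.
Proof.
move=> cM cq e e0.
have [kM kM0 hM] := mxcont_bounded cM; have [kq kq0 hq] := mxcont_bounded cq.
pose c := n%:R * kq * (n%:R * kq) + n%:R * (n%:R * kM * kq) + n%:R * kq * (n%:R * kM).
have c0 : 0 <= c by rewrite /c !addr_ge0 ?mulr_ge0 ?(ltW kq0) ?(ltW kM0).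
have e10 : 0 < e / (c + 1) by rewrite divr_gt0// ltr_wpDl.
have [d1 d10 h1] := mxcont_uniform cM e10; have [d2 d20 h2] := mxcont_uniform cq e10.
exists (Num.min d1 d2); first by rewrite lt_min d10.
move=> s u t sab uab tab; rewrite !lt_min => /andP[_ st] /andP[ut _].
rewrite bilinear_dist; set e1 := e / (c + 1) in h1 h2 e10.
have b1 : `|((q s)^T *m ((M u - M t) *m q s)) ord0 ord0| <= n%:R * kq * (n%:R * e1 * kq).
  apply: norm_bilinear_le => [i|i j|i]; [exact: hq| |exact: hq].
  by rewrite !mxE; exact: h1.
have b2 : `|((q s - q t)^T *m (M t *m q s)) ord0 ord0| <= n%:R * e1 * (n%:R * kM * kq).
  apply: norm_bilinear_le => [i|i j|i]; [|exact: hM|exact: hq].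
  by rewrite !mxE; exact: h2.
have b3 : `|((q t)^T *m (M t *m (q s - q t))) ord0 ord0| <= n%:R * kq * (n%:R * kM * e1).
  apply: norm_bilinear_le => [i|i j|i]; [exact: hq|exact: hM|].
  by rewrite !mxE; exact: h2.
have ec : c * e1 <= e.
  by rewrite /e1 mulrA ler_pdivrMr ?ltr_wpDl// mulrC ler_pM2l// lerDl.
apply: le_trans (ler_normD _ _) _; apply: le_trans (lerD (ler_normD _ _) b3) _.
apply: le_trans (lerD (lerD b1 b2) (lexx _)) _; apply: le_trans ec.
by rewrite le_eqVlt; apply/orP; left; apply/eqP; rewrite /c; ring.
Qed.

(* N need not have bounded variation: only the smooth path z - N is differentiated. *)
Lemma duality_sum n (a b : R) (F : R -> 'M[R]_n) (q z N : R -> 'cV[R]_n) : a < b ->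
  mxcont a b F -> mxcont a b z -> mxcont a b q ->
  (forall t, a < t < b -> mxder q t (- ((F t)^T *m q t))) ->
  (forall t, a <= t <= b -> z t = z a + mxint a t (fun u => F u *m z u) + (N t - N a)) ->
  (fun m => \sum_(k < m.+1) ((q (ugrid a b m.+1 k))^T *m
     (N (ugrid a b m.+1 k.+1) - N (ugrid a b m.+1 k))) ord0 ord0) @ \oo -->
  ((q b)^T *m z b) ord0 ord0 - ((q a)^T *m z a) ord0 ord0.
Proof.
move=> ab cF cz cq dq hz.
have [kF kF0 hF] := mxcont_bounded cF; have [kz kz0 hkz] := mxcont_bounded cz.
have [kq kq0 hkq] := mxcont_bounded cq.
apply/cvgrPdist_le => e e0.
pose c := n%:R * (n%:R * kF * kz) + n%:R * kq * (n%:R * kF).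
have c0 : 0 <= c by rewrite /c addr_ge0 ?mulr_ge0 ?(ltW kq0) ?(ltW kz0) ?(ltW kF0).
pose e1 := e / ((c + 1) * (b - a)).
have ba0 : 0 < b - a by rewrite subr_gt0.
have c1 : 0 < c + 1 by rewrite ltr_wpDl.
have e10 : 0 < e1 by rewrite divr_gt0// mulr_gt0.
have [d1 d10 h1] := mxcont_uniform cz e10; have [d2 d20 h2] := mxcont_uniform cq e10.
have d0 : 0 < Num.min d1 d2 by rewrite lt_min d10.
have [N0 hN0] := mesh_small a b d0.
exists N0 => // m /= Nm; have {hN0} := hN0 m Nm.
rewrite lt_min => /andP[md1 md2].
pose g k := ugrid a b m.+1 k.
have gab k : (k <= m.+1)%N -> a <= g k <= b by move=> km; apply: ugrid_itv => //; exact: ltW.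
have gS k : g k.+1 = g k + (b - a) / m.+1%:R by exact: ugridS.
have h0 : 0 < (b - a) / m.+1%:R by rewrite divr_gt0.
pose I t := mxint a t (fun u => F u *m z u).
have [cI dI] := mxint_antiderivative ab (mxcontM cF cz).
(* The increment of [G k] over its cell is that of [q^T z] minus [q(g_k)^T] times the increment of
   [N]. Freezing [q] at the left end and [z] at the right end makes its derivative a sum of two
   differences, small by uniform continuity. *)
pose G k t := ((q t)^T *m z (g k.+1) + (q (g k))^T *m I t) ord0 ord0.
pose dG k t := ((- ((F t)^T *m q t))^T *m z (g k.+1) + (q (g k))^T *m (F t *m z t)) ord0 ord0.
have gm : (forall k, (k < m.+1)%N -> g k <= g k.+1) by move=> k _; rewrite gS lerDl ltW.
have inab k t : (k < m.+1)%N -> g k < t < g k.+1 -> a < t < b.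
  move=> km /andP[t1 t2]; have /andP[+ _] := gab k (ltnW km); have /andP[_ +] := gab k.+1 km.
  by move=> h3 h4; rewrite (le_lt_trans h4 t1) (lt_le_trans t2 h3).
have cG k : (k < m.+1)%N -> {within `[g k, g k.+1], continuous (G k)}.
  move=> km; apply: (@within_subinterval a b).
  - by have /andP[] := gab k (ltnW km).
  - by have /andP[] := gab k.+1 km.
  have c1' : mxcont a b (fun=> z (g k.+1)) by exact: mxcont_cst.
  have c2' : mxcont a b (fun=> (q (g k))^T) by exact: mxcont_cst.
  exact: (mxcontD (mxcontM (mxcontT cq) c1') (mxcontM c2' cI)) ord0 ord0.
have dGd k t : (k < m.+1)%N -> g k < t < g k.+1 -> is_derive t 1 (G k) (dG k t).
  move=> km tk; have tab := inab k t km tk.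
  have := mxderD (mxderM (mxderT (dq t tab)) (mxder_cst (z (g k.+1)) t))
     (mxderM (mxder_cst (q (g k))^T t) (dI t tab)).
  move=> /(_ ord0 ord0); apply: is_derive_congr => //.
  by rewrite /dG mulmx0 mul0mx addr0 add0r.
have dGb k t : (k < m.+1)%N -> g k < t < g k.+1 -> `|dG k t| <= c * e1.
  move=> km tk; have tab := inab k t km tk.
  have -> : dG k t = ((q t - q (g k))^T *m (F t *m - z (g k.+1))) ord0 ord0
     + ((q (g k))^T *m (F t *m (z t - z (g k.+1)))) ord0 ord0.
    rewrite /dG -mx11D; congr (_ _ _).
    rewrite trmxN trmx_mul trmxK mulNmx mulmxN (trmxD (q t)) trmxN mulmxN mulmxDl mulNmx !mulmxBr !mulmxA.
    set x1 := _ *m F t *m z (g _); set x2 := _ *m F t *m z t; set x3 := (q (g k))^T *m F t *m z (g _).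
    by rewrite opprD opprK addrC -addrA (addrC x3) subrK addrC.
  have tab' : a <= t <= b by case/andP : tab => t1 t2; rewrite !ltW.
  have /andP[tk1 tk2] := tk.
  have dist1 : `|t - g k| < (b - a) / m.+1%:R.
    by rewrite ger0_norm ?subr_ge0 ?ltW// ltrBlDl -gS.
  have dist2 : `|t - g k.+1| < (b - a) / m.+1%:R.
    by rewrite gS; apply: cell_dist_end; rewrite -?gS.
  have b1 : `|((q t - q (g k))^T *m (F t *m - z (g k.+1))) ord0 ord0| <= n%:R * e1 * (n%:R * kF * kz).
    apply: norm_bilinear_le => [i|i j|i].
    - by rewrite !mxE; apply: h2 => //; [exact: gab (ltnW km)|exact: lt_trans md2].
    - exact: hF.
    - by rewrite mxE normrN; apply: hkz; exact: gab.
  have b2 : `|((q (g k))^T *m (F t *m (z t - z (g k.+1)))) ord0 ord0| <= n%:R * kq * (n%:R * kF * e1).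
    apply: norm_bilinear_le => [i|i j|i].
    - by apply: hkq; exact: gab (ltnW km).
    - exact: hF.
    - by rewrite !mxE; apply: h1 => //; [exact: gab|exact: lt_trans md1].
  apply: le_trans (ler_normD _ _) _; apply: le_trans (lerD b1 b2) _.
  by rewrite le_eqVlt; apply/orP; left; apply/eqP; rewrite /c; ring.
have := @sum_increments_le m.+1 g G dG (c * e1) gm cG dGd dGb.
have -> : g m.+1 = b by exact: ugridn.
have -> : g 0%N = a by exact: ugrid0.
move=> hsum.
have -> : ((q b)^T *m z b) ord0 ord0 - ((q a)^T *m z a) ord0 ord0 -
   \sum_(k < m.+1) ((q (ugrid a b m.+1 k))^T *m (N (ugrid a b m.+1 k.+1) - N (ugrid a b m.+1 k))) ord0 ord0
   = \sum_(k < m.+1) (G k (g k.+1) - G k (g k)).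
  have <- : \sum_(k < m.+1) (((q (g k.+1))^T *m z (g k.+1)) ord0 ord0 - ((q (g k))^T *m z (g k)) ord0 ord0)
     = ((q b)^T *m z b) ord0 ord0 - ((q a)^T *m z a) ord0 ord0.
    rewrite -(big_mkord xpredT (fun k => ((q (g k.+1))^T *m z (g k.+1)) ord0 ord0 - ((q (g k))^T *m z (g k)) ord0 ord0)).
    rewrite telescope_sumr//; congr (((q _)^T *m z _) ord0 ord0 - ((q _)^T *m z _) ord0 ord0).
    + exact: ugridn.
    + exact: ugridn.
    + exact: ugrid0.
    + exact: ugrid0.
  rewrite -sumrB; apply: eq_bigr => k _.
  have -> : N (ugrid a b m.+1 k.+1) - N (ugrid a b m.+1 k) = (z (g k.+1) - z (g k)) - (I (g k.+1) - I (g k)).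
    rewrite (hz _ (gab k.+1 (ltn_ord k))) (hz _ (gab k (ltnW (ltn_ord k)))) -/(I _) -/(I _).
    by rewrite /g; apply/matrixP => i j; rewrite !mxE; ring.
  change (ugrid a b m.+1 k) with (g k).
  by rewrite /G !(mulmxBr, mx11D, mx11N); ring.
apply: (le_trans hsum); rewrite /e1.
rewrite [leLHS](_ : _ = e * (c / (c + 1))).
  by rewrite ger_pMr// ler_pdivrMr// mul1r lerDl.
by field; rewrite !gt_eqF.
Qed.

(** [j %/ (M m).+1] is the coarse cell containing the fine cell [j]. The error is controlled by the
    coarse mesh alone, so [M] may be arbitrary; in the application it is the choice made by
    [cvg_prob_diag]. *)
Lemma variance_sum (a b : R) (V : R -> R) (f : R -> R -> R) (M : nat -> nat) : a < b ->
  {within `[a, b], continuous V} ->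
  (forall t : R, a < t < b -> is_derive t 1 V (f t t)) ->
  (forall e : R, 0 < e -> exists2 d : R, 0 < d &
    forall s u t, a <= s <= b -> a <= u <= b -> a <= t <= b -> `|s - t| < d -> `|u - t| < d ->
    `|f s u - f t t| <= e) ->
  (fun m => \sum_(j < m.+1 * (M m).+1)
     f (ugrid a b m.+1 (j %/ (M m).+1)) (ugrid a b (m.+1 * (M m).+1) j) *
     (ugrid a b (m.+1 * (M m).+1) j.+1 - ugrid a b (m.+1 * (M m).+1) j)) @ \oo --> V b - V a.
Proof.
move=> ab cV dV uf; apply/cvgrPdist_le => e e0.
have ba0 : 0 < b - a by rewrite subr_gt0.
have e10 : 0 < e / (b - a) by rewrite divr_gt0.
have [d d0 hd] := uf _ e10; have [N0 hN0] := mesh_small a b d0.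
exists N0 => // m /= Nm; have {hN0} md := hN0 m Nm.
pose n := (m.+1 * (M m).+1)%N; pose g k := ugrid a b n k.
pose cg k := ugrid a b m.+1 (k %/ (M m).+1).
have n0 : (0 < n)%N by rewrite muln_gt0.
have gab k : (k <= n)%N -> a <= g k <= b by move=> km; apply: ugrid_itv => //; exact: ltW.
have gS k : g k.+1 = g k + (b - a) / n%:R by exact: ugridS.
have h0 : 0 < (b - a) / n%:R by rewrite divr_gt0// ltr0n.
pose G k t := V t - f (cg k) (g k) * t.
pose dG k t := f t t - f (cg k) (g k).
have gm : (forall k, (k < n)%N -> g k <= g k.+1) by move=> k _; rewrite gS lerDl ltW.
have inab k t : (k < n)%N -> g k < t < g k.+1 -> a < t < b.
  move=> km /andP[t1 t2]; have /andP[+ _] := gab k (ltnW km); have /andP[_ +] := gab k.+1 km.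
  by move=> h3 h4; rewrite (le_lt_trans h4 t1) (lt_le_trans t2 h3).
have cG k : (k < n)%N -> {within `[g k, g k.+1], continuous (G k)}.
  move=> km; apply: (@within_subinterval a b).
  - by have /andP[] := gab k (ltnW km).
  - by have /andP[] := gab k.+1 km.
  move=> x; apply: cvgB; first exact: cV.
  apply: cvgMl_tmp; have : {within `[a, b], continuous (fun t : R => t)} by apply: continuous_subspaceT => y; exact: cvg_id.
  exact.
have dGd k t : (k < n)%N -> g k < t < g k.+1 -> is_derive t 1 (G k) (dG k t).
  move=> km tk; have tab := inab k t km tk.
  have d1 := dV t tab; rewrite /G /dG.
  have d2 : is_derive t 1 (fun t : R => f (cg k) (g k) * t) (f (cg k) (g k)).
    by apply: is_derive_eq; rewrite /GRing.scale/= mulr1.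
  exact: (is_deriveB d1 d2).
have cgE k t : (k < n)%N -> g k < t < g k.+1 -> a <= cg k <= b /\ `|cg k - t| < d.
  move=> km /andP[t1 t2]; split.
    by apply: ugrid_itv => //; [exact: ltW|rewrite ltnW// ltn_divLR].
  have e1 : cg k = ugrid a b n (k %/ (M m).+1 * (M m).+1) by rewrite /cg /n ugrid_mul.
  have e2 : ugrid a b m.+1 (k %/ (M m).+1).+1 = ugrid a b n ((k %/ (M m).+1).+1 * (M m).+1).
    by rewrite /n ugrid_mul.
  have le1 : cg k <= g k by rewrite e1; apply: ugrid_le; [exact: ltW|exact: leq_divM].
  have le2 : g k.+1 <= cg k + (b - a) / m.+1%:R.
    rewrite /cg -ugridS e2; apply: ugrid_le; first exact: ltW.
    by rewrite ltn_ceil.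
  exact: (cell_dist le1 t1 t2 le2 md).
have dGb k t : (k < n)%N -> g k < t < g k.+1 -> `|dG k t| <= e / (b - a).
  move=> km tk; have tab := inab k t km tk.
  have [c1 c2] := cgE k t km tk.
  rewrite /dG distrC; apply: hd => //.
  - exact: gab (ltnW km).
  - by case/andP : tab => *; rewrite !ltW.
  - case/andP : tk => t1 t2; rewrite ltr0_norm ?subr_lt0// opprB.
    have : (b - a) / n%:R <= (b - a) / m.+1%:R.
      by rewrite ler_pM2l// lef_pV2 ?posrE ?ltr0n// ler_nat /n leq_pmulr.
    by move=> h1; rewrite ltrBlDr (lt_trans t2)// gS addrC ltrD2r (le_lt_trans h1).
have := @sum_increments_le n g G dG (e / (b - a)) gm cG dGd dGb.
have -> : g n = b by exact: ugridn.
have -> : g 0%N = a by exact: ugrid0.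
rewrite divfK ?gt_eqF// => hs.
rewrite [X in `|X|](_ : _ = \sum_(k < n) (G k (g k.+1) - G k (g k)))//.
have <- : \sum_(k < n) (V (g k.+1) - V (g k)) = V b - V a.
  rewrite -(big_mkord xpredT (fun k => V (g k.+1) - V (g k))) telescope_sumr//.
  by rewrite /g ugridn// ugrid0.
rewrite -sumrB; apply: eq_bigr => k _.
change (V (g k.+1) - V (g k) - f (cg k) (g k) * (g k.+1 - g k) =
  V (g k.+1) - f (cg k) (g k) * g k.+1 - (V (g k) - f (cg k) (g k) * g k)).
by move: (V (g k.+1)) (V (g k)) (f (cg k) (g k)) (g k.+1) (g k) => v1 v2 ff g1 g2; ring.
Qed.

Lemma sum_blocks (V : zmodType) (A m : nat) (h : nat -> nat -> V) : (0 < m)%N ->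
  \sum_(k < A) \sum_(k * m <= j < k.+1 * m) h k j = \sum_(j < A * m) h (j %/ m)%N j.
Proof.
move=> m0; rewrite -(big_mkord xpredT (fun j => h (j %/ m)%N j)).
elim: A => [|A IH]; first by rewrite big_ord0 mul0n big_geq.
rewrite big_ord_recr/= IH [RHS](@big_cat_nat _ _ _ (A * m)%N)//= ?leq_mul2r ?leqnSn ?orbT//.
congr (_ + _); rewrite big_nat [RHS]big_nat; apply: eq_bigr => j /andP[j1 j2].
congr (h _ _); apply/eqP; rewrite eqn_leq leq_divRL// j1 -ltnS ltn_divLR//.
Qed.

End Grids.

(** * Linear stochastic equations and Ito sums *)

Section RandomVectors.
Context {R : realType} {disp : measure_display} {T : measurableType disp}.

Lemma rvecP d (X : T -> 'cV[R]_d) :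
  rvec X <-> forall i, measurable_fun setT (fun w => X w i ord0).
Proof.
by split=> [mX i|mX]; [exact: measurable_fun_coord|exact: measurable_fun_bvec].
Qed.

Lemma rvec_cst d (x : 'cV[R]_d) : rvec (fun _ : T => x).
Proof. by apply/rvecP => i; exact: measurable_cst. Qed.

Lemma rvecD d (X Y : T -> 'cV[R]_d) : rvec X -> rvec Y -> rvec (fun w => X w + Y w).
Proof.
move=> /rvecP mX /rvecP mY; apply/rvecP => i.
by under eq_fun do rewrite mxE; exact: measurable_funD.
Qed.

Lemma rvecN d (X : T -> 'cV[R]_d) : rvec X -> rvec (fun w => - X w).
Proof.
move=> /rvecP mX; apply/rvecP => i.
by under eq_fun do rewrite mxE; exact: measurable_funN.
Qed.

Lemma rvecB d (X Y : T -> 'cV[R]_d) : rvec X -> rvec Y -> rvec (fun w => X w - Y w).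
Proof. by move=> mX mY; apply: rvecD => //; exact: rvecN. Qed.

Lemma rvec_mulmx m d (M : 'M[R]_(m, d)) (X : T -> 'cV[R]_d) : rvec X -> rvec (fun w => M *m X w).
Proof.
move=> /rvecP mX; apply/rvecP => i; apply: measurable_fun_mulmx => k j.
by rewrite ord1.
Qed.

Lemma rvec_sum d (I : Type) (s : seq I) (X : I -> T -> 'cV[R]_d) : (forall i, rvec (X i)) ->
  rvec (fun w => \sum_(i <- s) X i w).
Proof.
move=> mX; elim: s => [|i s IH].
  rewrite (_ : (fun _ => _) = (fun=> 0)); first exact: rvec_cst.
  by apply/funext => w; rewrite big_nil.
rewrite (_ : (fun _ => _) = (fun w => X i w + \sum_(i <- s) X i w)); first exact: rvecD.
by apply/funext => w; rewrite big_cons.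
Qed.

Lemma rvec_usubmx m n (X : T -> 'cV[R]_(m + n)) : rvec X -> rvec (fun w => usubmx (X w)).
Proof.
move=> /rvecP mX; apply/rvecP => i.
by under eq_fun do rewrite mxE; exact: mX.
Qed.

Lemma rvec_dsubmx m n (X : T -> 'cV[R]_(m + n)) : rvec X -> rvec (fun w => dsubmx (X w)).
Proof.
move=> /rvecP mX; apply/rvecP => i.
by under eq_fun do rewrite mxE; exact: mX.
Qed.

Lemma rvec_dot d (X : T -> 'cV[R]_d) (u : 'cV[R]_d) : rvec X ->
  measurable_fun setT (fun w => (u^T *m X w) ord0 ord0).
Proof. by move=> mX; have /rvecP := rvec_mulmx u^T mX; exact. Qed.

Lemma rvec_norm2 d (X : T -> 'cV[R]_d) : rvec X -> measurable_fun setT (fun w => norm2 (X w)).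
Proof.
move=> /rvecP mX.
have cs : continuous (@Num.sqrt R) by exact: sqrt_continuous.
apply: (measurableT_comp (continuous_measurable_fun cs)).
by apply: measurable_sum => i; apply: measurable_funX; exact: mX.
Qed.

Lemma vadapted_rvec D d (X : T -> 'cV[R]_d) : sigma_algebra setT D ->
  vadapted D X <-> rvec (X : g_sigma_algebraType D -> 'cV[R]_d).
Proof.
move=> sD; split=> [/(sigma_vadaptedP _ sD) aX|mX'].
  by apply: measurable_fun_bvec => i; apply/sigma_adaptedP.
have mX i := measurable_fun_coord i mX'.
by apply/sigma_vadaptedP => // i; apply/sigma_adaptedP.
Qed.

End RandomVectors.

Section Grids.
Context {R : realType} {disp : measure_display} {T : measurableType disp}.
Variable P : probability T R.

Lemma riemann_sum_grid p q (K : R -> 'M[R]_(p, q)) (M : R -> T -> 'cV[R]_q) (a : R)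
    (g : nat -> R) n w : g 0%N = a ->
  riemann_sum K M a (mkseq (fun k => g k.+1) n) w =
  \sum_(0 <= k < n) K (g k) *m (M (g k.+1) w - M (g k) w).
Proof.
move=> g0; rewrite /riemann_sum; set l := mkseq _ _.
rewrite -(big_mkord xpredT (fun k => K (nth a (a :: l) k) *m (M (nth a l k) w - M (nth a (a :: l) k) w))).
rewrite size_mkseq big_nat [RHS]big_nat; apply: eq_bigr => k /= kn.
rewrite nth_mkseq//; case: k kn => [|k] kn /=; first by rewrite g0.
by rewrite nth_mkseq// ltnW.
Qed.

Lemma itv_partition_grid (a b : R) (g : nat -> R) n : g 0%N = a -> g n = b ->
  (forall k, g k < g k.+1) -> itv_partition a b (mkseq (fun k => g k.+1) n).
Proof.
move=> g0 gn gm; split.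
  apply/(pathP a) => k; rewrite size_mkseq => kn; rewrite nth_mkseq//.
  case: k kn => [|k] kn /=; first by rewrite -g0.
  by rewrite nth_mkseq// ltnW.
case: n gn => [<-|n gn]; first by rewrite /= g0.
by rewrite (last_nth a) size_mkseq /= -[X in nth _ X _]/(mkseq (fun k => g k.+1) n.+1) nth_mkseq// gn.
Qed.

Lemma mesh_lt_grid (a d : R) (g : nat -> R) n : g 0%N = a ->
  (forall k, g k.+1 - g k < d) -> mesh_lt a (mkseq (fun k => g k.+1) n) d.
Proof.
move=> g0 gm k; rewrite size_mkseq => kn; rewrite nth_mkseq//.
case: k kn => [|k] kn /=; first by rewrite -g0.
by rewrite nth_mkseq// ltnW.
Qed.

(** The partition of [[a, ugrid a b A i]] is taken inside a refinement of the grid of the whole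
    [[a, b]], so that sums for different endpoints share their cells and can be subtracted. *)
Lemma ito_grid p q (K : R -> 'M[R]_(p, q)) (M : R -> T -> 'cV[R]_q) (a b : R) A i J (v : 'cV[R]_p) :
  a < b -> (0 < A)%N -> (i <= A)%N -> (forall t, a <= t -> rvec (M t)) ->
  ito_integral P K M a (ugrid a b A i) J ->
  cvg_prob P (fun m w => (v^T *m \sum_(0 <= j < i * m.+1) K (ugrid a b (A * m.+1) j) *m
      (M (ugrid a b (A * m.+1) j.+1) w - M (ugrid a b (A * m.+1) j) w)) ord0 ord0)
    (fun w => (v^T *m J w) ord0 ord0).
Proof.
move=> ab A0 iA mM [mJ hJ] e e0.
pose c := norm2 v + 1; have c0 : 0 < c by rewrite ltr_wpDl// norm2_ge0.
(* The first bound serves the probability, the second the deviation, which Cauchy-Schwarz multiplies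
   by [norm2 v < c]. *)
pose e1 := Num.min e (e / c).
have e10 : 0 < e1 by rewrite lt_min e0 divr_gt0.
have [d d0 hd] := hJ _ e10; have [N hN] := mesh_small a b d0.
exists N => m Nm.
pose n := (A * m.+1)%N; pose g k := ugrid a b n k.
have n0 : (0 < n)%N by rewrite muln_gt0 A0.
have g0 : g 0%N = a by exact: ugrid0.
have gS k : g k.+1 = g k + (b - a) / n%:R by exact: ugridS.
have h0 : 0 < (b - a) / n%:R by rewrite divr_gt0 ?subr_gt0// ltr0n.
have hnd : (b - a) / n%:R < d.
  apply: le_lt_trans (hN m Nm); rewrite ler_pM2l ?subr_gt0//.
  by rewrite lef_pV2 ?posrE ?ltr0n// ler_nat /n leq_pmull.
have ga k : a <= g k by rewrite -g0; apply: ugrid_le; [exact: ltW|].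
have mS : rvec (fun w => \sum_(0 <= j < i * m.+1) K (g j) *m (M (g j.+1) w - M (g j) w)).
  apply: rvec_sum => j; apply: rvec_mulmx; apply: rvecB; apply: mM; exact: ga.
have part : itv_partition a (ugrid a b A i) (mkseq (fun k => g k.+1) (i * m.+1)).
  apply: itv_partition_grid => //; first by rewrite /g /n ugrid_mul.
  by move=> k; rewrite gS ltrDl.
have mesh : mesh_lt a (mkseq (fun k => g k.+1) (i * m.+1)) d.
  by apply: mesh_lt_grid => // k; rewrite gS addrC addKr.
have le := hd _ part mesh; apply: (@le_trans _ _ e1%:E); last by rewrite lee_fin ge_min lexx.
apply: le_trans le.
rewrite (_ : [set w | (e1 < norm2 _)%R] = [set w | (e1 < norm2 (\sum_(0 <= j < i * m.+1) K (g j) *m (M (g j.+1) w - M (g j) w) - J w))%R]); last first.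
  by apply/funext => w; rewrite /= riemann_sum_grid.
apply: le_measure; rewrite ?inE.
- apply: measurable_gt_norm; first exact: (rvec_dot v mS).
  exact: rvec_dot.
- rewrite (_ : [set w | _] = (fun w => norm2 (\sum_(0 <= j < i * m.+1) K (g j) *m (M (g j.+1) w - M (g j) w) - J w)) @^-1` `]e1, +oo[%classic).
    rewrite -[X in measurable X]setTI; have mm := rvec_norm2 (rvecB mS mJ).
    exact: mm.
  by apply/seteqP; split=> w /=; rewrite in_itv/= andbT.
move=> w /=; rewrite -mx11N -mx11D -mulmxBr => /lt_le_trans/(_ (cauchy_schwarz_dot _ _)) h.
apply: (@le_lt_trans _ _ (e / c)); first by rewrite ge_min lexx orbT.
rewrite ltr_pdivrMr//; apply: (lt_le_trans h).
by rewrite mulrC ler_wpM2l ?norm2_ge0// lerDl.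
Qed.

Lemma continuous_proc_rvec d (s t : R) (X : R -> T -> 'cV[R]_d) : s <= t ->
  continuous_proc P s X -> rvec (X t).
Proof. by move=> st [mX _]; exact: mX. Qed.

Lemma continuous_proc_mxcont d (s t : R) (X : R -> T -> 'cV[R]_d) :
  continuous_proc P s X -> {ae P, forall w, mxcont s t (fun u => X u w)}.
Proof.
move=> [_ cX]; apply: filterS cX => w cw; apply: mxcont_within.
apply: continuous_subspaceW cw => x /=; rewrite !in_itv/= andbT; by case/andP.
Qed.

Definition linear_path n (F : R -> 'M[R]_n) (z N : R -> T -> 'cV[R]_n) (s t : R) : Prop :=
  {ae P, forall w, forall u, s <= u <= t ->
    z u w = z s w + mxint s u (fun u => F u *m z u w) + (N u w - N s w)}.

Lemma linear_path_sum n (F : R -> 'M[R]_n) (z N : R -> T -> 'cV[R]_n) (s t : R) (v : 'cV[R]_n) :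
  s < t -> mxcont s t F -> {ae P, forall w, mxcont s t (fun u => z u w)} ->
  linear_path F z N s t ->
  exists q : R -> 'cV[R]_n, [/\ mxcont s t q, q t = v,
    forall u, s < u < t -> mxder q u (- ((F u)^T *m q u)) &
    {ae P, forall w, (fun m => \sum_(k < m.+1) ((q (ugrid s t m.+1 k))^T *m
        (N (ugrid s t m.+1 k.+1) w - N (ugrid s t m.+1 k) w)) ord0 ord0) @ \oo -->
      (v^T *m z t w) ord0 ord0 - ((q s)^T *m z s w) ord0 ord0}].
Proof.
move=> st cF cz hz.
have [q [cq qt dq]] := linear_ode_backward v st (mxcontN (mxcontT cF)).
have dq' u : s < u < t -> mxder q u (- ((F u)^T *m q u)).
  by move=> /dq; rewrite mulNmx.
exists q; split => //; apply: filterS2 cz hz => w czw hzw.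
have := @duality_sum R n s t F q (fun u => z u w) (fun u => N u w) st cF czw cq dq' hzw.
by rewrite qt.
Qed.

(** By duality each coordinate of [z t] is, up to a linear term in [z s], an almost sure limit of
    linear combinations of finitely many values of [N]. This serves both the signal-observation pair
    and the filter. *)
Lemma linear_path_adapted D n (F : R -> 'M[R]_n) (z N : R -> T -> 'cV[R]_n) (s t : R) :
  s <= t -> sigma_algebra setT D -> mxcont s t F -> rvec (z t) ->
  {ae P, forall w, mxcont s t (fun u => z u w)} ->
  linear_path F z N s t -> vadapted (completion P D) (z s) ->
  (forall u, s <= u <= t -> vadapted (completion P D) (N u)) ->
  vadapted (completion P D) (z t).
Proof.
rewrite le_eqVlt => /predU1P[<-//|st] sD cF mzt cz hz az aN.
have sC := completion_sigma_algebra P sD.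
apply/sigma_vadaptedP => // i; pose v : 'cV[R]_n := delta_mx i ord0.
have [q [cq qt dq hq]] := linear_path_sum v st cF cz hz.
have mz : measurable_fun setT (fun w => (v^T *m z t w) ord0 ord0 - ((q s)^T *m z s w) ord0 ord0).
  apply: measurable_funB; apply: rvec_dot => //.
  by move=> _ U mU; rewrite setTI; apply: (@completion_measurable _ _ _ P D); exact: az.
have a1 : adapted (completion P D) (fun w => (v^T *m z t w) ord0 ord0 - ((q s)^T *m z s w) ord0 ord0).
  apply: adapted_cvg_ae mz hq => // m.
  apply/sigma_adaptedP => //; apply: measurable_sum => k; apply: rvec_dot.
  have gk j : (j <= m.+1)%N -> s <= ugrid s t m.+1 j <= t by move=> jm; apply: ugrid_itv => //; exact: ltW.
  apply: rvecB; apply/vadapted_rvec => //; apply: aN; apply: gk; first exact: ltn_ord.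
  exact: ltnW.
have a2 := vadapted_dot (q s) sC az.
have : adapted (completion P D) (fun w => ((v^T *m z t w) ord0 ord0 - ((q s)^T *m z s w) ord0 ord0) + ((q s)^T *m z s w) ord0 ord0).
  by apply/sigma_adaptedP => //; apply: measurable_funD; apply/sigma_adaptedP.
rewrite (_ : (fun w => _ + _) = (fun w => z t w i ord0))//.
by apply/funext => w; rewrite subrK trmx_delta -rowE mxE.
Qed.

Lemma vadapted_ae D n (X Y : T -> 'cV[R]_n) : vadapted (completion P D) X -> rvec Y ->
  {ae P, forall w, X w = Y w} -> vadapted (completion P D) Y.
Proof.
move=> aX mY XY U mU; apply: (completion_ae (aX U mU)).
  by rewrite -[X in measurable X]setTI; exact: mY.
by apply: filterS XY => w /= ->.
Qed.

Lemma ito_adapted D p q (K : R -> 'M[R]_(p, q)) (M : R -> T -> 'cV[R]_q) (a b : R) J : a < b ->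
  sigma_algebra setT D ->
  (forall t, a <= t <= b -> vadapted (completion P D) (M t)) ->
  (forall t, a <= t -> rvec (M t)) -> ito_integral P K M a b J ->
  vadapted (completion P D) J.
Proof.
move=> ab sD aM mM hJ; have sC := completion_sigma_algebra P sD.
have [mJ hJ'] := hJ.
apply/sigma_vadaptedP => // i; pose v : 'cV[R]_p := delta_mx i ord0.
rewrite (_ : (fun w => _) = (fun w => (v^T *m J w) ord0 ord0)); last first.
  by apply/funext => w; rewrite trmx_delta -rowE mxE.
have hJ1 : ito_integral P K M a (ugrid a b 1 1) J by rewrite ugridn.
apply: adapted_cvg_prob (ito_grid v ab (ltnSn 0) (leqnn 1) mM hJ1) => //; last exact: rvec_dot.
move=> m; apply/sigma_adaptedP => //; apply: rvec_dot.
have gk j : (j <= m.+1)%N -> a <= ugrid a b (1 * m.+1) j <= b.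
  by move=> jm; apply: ugrid_itv; rewrite ?mul1n// ltW.
have -> : (fun w => \sum_(0 <= j < 1 * m.+1) K (ugrid a b (1 * m.+1) j) *m (M (ugrid a b (1 * m.+1) j.+1) w - M (ugrid a b (1 * m.+1) j) w))
  = (fun w => \sum_(j < m.+1) K (ugrid a b (1 * m.+1) j) *m (M (ugrid a b (1 * m.+1) j.+1) w - M (ugrid a b (1 * m.+1) j) w)).
  by apply/funext => w; rewrite big_mkord mul1n.
apply: rvec_sum => j; apply: rvec_mulmx; apply: rvecB; apply/vadapted_rvec => //; apply: aM; apply: gk => //.
exact: ltnW.
Qed.

End Grids.

(** * Law and measurability of the gap between two filters *)

Section FilterGap.
Context {R : realType} {disp : measure_display} {T : measurableType disp}.
Variable P : probability T R.
Context {d : nat}.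
Variable W : R -> T -> 'cV[R]_d.+1.
Hypothesis hW : brownian P W.
Context {n p : nat}.
Variable B : R -> T -> 'cV[R]_(n + p).
Hypothesis hB : brownian P B.

Lemma sigma_proc_sigma_algebra m (D : set R) (X : R -> T -> 'cV[R]_m) :
  sigma_algebra setT (sigma_proc D X).
Proof. exact: smallest_sigma_algebra. Qed.

Lemma sigma_proc_measurable m (D : set R) (X : R -> T -> 'cV[R]_m) :
  (forall u, D u -> rvec (X u)) -> sigma_proc D X `<=` measurable.
Proof.
move=> mX; apply: smallest_sub; first exact: sigma_algebra_measurable.
move=> _ [u Du [U mU ->]]; rewrite -[X in measurable X]setTI; exact: mX.
Qed.

Lemma sigma_proc_vadapted m (D : set R) (X : R -> T -> 'cV[R]_m) u : D u ->
  vadapted (sigma_proc D X) (X u).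
Proof. by move=> Du U mU; apply: sub_sigma_algebra; exists u => //; exists U. Qed.

Lemma dot_col_mx (u1 : 'cV[R]_n) (u2 : 'cV[R]_p) (b : 'cV[R]_(n + p)) :
  ((col_mx u1 u2)^T *m b) ord0 ord0 =
  (u1^T *m usubmx b) ord0 ord0 + (u2^T *m dsubmx b) ord0 ord0.
Proof. by rewrite -{1}(vsubmxK b) tr_col_mx mul_row_col mx11D. Qed.

Lemma sqr_norm2_col_mx (u1 : 'cV[R]_n) (u2 : 'cV[R]_p) :
  norm2 (col_mx u1 u2) ^+ 2 = norm2 u1 ^+ 2 + norm2 u2 ^+ 2.
Proof. by rewrite !sqr_norm2_dot tr_col_mx mul_row_col mx11D. Qed.

Lemma sqr_norm2_trmx_mul m k (M : 'M[R]_(m, k)) (v : 'cV[R]_m) :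
  norm2 (M^T *m v) ^+ 2 = quadform (M *m M^T) v.
Proof. by rewrite sqr_norm2_dot trmx_mul trmxK quadformE !mulmxA. Qed.

(* z is the difference of two filters with the same gain K: the observations M2
   cancel, and M1 - M2 is the independent observation noise. *)
Variables (s1 : 'M[R]_n) (s2 : 'M[R]_p) (K : R -> 'M[R]_(n, p)) (F : R -> 'M[R]_n).
Variables (M1 M2 : R -> T -> 'cV[R]_p) (J1 J2 z : R -> T -> 'cV[R]_n) (s t : R).
Hypotheses (s0 : 0 <= s) (st : s < t).
Hypotheses (cF : mxcont s t F) (cK : mxcont s t K).
Hypotheses (mM1 : forall u, s <= u -> rvec (M1 u)) (mM2 : forall u, s <= u -> rvec (M2 u)).
Hypothesis M12 : forall u w, M1 u w - M2 u w = - (s2 *m dsubmx (B u w)).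
Hypothesis iJ1 : forall u, s <= u -> ito_integral P K M1 s u (J1 u).
Hypothesis iJ2 : forall u, s <= u -> ito_integral P K M2 s u (J2 u).
Hypothesis mz : forall u, s <= u -> rvec (z u).
Hypothesis cz : {ae P, forall w, mxcont s t (fun u => z u w)}.

Let N u w := s1 *m usubmx (B u w) + J1 u w - J2 u w.
Hypothesis hz : linear_path P F z N s t.

Let mB u : 0 <= u -> rvec (B u).
Proof. by have [[+ _] _ _ _] := hB; exact. Qed.

(** The contribution of one grid cell to the Riemann sums of [N]; by [incE] it is linear in the
    increment of [B] alone. *)
Let inc A (j : nat) w : 'cV[R]_n :=
  s1 *m (usubmx (B (ugrid s t A j.+1) w) - usubmx (B (ugrid s t A j) w)) +
  K (ugrid s t A j) *m ((M1 (ugrid s t A j.+1) w - M1 (ugrid s t A j) w) -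
                        (M2 (ugrid s t A j.+1) w - M2 (ugrid s t A j) w)).

Let grid_ge A j : s <= ugrid s t A j.
Proof. by rewrite -[leLHS](ugrid0 s t A); apply: ugrid_le; [exact: ltW|]. Qed.

Let minc A j : rvec (inc A j).
Proof.
have g0 i : 0 <= ugrid s t A i by exact: le_trans s0 (grid_ge A i).
apply: rvecD; first by apply: rvec_mulmx; apply: rvecB; apply: rvec_usubmx; exact: mB.
by apply: rvec_mulmx; apply: rvecB; apply: rvecB; (apply: mM1 || apply: mM2).
Qed.

Let mN u : s <= u -> rvec (N u).
Proof.
move=> su; apply: rvecB; last by have [] := iJ2 su.
apply: rvecD; last by have [] := iJ1 su.
by apply: rvec_mulmx; apply: rvec_usubmx; apply: mB; exact: le_trans su.
Qed.

Let noise_limit A i (v : 'cV[R]_n) : (0 < A)%N -> (i <= A)%N ->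
  cvg_prob P (fun m w => (v^T *m \sum_(0 <= j < i * m.+1) inc (A * m.+1) j w) ord0 ord0)
   (fun w => (v^T *m (N (ugrid s t A i) w - s1 *m usubmx (B s w))) ord0 ord0).
Proof.
move=> A0 iA; have gs := grid_ge A i.
have h1 := ito_grid v st A0 iA mM1 (iJ1 gs).
have h2 := ito_grid (- v) st A0 iA mM2 (iJ2 gs).
have [mJ1 _] := iJ1 gs; have [mJ2 _] := iJ2 gs.
pose Z w := (v^T *m (s1 *m (usubmx (B (ugrid s t A i) w) - usubmx (B s w)))) ord0 ord0.
have mZ : measurable_fun setT Z.
  apply: rvec_dot; apply: rvec_mulmx; apply: rvecB; apply: rvec_usubmx; apply: mB => //.
  exact: le_trans gs.
have mS (M : R -> T -> 'cV[R]_p) k m : (forall u, s <= u -> rvec (M u)) -> rvec (fun w => \sum_(0 <= j < k) K (ugrid s t m j) *m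
      (M (ugrid s t m j.+1) w - M (ugrid s t m j) w)).
  by move=> mM; apply: rvec_sum => j; apply: rvec_mulmx; apply: rvecB; exact: mM.
have h3 := cvg_probD (fun m => rvec_dot v (mS _ _ _ mM1)) (fun m => rvec_dot (- v) (mS _ _ _ mM2))
  (rvec_dot v mJ1) (rvec_dot (- v) mJ2) h1 h2.
have h4 := cvg_probD (fun m => mZ) (fun m => measurable_funD (rvec_dot v (mS _ _ _ mM1)) (rvec_dot (- v) (mS _ _ _ mM2)))
  mZ (measurable_funD (rvec_dot v mJ1) (rvec_dot (- v) mJ2)) (cvg_prob_cst P Z) h3.
move: h4; congr (cvg_prob P _ _).
- apply/funext => m; apply/funext => w.
  rewrite /Z linearN/= mulNmx mx11N -mx11N -!mx11D -mulNmx; congr (_ _ _).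
  rewrite mulNmx -!mulmxBr -mulmxDr; congr (_ *m _).
  rewrite /inc big_split/=; congr (_ + _); last first.
    by rewrite -sumrB; apply: eq_bigr => j _; rewrite [RHS]mulmxBr.
  rewrite -mulmx_sumr; congr (_ *m _).
  rewrite (telescope_sumr (fun j => usubmx (B (ugrid s t (A * m.+1) j) w)))//.
  by rewrite ugrid_mul// ugrid0.
- apply/funext => w; rewrite /Z linearN/= mulNmx mx11N -mx11N -!mx11D -mulNmx; congr (_ _ _).
  rewrite mulNmx -!mulmxBr -mulmxDr; congr (_ *m _).
  by rewrite /N mulmxBr addrAC -!addrA; congr (_ + _); rewrite addrC -addrA.
Qed.

(** The weight of the fine increment [j] of [B], with [q] frozen on the coarse grid and [K] on the
    fine one. The two blocks belong to the signal noise and the observation noise; the minus sign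
    comes from [M12]. *)
Let coef (q : R -> 'cV[R]_n) m l j : 'cV[R]_(n + p) :=
  col_mx (s1^T *m q (ugrid s t m.+1 (j %/ l.+1)%N))
    (- (s2^T *m ((K (ugrid s t (m.+1 * l.+1) j))^T *m q (ugrid s t m.+1 (j %/ l.+1)%N)))).

Let approx (q : R -> 'cV[R]_n) m l w : R :=
  \sum_(k < m.+1) ((q (ugrid s t m.+1 k))^T *m
     \sum_(k * l.+1 <= j < k.+1 * l.+1) inc (m.+1 * l.+1) j w) ord0 ord0.

Let incE A j w : inc A j w =
  s1 *m usubmx (B (ugrid s t A j.+1) w - B (ugrid s t A j) w)
  - K (ugrid s t A j) *m (s2 *m dsubmx (B (ugrid s t A j.+1) w - B (ugrid s t A j) w)).
Proof.
rewrite /inc; set b := B _ w; set c := B _ w.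
have -> : usubmx (b - c) = usubmx b - usubmx c by apply/matrixP => i k; rewrite !mxE.
have -> : dsubmx (b - c) = dsubmx b - dsubmx c by apply/matrixP => i k; rewrite !mxE.
congr (_ + _); rewrite -mulmxN; congr (_ *m _).
transitivity ((M1 (ugrid s t A j.+1) w - M2 (ugrid s t A j.+1) w) -
  (M1 (ugrid s t A j) w - M2 (ugrid s t A j) w)).
  by rewrite !opprB addrACA [in RHS]addrACA; congr (_ + _); rewrite addrC.
by rewrite !M12 mulmxBr opprK opprB addrC.
Qed.

Let approxE q m l w : approx q m l w =
  \sum_(j < m.+1 * l.+1) ((coef q m l j)^T *m
    (B (ugrid s t (m.+1 * l.+1) j.+1) w - B (ugrid s t (m.+1 * l.+1) j) w)) ord0 ord0.
Proof.
rewrite /approx -(@sum_blocks R m.+1 l.+1 (fun k j => ((col_mx (s1^T *m q (ugrid s t m.+1 k))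
    (- (s2^T *m ((K (ugrid s t (m.+1 * l.+1) j))^T *m q (ugrid s t m.+1 k)))))^T *m
    (B (ugrid s t (m.+1 * l.+1) j.+1) w - B (ugrid s t (m.+1 * l.+1) j) w)) ord0 ord0))//.
apply: eq_bigr => k _; rewrite mulmx_sumr summxE; apply: eq_bigr => j _.
rewrite dot_col_mx -mx11D; congr (_ _ _).
rewrite incE mulmxDr trmx_mul trmxK trmxN !trmx_mul !trmxK.
by rewrite mulmxN mulNmx !mulmxA.
Qed.

Let gap_adapted D (f : T -> R) (f_ : nat -> T -> R) :
  sigma_algebra setT D -> D `<=` measurable ->
  (forall m, adapted D (f_ m)) -> measurable_fun setT f -> cvg_prob P f_ f ->
  adapted (completion P D) f.
Proof.
move=> sD mD af mf cf; apply: adapted_cvg_prob cf => // m.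
by apply: adapted_sub (af m); exact: sub_completion.
Qed.

(* v^T z_t - x^T z_s is a limit of sums of independent Gaussian increments, on a
   fine grid for the Ito sums inside a coarse grid for the dual path. *)
Lemma linear_path_char (Pf : R -> 'M[R]_n) (v : 'cV[R]_n) : mxcont s t Pf ->
  (forall u, s < u < t -> mxder Pf u (F u *m Pf u + Pf u *m (F u)^T +
     (s1 *m s1^T + K u *m (s2 *m s2^T) *m (K u)^T))) ->
  exists x : 'cV[R]_n,
    char_gauss P W (fun w => (v^T *m z t w) ord0 ord0 - (x^T *m z s w) ord0 ord0)
      (quadform (Pf t) v - quadform (Pf s) x) /\
    adapted (completion P (sigma_proc `[0, +oo[ B))
      (fun w => (v^T *m z t w) ord0 ord0 - (x^T *m z s w) ord0 ord0).
Proof.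
move=> cP dP; have st' := ltW st.
have [q [cq qt dq hq]] := linear_path_sum v st cF cz hz.
exists (q s); set Y := fun w => _ - _.
have mY : measurable_fun setT Y.
  by apply: measurable_funB; apply: rvec_dot; exact: mz.
pose Sm m w := \sum_(k < m.+1) ((q (ugrid s t m.+1 k))^T *m
        (N (ugrid s t m.+1 k.+1) w - N (ugrid s t m.+1 k) w)) ord0 ord0.
have mSm m : measurable_fun setT (Sm m).
  apply: measurable_sum => k; apply: rvec_dot; apply: rvecB; exact: mN.
have mapp m l : measurable_fun setT (approx q m l).
  by apply: measurable_sum => k; apply: rvec_dot; apply: rvec_sum => h; exact: minc.
have capp m : cvg_prob P (approx q m) (Sm m).
  have term (k : 'I_m.+1) : cvg_prob P
     (fun l w => ((q (ugrid s t m.+1 k))^T *m \sum_(k * l.+1 <= j < k.+1 * l.+1) inc (m.+1 * l.+1) j w) ord0 ord0)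
     (fun w => ((q (ugrid s t m.+1 k))^T *m (N (ugrid s t m.+1 k.+1) w - N (ugrid s t m.+1 k) w)) ord0 ord0).
    pose u := q (ugrid s t m.+1 k).
    have h1 := @noise_limit m.+1 k.+1 u (ltn0Sn _) (ltn_ord k).
    have h2 := @noise_limit m.+1 k (- u) (ltn0Sn _) (ltnW (ltn_ord k)).
    have mI (x : 'cV[R]_n) i l : measurable_fun setT (fun w => (x^T *m \sum_(0 <= j < i * l.+1) inc (m.+1 * l.+1) j w) ord0 ord0).
      by apply: rvec_dot; apply: rvec_sum => h; exact: minc.
    have mL (x : 'cV[R]_n) i : measurable_fun setT (fun w => (x^T *m (N (ugrid s t m.+1 i) w - s1 *m usubmx (B s w))) ord0 ord0).
      apply: rvec_dot; apply: rvecB; first exact: mN.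
      by apply: rvec_mulmx; apply: rvec_usubmx; exact: mB.
    have := cvg_probD (mI u k.+1) (mI (- u) k) (mL u k.+1) (mL (- u) k) h1 h2.
    congr (cvg_prob P _ _).
    - apply/funext => l; apply/funext => w; rewrite -mx11D trmxN mulNmx -mulmxBr; congr ((_ *m _) _ _).
      rewrite (@big_cat_nat _ _ _ (k * l.+1)%N 0%N (k.+1 * l.+1)%N)//= ?leq_mul2r ?leqnSn ?orbT//.
      by rewrite addrAC subrr add0r.
    - apply/funext => w; rewrite -mx11D trmxN mulNmx -mulmxBr; congr ((_ *m _) _ _).
      by rewrite opprB addrA subrK.
  apply: (@cvg_prob_sum _ _ _ P _ (index_enum 'I_m.+1) (fun k l w => ((q (ugrid s t m.+1 k))^T *m \sum_(k * l.+1 <= j < k.+1 * l.+1) inc (m.+1 * l.+1) j w) ord0 ord0)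
     (fun k w => ((q (ugrid s t m.+1 k))^T *m (N (ugrid s t m.+1 k.+1) w - N (ugrid s t m.+1 k) w)) ord0 ord0)) => //.
  - by move=> k l; apply: rvec_dot; apply: rvec_sum => h; exact: minc.
  - by move=> k; apply: rvec_dot; apply: rvecB; exact: mN.
have cS : cvg_prob P Sm Y by exact: cvg_ae_prob.
(* [L m] refines the coarse grid [m] so far that the Ito sums are close to their limits in
   probability. *)
have [L hL] := cvg_prob_diag mapp mSm mY capp cS.
pose G u := s1 *m s1^T + K u *m (s2 *m s2^T) *m (K u)^T.
have GE u x : quadform (G u) x = norm2 (s1^T *m x) ^+ 2 + norm2 (s2^T *m ((K u)^T *m x)) ^+ 2.
  rewrite /G quadformD -!sqr_norm2_trmx_mul; congr (_ + _).
  by rewrite !sqr_norm2_trmx_mul -[in RHS](trmxK (K u)) -quadform_conj trmxK trmxK.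
have G0 u x : 0 <= quadform (G u) x by rewrite GE addr_ge0 ?sqr_ge0.
(* Along [q] the drift cancels and [V' = q^T G q]; the variances of the approximating sums are
   Riemann sums of this derivative, hence tend to [V t - V s]. *)
pose V u := quadform (Pf u) (q u).
have cV : {within `[s, t], continuous V} by exact: mxcont_quadform.
have dV (u : R) : s < u < t -> is_derive u 1 V (quadform (G u) (q u)).
  by move=> su; apply: is_derive_quadform (dq u su) (dP u su).
have V0 : 0 <= V t - V s.
  rewrite subr_ge0; apply: (derive_nondecr st' dV cV) => u su; exact: G0.
have cG : mxcont s t G.
  apply: mxcontD; first exact: mxcont_cst.
  by apply: mxcontM; [apply: mxcontM => //; exact: mxcont_cst|exact: mxcontT].
have uf := quadform_uniform cG cq.
have cvV := @variance_sum R s t V (fun x y => quadform (G y) (q x)) L st cV dV uf.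
split.
  have -> : quadform (Pf t) v - quadform (Pf s) (q s) = V t - V s by rewrite /V qt.
  apply: (char_gauss_cvg hW) hL V0 cvV => // m.
  have gm' k : ugrid s t (m.+1 * (L m).+1) k <= ugrid s t (m.+1 * (L m).+1) k.+1 by apply: ugrid_le.
  have g0 : 0 <= ugrid s t (m.+1 * (L m).+1) 0 by rewrite ugrid0.
  have := brownian_sum_char hW hB (coef q m (L m)) (m.+1 * (L m).+1) g0 gm'.
  congr (char_gauss P W _ _).
    by apply/funext => w; rewrite approxE.
  by apply: eq_bigr => j _; rewrite /coef sqr_norm2_col_mx norm2N GE.
have sB := @sigma_proc_sigma_algebra (n + p) `[0, +oo[%classic B.
apply: gap_adapted hL => //.
- apply: sigma_proc_measurable => u /=; rewrite in_itv/= andbT; exact: mB.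
- move=> m; apply/sigma_adaptedP => //.
  rewrite (_ : approx q m (L m) = fun w => \sum_(j < m.+1 * (L m).+1) ((coef q m (L m) j)^T *m
    (B (ugrid s t (m.+1 * (L m).+1) j.+1) w - B (ugrid s t (m.+1 * (L m).+1) j) w)) ord0 ord0); last first.
    by apply/funext => w; rewrite approxE.
  apply: measurable_sum => j; apply: rvec_dot; apply: rvecB; apply/vadapted_rvec => //.
  + by apply: sigma_proc_vadapted; rewrite /= in_itv/= andbT (le_trans s0).
  + by apply: sigma_proc_vadapted; rewrite /= in_itv/= andbT (le_trans s0).
Qed.

End FilterGap.

(** * Conditional laws *)

Section ConditionalLaws.
Context {R : realType} {disp : measure_display} {T : measurableType disp}.
Variable P : probability T R.

Lemma expect_eq0_ae (f : T -> R) : bmeas f -> (forall w, 0 <= f w) -> expect P f = 0 ->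
  {ae P, forall w, f w = 0}.
Proof.
move=> bf f0 Ef; have [mf _] := bf.
have mfE : measurable_fun setT (fun w => (f w)%:E) by exact/measurable_EFinP.
have : (\int[P]_w `|(f w)%:E| = 0)%E.
  under eq_integral do rewrite gee0_abs ?lee_fin//.
  have fin : (\int[P]_w (f w)%:E)%E \is a fin_num by exact: (integrable_fin_num measurableT (bmeas_integrable P bf)).
  by rewrite -(fineK fin); congr EFin.
move/(ae_eq_integral_abs P measurableT mfE).
by apply: filterS => w /(_ I) [].
Qed.

(** Tests against [D] extend to its completion, as null sets do not affect expectations; the event
    [g < f] belongs to the completion and can itself be used as a test. *)
Lemma adapted_ae_le D (f g : T -> R) : sigma_algebra setT D -> D `<=` measurable ->
  adapted (completion P D) f -> adapted (completion P D) g -> bmeas f -> bmeas g ->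
  (forall B, D B -> expect P (fun w => \1_B w * f w) = expect P (fun w => \1_B w * g w)) ->
  {ae P, forall w, f w <= g w}.
Proof.
move=> sD mD af ag bf bg hD; have sC := completion_sigma_algebra P sD.
have hC B : completion P D B -> expect P (fun w => \1_B w * f w) = expect P (fun w => \1_B w * g w).
  move=> [mB [B' DB' BB']].
  have mB' : bmeas (\1_B' : T -> R) by apply: bmeas_indic; exact: mD.
  have E h : bmeas h -> expect P (fun w => \1_B w * h w) = expect P (fun w => \1_B' w * h w).
    move=> bh; apply: expect_ae; [by apply: bmeasM => //; exact: bmeas_indic|exact: bmeasM|].
    apply: filterS BB' => w [h1 h2]; congr (_ * _); rewrite !indicE.
    have [Bw|Bw] := pselect (B w); first by rewrite !mem_set//; exact: h1.
    by rewrite !memNset// => /h2.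
  by rewrite E// hD// -E.
pose B := [set w | g w < f w].
have CB : completion P D B.
  have : measurable_fun setT (fun w : g_sigma_algebraType (completion P D) => f w - g w).
    by apply: measurable_funB; apply/sigma_adaptedP.
  move=> /(sigma_adaptedP _ sC)/(_ `]0, +oo[%classic (measurable_itv _)).
  by congr (completion P D _); apply/seteqP; split=> w; rewrite /B /= in_itv/= andbT subr_gt0.
have mB : measurable B by exact: completion_measurable CB.
have b1 := bmeas_indic mB : bmeas (\1_B : T -> R).
have : {ae P, forall w, \1_B w * (f w - g w) = 0}.
  apply: expect_eq0_ae.
  - by apply: bmeasM => //; exact: bmeasB.
  - move=> w; rewrite indicE; have [Bw|Bw] := pselect (B w).
      by rewrite mem_set// mul1r subr_ge0 ltW.
    by rewrite memNset// mul0r.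
  - rewrite (_ : (fun w => _) = (fun w => \1_B w * f w - \1_B w * g w)); last first.
      by apply/funext => w; rewrite mulrBr.
    rewrite expectB; [|exact: bmeasM|exact: bmeasM].
    by rewrite hC// subrr.
apply: filterS => w; rewrite indicE; have [Bw|Bw] := pselect (B w).
  by rewrite mem_set// mul1r => /eqP; rewrite subr_eq0 => /eqP ->.
by move=> _; rewrite leNgt; apply/negP.
Qed.

(** The pair has the product law by uniqueness of product measures, and sections integrate
    accordingly. The target types are general so that [f] can be the identity into [T] with a
    smaller sigma-algebra. *)
Lemma indep_pair_law d1 d2 (T1 : measurableType d1) (T2 : measurableType d2)
    (f : T -> T1) (g : T -> T2) (S : set (T1 * T2)) :
  measurable_fun setT f -> measurable_fun setT g ->
  (forall A B, measurable A -> measurable B ->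
    P (f @^-1` A `&` g @^-1` B) = (P (f @^-1` A) * P (g @^-1` B))%E) ->
  measurable S ->
  measurable_fun setT (fun x => P (g @^-1` (xsection S x))) /\
  P [set w | S (f w, g w)] = (\int[P]_w P (g @^-1` (xsection S (f w))))%E.
Proof.
move=> mf mg fg mS.
pose f' : {mfun T >-> T1} := mfun_Sub (mem_set mf).
pose g' : {mfun T >-> T2} := mfun_Sub (mem_set mg).
have mfg : measurable_fun setT (fun w => (f w, g w)) by exact: measurable_fun_pair.
pose fg' : {mfun T >-> (T1 * T2)%type} := mfun_Sub (mem_set mfg).
have mx : measurable_fun setT (fun x => P (g @^-1` (xsection S x))).
  exact: (measurable_fun_xsection (distribution P g') mS).
split => //.
have fgE A B : measurable A -> measurable B ->
    (distribution P fg') (A `*` B) = (distribution P f' A * distribution P g' B)%E.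
  by move=> mA mB; exact: fg.
rewrite -[LHS]/(distribution P fg' S) -(product_measure_unique fgE mS) /product_measure1.
rewrite (@integral_law _ _ _ P _ T1 f (distribution P f') (fun x => P (g @^-1` (xsection S x))))//.
Qed.

(* F-measurability of m holds only up to null sets, hence the completion. *)
Lemma cond_law_sum d (F G : set (set T)) (m D xi : T -> 'cV[R]_d)
    (eta : T -> probability (bvec R d) R) :
  sigma_algebra setT F -> F `<=` measurable ->
  indep P (completion P F) G -> vadapted (completion P F) m -> vadapted G D ->
  G `<=` measurable -> rvec xi ->
  (forall U : set (bvec R d), measurable U -> P (D @^-1` U) = P (xi @^-1` U)) ->
  cond_law P F (fun w => m w + D w) eta ->
  {ae P, forall w, forall U : set (bvec R d), measurable U ->
    eta w U = P [set w' | U (m w + xi w')]}.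
Proof.
move=> sF mF iFG am aD mG mxi Dxi heta.
have sC := completion_sigma_algebra P sF.
(* [T] with the completed sigma-algebra: the identity into it carries all the information of [F], so
   that [m] and the indicators of events become functions of one variable independent of [D]. *)
pose TF := g_sigma_algebraType (completion P F).
have mD : rvec D by move=> _ U mU; rewrite setTI; apply: mG; exact: aD.
have mm : rvec (m : TF -> 'cV[R]_d) by exact/vadapted_rvec.
have mid : measurable_fun setT (id : T -> TF).
  move=> _ B mB; rewrite setTI; apply: (@completion_measurable _ _ _ P F).
  by rewrite -(sigma_algebra_id sC).
have CTF (B : set T) : completion P F B <-> measurable (B : set TF).
  split=> [CB|]; first exact: sub_sigma_algebra.
  by move=> mB; rewrite -(sigma_algebra_id sC).
have idD (A : set TF) (B : set (bvec R d)) : measurable A -> measurable B ->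
    P (id @^-1` A `&` D @^-1` B) = (P (id @^-1` A) * P (D @^-1` B))%E.
  by move=> mA mB; apply: iFG; [exact/CTF|exact: aD].
have madd : measurable_fun setT (fun z : TF * bvec R d => (m z.1 + (z.2 : 'cV[R]_d)) : bvec R d).
  apply: measurable_fun_bvec => i; under eq_fun do rewrite mxE.
  apply: measurable_funD.
    exact: (measurableT_comp (measurable_fun_coord i mm) measurable_fst).
  exact: (measurableT_comp (measurable_bvec_coord i) measurable_snd).
have key (U : set (bvec R d)) : measurable U ->
  {ae P, forall w, eta w U = P [set w' | U (m w + D w')]}.
  move=> mU; have [aeta heU] := heta U mU.
  pose k w := fine (P [set w' | U (m w + D w')]).
  have finP (A : set T) : measurable A -> P A \is a fin_num by move=> mA; exact: fin_num_measure.
  have mshift w : measurable [set w' | U (m w + D w')].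
    rewrite -[X in measurable X]setTI; apply: (rvecD (rvec_cst (m w)) mD) => //.
  have mS0 : measurable [set z : TF * bvec R d | U (m z.1 + (z.2 : 'cV[R]_d))].
    by rewrite -[X in measurable X]setTI; exact: madd.
  have [mk0 _] := indep_pair_law mid mD idD mS0.
  have secE w : P (D @^-1` xsection [set z : TF * bvec R d | U (m z.1 + (z.2 : 'cV[R]_d))] w) = P [set w' | U (m w + D w')].
    by congr (P _); apply/seteqP; split=> w' /=; rewrite /xsection/= inE.
  have ak : adapted (completion P F) k.
    apply/sigma_adaptedP => //.
    have := measurableT_comp (@fine_measurable R _ measurableT) mk0.
    by rewrite (_ : _ \o _ = k)//; apply/funext => w; rewrite /= secE.
  have le01 (p : \bar R) : (0 <= p)%E -> (p <= 1)%E -> `|fine p| <= 1.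
    by case: p => [p| |]//=; rewrite ?normr0// !lee_fin => p0 p1; rewrite ger0_norm.
  have bk : bmeas k.
    split; first exact: adapted_measurable (@completion_measurable _ _ _ P F) ak.
    by exists 1 => w; apply: le01; rewrite ?measure_ge0// probability_le1.
  have ae0 : adapted F (fun w => fine (eta w U)) by exact: aeta.
  have be : bmeas (fun w => fine (eta w U)).
    split; first exact: adapted_measurable mF ae0.
    by exists 1 => w; apply: le01; rewrite ?measure_ge0// probability_le1.
  have ae1 : adapted (completion P F) (fun w => fine (eta w U)).
    by apply: adapted_sub ae0; exact: sub_completion.
  have hB B : F B -> expect P (fun w => \1_B w * fine (eta w U)) = expect P (fun w => \1_B w * k w).
    move=> FB; have mB := mF _ FB.
    have CB : completion P F B by exact: sub_completion.
    have mS : measurable ([set z : TF * bvec R d | U (m z.1 + (z.2 : 'cV[R]_d))] `&` (B `*` setT)).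
      by apply: measurableI => //; apply: measurableX => //; exact/CTF.
    have [_ e1] := indep_pair_law mid mD idD mS.
    have e2 := heU B FB.
    have i1 : (\int[P]_w (\1_B w * fine (eta w U))%:E = \int[P]_(w in B) eta w U)%E.
      rewrite [RHS]integral_mkcond; apply: eq_integral => w _.
      rewrite patchE indicE; case: (w \in B); last by rewrite mul0r.
      by rewrite mul1r fineK// fin_num_measure.
    have i2 : (\int[P]_w (\1_B w * k w)%:E = P (B `&` (fun w => (m w + D w)%R) @^-1` U))%E.
      transitivity (P [set w | ([set z : TF * bvec R d | U (m z.1 + (z.2 : 'cV[R]_d))] `&` (B `*` setT)) (id w, D w)]); last first.
        by congr (P _); apply/seteqP; split=> w /=; [move=> [h [Bw _]]|move=> [Bw h]].
      rewrite e1; apply: eq_integral => w _; rewrite indicE.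
      have [Bw|Bw] := pselect (B w).
        rewrite mem_set// mul1r /k fineK ?finP//; congr (P _); apply/seteqP; split=> w' /=.
          by rewrite /xsection/= inE => h; split.
        by rewrite /xsection/= inE => -[].
      rewrite memNset// mul0r (_ : _ @^-1` _ = set0) ?measure0//.
      by apply/seteqP; split=> w' //=; rewrite /xsection/= inE => -[_ [/Bw]].
    by congr fine; rewrite i1 i2 e2.
  have l1 := adapted_ae_le sF mF ae1 ak be bk hB.
  have l2 := adapted_ae_le sF mF ak ae1 bk be (fun B FB => esym (hB B FB)).
  apply: filterS2 l1 l2 => w h1 h2.
  rewrite -[LHS]fineK ?fin_num_measure// -[RHS]fineK ?finP//; congr EFin.
  by apply/eqP; rewrite eq_le h1 h2.
(* Countably many orthants share one null set; uniqueness on this pi-system then gives all Borel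
   sets outside it. *)
have all_orth : {ae P, forall w, forall a, eta w (orthant a) = P [set w' | orthant a (m w + D w')]}.
  have : {ae P, forall w, forall n : nat, if unpickle n is Some a then
     eta w (orthant a) = P [set w' | orthant a (m w + D w')] else True}.
    apply: ae_foralln => n; case: unpickle => [a|]; last exact: aeW.
    by apply: key; exact: measurable_orthant.
  by apply: filterS => w h a; have := h (pickle a); rewrite pickleK.
apply: filterS all_orth => w hw U mU.
have mX : measurable_fun setT (fun w' => (m w + D w') : bvec R d) by exact: (rvecD (rvec_cst (m w)) mD).
pose X' : {mfun T >-> bvec R d} := mfun_Sub (mem_set mX).
rewrite (@orthant_uniqueness R d (eta w) (distribution P X') hw U mU).
have mV : measurable ([set y : 'cV[R]_d | U (m w + y)] : set (bvec R d)).
  rewrite -[X in measurable X]setTI.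
  have : measurable_fun setT (fun y : bvec R d => (m w + (y : 'cV[R]_d)) : bvec R d).
    apply: measurable_fun_bvec => i; under eq_fun do rewrite mxE.
    by apply: measurable_funD; [exact: measurable_cst|exact: measurable_bvec_coord].
  exact.
exact: (Dxi _ mV).
Qed.

Context {d : nat}.
Variable W : R -> T -> 'cV[R]_d.+1.

(** Cramer-Wold: along every [u] the expectations of cosine and sine depend on [quadform V u] alone,
    through [gchar], so the Fourier transforms agree. *)
Lemma char_gauss_law n (X Y : T -> 'cV[R]_n) (V : 'M[R]_n) : rvec X -> rvec Y ->
  (forall u, char_gauss P W (fun w => (u^T *m X w) ord0 ord0) (quadform V u)) ->
  (forall u, char_gauss P W (fun w => (u^T *m Y w) ord0 ord0) (quadform V u)) ->
  forall U : set (bvec R n), measurable U -> P (X @^-1` U) = P (Y @^-1` U).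
Proof.
move=> mX mY cX cY U mU.
pose X' : {mfun T >-> bvec R n} := mfun_Sub (mem_set mX).
pose Y' : {mfun T >-> bvec R n} := mfun_Sub (mem_set mY).
have mdot (u : 'cV[R]_n) : measurable_fun setT (fun y : bvec R n => (u^T *m (y : 'cV[R]_n)) ord0 ord0).
  by apply: measurable_fun_mulmx => i j; rewrite ord1; exact: measurable_bvec_coord.
have E (f : R -> R) (Z : {mfun T >-> bvec R n}) (u : 'cV[R]_n) : measurable_fun setT f -> (forall x, `|f x| <= 1) ->
  (\int[distribution P Z]_y (f ((u^T *m (y : 'cV[R]_n)) ord0 ord0))%:E =
   (expect P (fun w => f ((u^T *m (Z w : 'cV[R]_n)) ord0 ord0)))%:E)%E.
  move=> mf f1.
  have bf : bmeas (fun w => f ((u^T *m (Z w : 'cV[R]_n)) ord0 ord0)).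
    split; last by exists 1.
    by apply: (measurableT_comp mf); apply: (@rvec_dot R disp T n (fun w => Z w : 'cV[R]_n) u); exact: measurable_funP.
  have iP := bmeas_integrable P bf.
  rewrite integral_distribution//; last first.
    by apply/measurable_EFinP; exact: (measurableT_comp mf (mdot u)).
  rewrite /expect /Rintegral fineK//.
  exact: (integrable_fin_num measurableT iP).
have mcos : measurable_fun setT (@cos R) by exact: continuous_measurable_fun (@continuous_cos R).
have msin : measurable_fun setT (@sin R) by exact: continuous_measurable_fun (@continuous_sin R).
apply: (@fourier_uniqueness R n (distribution P X') (distribution P Y')) => // u.
- rewrite !E//; [|exact: norm_cos_le1|exact: norm_cos_le1].
  by have [_ _ /= -> _] := cX u; have [_ _ -> _] := cY u.
- rewrite !E//; [|exact: norm_sin_le1|exact: norm_sin_le1].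
  by have [_ _ _ /= ->] := cX u; have [_ _ _ ->] := cY u.
Qed.

End ConditionalLaws.

(** * Kalman-Bucy diffusions *)

Section ColumnVectors.
Context {R : realType} {disp : measure_display} {T : measurableType disp}.

Lemma rvec_col_mx m n (X : T -> 'cV[R]_m) (Y : T -> 'cV[R]_n) : rvec X -> rvec Y ->
  rvec (fun w => col_mx (X w) (Y w)).
Proof.
move=> mX mY; apply: measurable_fun_bvec => i.
rewrite -(splitK i); case: (fintype.split i) => k; rewrite /unsplit.
  by under eq_fun do rewrite col_mxEu; exact: measurable_fun_coord.
by under eq_fun do rewrite col_mxEd; exact: measurable_fun_coord.
Qed.

End ColumnVectors.

Section KalmanBucy.
Context {R : realType} {disp : measure_display} {T : measurableType disp}.
Variable P : probability T R.

Lemma mxintB m n (a b : R) (f g : R -> 'M[R]_(m, n)) : a <= b -> mxcont a b f -> mxcont a b g ->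
  mxint a b (fun u => f u - g u) = mxint a b f - mxint a b g.
Proof.
rewrite le_eqVlt => /predU1P[->|ab] cf cg; first by rewrite !mxint_point subrr.
have [cF dF] := mxint_antiderivative ab cf; have [cG dG] := mxint_antiderivative ab cg.
have [cH dH] := mxint_antiderivative ab (mxcontB cf cg).
apply: (@mx_path_eq _ _ _ a b (fun t => mxint a t (fun u => f u - g u)) (fun t => mxint a t f - mxint a t g)
  (fun t => f t - g t)).
- exact: ltW.
- exact: cH.
- exact: mxcontB.
- by rewrite !mxint_point subrr.
- exact: dH.
- by move=> t ht; apply: mxderB; [exact: dF|exact: dG].
Qed.

Lemma mxint_col_mx m n p (a b : R) (f : R -> 'M[R]_(m, p)) (g : R -> 'M[R]_(n, p)) :
  mxint a b (fun u => col_mx (f u) (g u)) = col_mx (mxint a b f) (mxint a b g).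
Proof.
apply/matrixP => i j; rewrite mxE -(splitK i); case: (fintype.split i) => k; rewrite /unsplit.
  by rewrite col_mxEu mxE; congr Rintegral; apply/funext => u; rewrite col_mxEu.
by rewrite col_mxEd mxE; congr Rintegral; apply/funext => u; rewrite col_mxEd.
Qed.

Lemma mxcont_col_mx m n p (a b : R) (f : R -> 'M[R]_(m, p)) (g : R -> 'M[R]_(n, p)) :
  mxcont a b f -> mxcont a b g -> mxcont a b (fun u => col_mx (f u) (g u)).
Proof.
move=> cf cg i j; rewrite -(splitK i); case: (fintype.split i) => k; rewrite /unsplit.
  by apply: (@within_congr R _ (fun u => f u k j)) => [u|]; [rewrite col_mxEu|exact: cf].
by apply: (@within_congr R _ (fun u => g u k j)) => [u|]; [rewrite col_mxEd|exact: cg].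
Qed.

Lemma brownian0 n (B : R -> T -> 'cV[R]_n) : brownian P B -> {ae P, forall w, B 0 w = 0}.
Proof. by case. Qed.

Lemma brownian_rvec_at n (B : R -> T -> 'cV[R]_n) u : brownian P B -> 0 <= u -> rvec (B u).
Proof. by move=> [[h _] _ _ _]; exact: h. Qed.

Lemma joint_sigma_measurable m n (X : T -> 'cV[R]_m) (B : R -> T -> 'cV[R]_n) : rvec X -> brownian P B ->
  <<s sigma_vec X `|` sigma_proc `[0, +oo[ B >> `<=` measurable.
Proof.
move=> mX hB; apply: smallest_sub; first exact: sigma_algebra_measurable.
move=> A [[U mU ->]|].
  by rewrite -[X in measurable X]setTI; exact: mX.
apply: sigma_proc_measurable => u /=; rewrite in_itv/= andbT; exact: brownian_rvec_at.
Qed.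

Lemma joint_sigma_left m n (X : T -> 'cV[R]_m) (B : R -> T -> 'cV[R]_n) :
  sigma_vec X `<=` <<s sigma_vec X `|` sigma_proc `[0, +oo[ B >>.
Proof. by move=> A h; apply: sub_sigma_algebra; left. Qed.

Lemma joint_sigma_right m n (X : T -> 'cV[R]_m) (B : R -> T -> 'cV[R]_n) :
  sigma_proc `[0, +oo[ B `<=` <<s sigma_vec X `|` sigma_proc `[0, +oo[ B >>.
Proof. by move=> A h; apply: sub_sigma_algebra; right. Qed.

Lemma vadapted_sub (D E : set (set T)) n (X : T -> 'cV[R]_n) : D `<=` E -> vadapted D X -> vadapted E X.
Proof. by move=> DE aX U mU; apply: DE; exact: aX. Qed.

Lemma sqrtmx_sym n (M : 'M[R]_n) : psd M -> (sqrtmx M)^T = sqrtmx M.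
Proof. by move=> /psd_sqrtmx[]. Qed.

Section Observation.
Context {r p : nat}.
Variables (A Rm : 'M[R]_r) (C : 'M[R]_(p, r)) (Sigma : 'M[R]_p).
Variables (B : R -> T -> 'cV[R]_(r + p)) (X : R -> T -> 'cV[R]_r) (Y : R -> T -> 'cV[R]_p).
Hypothesis hXY : signal_observation P A Rm C Sigma B X Y.

(** Signal and observation together solve one linear equation with block drift, whose noise is a
    linear image of [B]; adaptedness of the pair follows from that of the noise and of the initial
    values. *)
Lemma observation_adapted u : 0 <= u ->
  vadapted (completion P <<s sigma_vec (X 0) `|` sigma_proc `[0, +oo[ B >>) (Y u).
Proof.
move=> u0; have [hB [m [V [mX0 _ _]]] _ [cX cY] heq] := hXY.
set D := <<s _ >>.
have sD : sigma_algebra setT D by exact: smallest_sigma_algebra.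
have mD : D `<=` measurable by exact: joint_sigma_measurable.
have sC := completion_sigma_algebra P sD.
have DC : D `<=` completion P D by exact: sub_completion.
pose z u w := col_mx (X u w) (Y u w).
pose F (_ : R) : 'M[R]_(r + p) := block_mx A 0 C 0.
pose N u w := col_mx (sqrtmx Rm *m usubmx (B u w)) (sqrtmx Sigma *m dsubmx (B u w)).
have mX v : 0 <= v -> rvec (X v) by move=> v0; exact: continuous_proc_rvec cX.
have mY v : 0 <= v -> rvec (Y v) by move=> v0; exact: continuous_proc_rvec cY.
have aB v : 0 <= v -> vadapted (completion P D) (B v).
  move=> v0; apply: (vadapted_sub DC).
  apply: (@vadapted_sub (sigma_proc `[0, +oo[ B)); first exact: joint_sigma_right.
  by apply: sigma_proc_vadapted; rewrite /= in_itv/= v0.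
have aX0 : vadapted (completion P D) (X 0).
  by apply: (vadapted_sub DC) => U mU; apply: joint_sigma_left; exists U.
have Y0 : {ae P, forall w, Y 0 w = 0}.
  apply: filterS2 heq (brownian0 hB) => w /(_ 0 (lexx 0))[_ ->] ->.
  by rewrite mxint_point add0r (_ : dsubmx 0 = 0) ?mulmx0//; apply/matrixP => i j; rewrite !mxE.
have aY0 : vadapted (completion P D) (Y 0).
  apply: (@vadapted_ae _ _ _ P D _ (fun=> 0)) => //; last by apply: filterS Y0.
    by apply/vadapted_rvec => //; exact: rvec_cst.
  exact: mY.
have az0 : vadapted (completion P D) (z 0).
  by apply/vadapted_rvec => //; apply: rvec_col_mx; apply/vadapted_rvec.
have hz : linear_path P F z N 0 u.
  apply: filterS2 heq (brownian0 hB) => w hw B0 v /andP[v0 _].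
  have [e1 e2] := hw v v0; have [e3 e4] := hw 0 (lexx 0).
  rewrite /z e1 e2 e4 /N B0 mxint_point.
  have -> : usubmx (0 : 'cV[R]_(r + p)) = 0 by apply/matrixP => i j; rewrite !mxE.
  have -> : dsubmx (0 : 'cV[R]_(r + p)) = 0 by apply/matrixP => i j; rewrite !mxE.
  rewrite !mulmx0 add0r col_mx0 subr0.
  have -> : (fun v => F v *m col_mx (X v w) (Y v w)) = (fun v => col_mx (A *m X v w) (C *m X v w)).
    by apply/funext => y; rewrite /F mul_block_col !mul0mx !addr0.
  by rewrite mxint_col_mx !add_col_mx add0r.
have cz : {ae P, forall w, mxcont 0 u (fun v => z v w)}.
  apply: filterS2 (continuous_proc_mxcont u cX) (continuous_proc_mxcont u cY) => w h1 h2.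
  exact: mxcont_col_mx.
have cF : mxcont 0 u F by exact: mxcont_cst.
have := @linear_path_adapted _ _ _ P D _ F z N 0 u u0 sD cF (rvec_col_mx (mX _ u0) (mY _ u0)) cz hz az0.
have aN v : 0 <= v <= u -> vadapted (completion P D) (N v).
  move=> /andP[v0 _]; apply/vadapted_rvec => //; apply: rvec_col_mx; apply: rvec_mulmx.
    by apply: rvec_usubmx; apply/vadapted_rvec => //; exact: aB.
  by apply: rvec_dsubmx; apply/vadapted_rvec => //; exact: aB.
move=> /(_ aN) az; apply/vadapted_rvec => //.
rewrite (_ : Y u = fun w => dsubmx (z u w)); last by apply/funext => w; rewrite col_mxKd.
by apply: rvec_dsubmx; apply/vadapted_rvec.
Qed.

Lemma observation_sigma_sub (s t : R) : 0 <= s ->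
  sigma_proc `[s, t] Y `<=` completion P <<s sigma_vec (X 0) `|` sigma_proc `[0, +oo[ B >>.
Proof.
move=> s0; apply: smallest_sub.
  by apply: completion_sigma_algebra; exact: smallest_sigma_algebra.
move=> V [u /=]; rewrite in_itv/= => /andP[su _] [U mU ->].
by apply: observation_adapted mU; exact: le_trans su.
Qed.

End Observation.

Section Filter.
Context {r p : nat}.
Variables (A : 'M[R]_r) (C : 'M[R]_(p, r)) (K : R -> 'M[R]_(r, p)) (s : R).

(** The equation at [t = s] forces [J s] to vanish, which settles the Ito integral over a degenerate
    interval. *)
Lemma filter_noise0 N (M : R -> T -> 'cV[R]_p) Z :
  solves_filter P A C K s N M Z ->
  exists2 J : R -> T -> 'cV[R]_r, (forall t, s <= t -> ito_integral P K M s t (J t)) &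
  {ae P, forall w, J s w = 0 /\ forall t, s <= t ->
      Z t w = Z s w
              + mxint s t (fun u => A *m Z u w - K u *m (C *m Z u w))
              + (N t w - N s w) + J t w}.
Proof.
move=> [cZ [J iJ hJ]]; exists J => //; apply: filterS hJ => w hw; split=> //.
have := hw s (lexx s); rewrite mxint_point addr0 subrr addr0 => /eqP.
by rewrite -subr_eq0 opprD addrA subrr add0r oppr_eq0 => /eqP.
Qed.

(** The filter equation reads [dZ = (A - K C) Z dt + dJ], a linear equation whose noise [J] is the
    Ito integral against [Y]. *)
Lemma filter_adapted (Y : R -> T -> 'cV[R]_p) psi x (t : R) : s <= t -> mxcont s t K ->
  (forall u, s <= u -> rvec (Y u)) -> {ae P, forall w, psi s w = x} ->
  solves_filter P A C K s (fun _ _ => 0) Y psi ->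
  vadapted (completion P (sigma_proc `[s, t] Y)) (psi t).
Proof.
move=> st cK mY psi0 hpsi; have [cpsi _] := hpsi.
have [J iJ hJ] := filter_noise0 hpsi.
set D := sigma_proc _ _.
have sD : sigma_algebra setT D by exact: smallest_sigma_algebra.
have mD : D `<=` measurable.
  by apply: sigma_proc_measurable => u /=; rewrite in_itv/= => /andP[su _]; exact: mY.
have sC := completion_sigma_algebra P sD.
have DC : D `<=` completion P D by exact: sub_completion.
have a0 c : vadapted (completion P D) (fun=> c : 'cV[R]_r).
  by apply/vadapted_rvec => //; exact: rvec_cst.
have aY u : s <= u <= t -> vadapted (completion P D) (Y u).
  move=> su; apply: (vadapted_sub DC); apply: sigma_proc_vadapted.
  by rewrite /= in_itv/=.
apply: (@linear_path_adapted _ _ _ P D _ (fun u => A - K u *m C) psi J s t) => //.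
- apply: mxcontB; first exact: mxcont_cst.
  by apply: mxcontM => //; exact: mxcont_cst.
- exact: continuous_proc_rvec cpsi.
- exact: continuous_proc_mxcont.
- apply: filterS hJ => w [J0 hw] u /andP[su _]; rewrite hw// J0 !subr0 addr0; congr (_ + mxint _ _ _ + _).
  by apply/funext => v; rewrite mulmxBl mulmxA.
- apply: (@vadapted_ae _ _ _ P D _ (fun=> x)) => //; last by apply: filterS psi0.
  exact: continuous_proc_rvec cpsi.
(* At [u = s] the interval degenerates and [J s] is null almost surely; elsewhere the Ito sums use
   values of [Y] up to [u] only. *)
- move=> u /andP[]; rewrite le_eqVlt => /predU1P[<-|su] ut.
    have [mJ _] := iJ s (lexx s).
    apply: (@vadapted_ae _ _ _ P D _ (fun=> 0)) => //; by apply: filterS hJ => w [].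
  apply: (ito_adapted su sD _ mY (iJ u (ltW su))) => v /andP[sv vu].
  by apply: aY; rewrite sv (le_trans vu ut).
Qed.

End Filter.

End KalmanBucy.

(** * Standard Gaussian vectors built from the driving Brownian motion *)

Section GaussianSteps.
Context {R : realType} {disp : measure_display} {T : measurableType disp}.
Variable P : probability T R.
Context {r0 p : nat}.
Let r := r0.+1.
Variable WV : R -> T -> 'cV[R]_(r + p).
Hypothesis hB : brownian P WV.
Let W : R -> T -> 'cV[R]_(r0 + p).+1 := WV.

(** Unit-time increments of the first block of [WV]: independent standard Gaussian vectors are thus
    available on [T] itself, where the couplings are realised. *)
Definition gauss_step (k : nat) (w : T) : 'cV[R]_r := usubmx (WV k.+1%:R w - WV k%:R w).

Lemma rvec_gauss_step k : rvec (gauss_step k).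
Proof. by apply: rvec_usubmx; apply: rvecB; apply: brownian_rvec_at hB _. Qed.

Let lift (u : 'cV[R]_r) : 'cV[R]_(r + p) := col_mx u 0.

Let norm_lift u : norm2 (lift u) ^+ 2 = norm2 u ^+ 2.
Proof.
rewrite sqr_norm2_col_mx (_ : norm2 (0 : 'cV[R]_p) ^+ 2 = 0) ?addr0//.
by rewrite sqr_norm2_dot mulmx0 mxE.
Qed.

Let dot_lift u k w : ((lift u)^T *m (WV k.+1%:R w - WV k%:R w)) ord0 ord0 = (u^T *m gauss_step k w) ord0 ord0.
Proof. by rewrite dot_col_mx trmx0 mul0mx [X in _ + X]mxE addr0. Qed.

Let step1 k : k.+1%:R - k%:R = 1 :> R.
Proof. by rewrite -natr1 addrC addKr. Qed.

Let norm_sqrtmx (M : 'M[R]_r) u : psd M -> norm2 (sqrtmx M *m u) ^+ 2 = quadform M u.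
Proof.
move=> pM; rewrite -quadform_sqr; last by have [] := psd_sqrtmx pM.
by rewrite sqr_sqrtmx.
Qed.

Let dot_sqrtmx (M : 'M[R]_r) (u v : 'cV[R]_r) : psd M ->
  ((sqrtmx M *m u)^T *m v) ord0 ord0 = (u^T *m (sqrtmx M *m v)) ord0 ord0.
Proof. by move=> pM; rewrite trmx_mul sqrtmx_sym// mulmxA. Qed.

Lemma gauss_step_law k (u : 'cV[R]_r) :
  gauss_law P (fun w => (u^T *m gauss_step k w) ord0 ord0) 0 (norm2 u ^+ 2).
Proof.
have [_ _ h _] := hB; have k1 : (k%:R : R) <= k.+1%:R by rewrite ler_nat.
have := gaussian_vec_dot (lift u) (h k%:R k.+1%:R (ler0n _ _) k1).
rewrite mulmx0 mxE step1 quadform_scalar mul1r norm_lift.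
by under eq_fun do rewrite dot_lift.
Qed.

Lemma gauss_step_char (M : 'M[R]_r) (u : 'cV[R]_r) : psd M ->
  char_gauss P W (fun w => (u^T *m (sqrtmx M *m gauss_step 0 w)) ord0 ord0) (quadform M u).
Proof.
move=> pM; have := brownian_increment_char (hB : brownian P W) hB (lift (sqrtmx M *m u)) (lexx 0) ler01.
rewrite norm_lift subr0 mulr1 norm_sqrtmx//; congr (char_gauss P W _ _).
by apply/funext => w; have := dot_lift (sqrtmx M *m u) 0 w; rewrite dot_sqrtmx.
Qed.

Lemma gauss_step_char2 (M N : 'M[R]_r) (u : 'cV[R]_r) : psd M -> psd N ->
  char_gauss P W (fun w => (u^T *m (sqrtmx M *m gauss_step 0 w + sqrtmx N *m gauss_step 1 w)) ord0 ord0)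
    (quadform (M + N) u).
Proof.
move=> pM pN; pose a (k : nat) := lift (if k is 0%N then sqrtmx M *m u else sqrtmx N *m u).
have tm (k : nat) : (k%:R : R) <= k.+1%:R by rewrite ler_nat.
have := brownian_sum_char (hB : brownian P W) hB a 2 (lexx 0) tm.
rewrite quadformD; congr (char_gauss P W _ _).
  apply/funext => w; rewrite big_ord_recl big_ord1 mulmxDr mx11D.
  by rewrite (dot_lift (sqrtmx M *m u) 0) (dot_lift (sqrtmx N *m u) 1) !dot_sqrtmx.
rewrite big_ord_recl big_ord1 /a /= !norm_lift !norm_sqrtmx//.
by rewrite (step1 0) (step1 1) !mulr1.
Qed.

End GaussianSteps.

(** * Conditional law of a Kalman-Bucy diffusion *)

Section FilterLaw.
Context {R : realType} {disp : measure_display} {T : measurableType disp}.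
Variable P : probability T R.
Context {r0 p : nat}.
Let r := r0.+1.
Variables (A Rm : 'M[R]_r) (C : 'M[R]_(p, r)) (Sigma : 'M[R]_p).
Variables (WV : R -> T -> 'cV[R]_(r + p)) (X : R -> T -> 'cV[R]_r) (Y : R -> T -> 'cV[R]_p).
Hypotheses (hRm : posdef Rm) (hSigma : posdef Sigma).
Hypothesis hXY : signal_observation P A Rm C Sigma WV X Y.

Let S := C^T *m invmx Sigma *m C.
Let W : R -> T -> 'cV[R]_(r0 + p).+1 := WV.
Let hW : brownian P W.
Proof. by have [] := hXY. Qed.

Variables (G : R -> 'M[R]_r) (s t : R) (x : 'cV[R]_r) (Q : 'M[R]_r).
Variables (eta : T -> probability (bvec R r) R) (psi : R -> T -> 'cV[R]_r) (Pf : R -> 'M[R]_r).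
Hypotheses (s0 : 0 <= s) (st : s < t).
Hypothesis psi0 : {ae P, forall w, psi s w = x}.
Hypothesis hpsi : solves_filter P A C (fun u => G u *m C^T *m invmx Sigma) s (fun _ _ => 0) Y psi.
Hypothesis heta : kalman_bucy_law P A Rm C Sigma WV X Y G s t x Q eta.
Hypotheses (cG : mxcont s t G) (sG : forall u, s < u < t -> symmx (G u)).
Hypotheses (cP : mxcont s t Pf) (Ps : Pf s = Q) (pPt : psd (Pf t)).
Hypothesis dP : forall u, s < u < t ->
  mxder Pf u ((A - G u *m S) *m Pf u + Pf u *m (A - G u *m S)^T + (Rm + G u *m S *m G u)).

Lemma kalman_bucy_gaussian : {ae P, forall w, forall U : set (bvec R r), measurable U ->
  eta w U = P [set w' | U (psi t w + sqrtmx (Pf t) *m gauss_step WV 0 w')]}.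
Proof.
have [hB [m0 [V0 [mX0 _ _]]] _ [cX cY] _] := hXY.
have [B' [Z [[hB' gZ] iZB iXZ hZ hcl]]] := heta.
pose K u := G u *m C^T *m invmx Sigma.
have cK : mxcont s t K by do 2!(apply: mxcontM; last exact: mxcont_cst).
have mY u : s <= u -> rvec (Y u).
  by move=> su; apply: continuous_proc_rvec cY; exact: le_trans su.
have pS := posdef_psd hSigma; have pR := posdef_psd hRm.
have KCE u : K u *m C = G u *m S by rewrite /K /S !mulmxA.
have KSK u : s < u < t -> K u *m (sqrtmx Sigma *m (sqrtmx Sigma)^T) *m (K u)^T = G u *m S *m G u.
  move=> su; rewrite sqrtmx_sym// sqr_sqrtmx// /K !trmx_mul trmxK (sG su) trmx_inv.
  have -> : Sigma^T = Sigma by case: hSigma.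
  rewrite /S !mulmxA mulmxKV ?posdef_unit//.
have mZs : rvec (Z s) by case: gZ.
have [cZ _] := hZ; have [cpsi _] := hpsi.
have [J1 iJ1 hJ1] := filter_noise0 hZ; have [J2 iJ2 hJ2] := filter_noise0 hpsi.
pose D u w := Z u w - psi u w.
have mD u : s <= u -> rvec (D u).
  by move=> su; apply: rvecB; [exact: continuous_proc_rvec cZ|exact: continuous_proc_rvec cpsi].
have cZ' := continuous_proc_mxcont t cZ; have cpsi' := continuous_proc_mxcont t cpsi.
have cD : {ae P, forall w, mxcont s t (fun u => D u w)}.
  by apply: filterS2 cZ' cpsi' => w; exact: mxcontB.
pose F u := A - K u *m C.
have cF : mxcont s t F.
  by apply: mxcontB; [exact: mxcont_cst|apply: mxcontM => //; exact: mxcont_cst].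
pose M1 u w := Y u w - sqrtmx Sigma *m dsubmx (B' u w).
have mM1 u : s <= u -> rvec (M1 u).
  move=> su; apply: rvecB; first exact: mY.
  apply: rvec_mulmx; apply: rvec_dsubmx; apply: brownian_rvec_at hB' _; exact: le_trans su.
have M12 u w : M1 u w - Y u w = - (sqrtmx Sigma *m dsubmx (B' u w)).
  by rewrite /M1 addrAC subrr add0r.
(* The observations enter both equations through the same gain; the drifts subtract to [F D], and
   [J1 - J2] retains the observation noise of the copy [B']. *)
have hD : linear_path P F D (fun u w => sqrtmx Rm *m usubmx (B' u w) + J1 u w - J2 u w) s t.
  have h12 : {ae P, forall w, mxcont s t (fun u => Z u w) /\ mxcont s t (fun u => psi u w)}.
    by apply: filterS2 cZ' cpsi'.
  apply: filterS3 h12 hJ1 hJ2 => w [c1 c2] [J10 e1] [J20 e2] u /andP[su ut].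
  have c1' := mxcontS (lexx s) ut c1; have c2' := mxcontS (lexx s) ut c2.
  have cF' := mxcontS (lexx s) ut cF.
  have FE (y : R -> 'cV[R]_r) : (fun v => A *m y v - K v *m (C *m y v)) = (fun v => F v *m y v).
    by apply/funext => v; rewrite /F mulmxBl mulmxA.
  rewrite /D (e1 u su) (e2 u su) J10 J20 !subr0.
  rewrite (FE (Z ^~ w)) (FE (psi ^~ w)).
  have -> : (fun v => F v *m (Z v w - psi v w)) = (fun v => F v *m Z v w - F v *m psi v w).
    by apply/funext => v; rewrite mulmxBr.
  rewrite mxintB//; [|exact: mxcontM|exact: mxcontM].
  set i1 := mxint s u _; set i2 := mxint s u _.
  by apply/matrixP => i j; rewrite !mxE; ring.
have dPF u : s < u < t -> mxder Pf u (F u *m Pf u + Pf u *m (F u)^T +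
     (sqrtmx Rm *m (sqrtmx Rm)^T + K u *m (sqrtmx Sigma *m (sqrtmx Sigma)^T) *m (K u)^T)).
  move=> su; apply: (mxder_congr _ _ (dP su)) => //.
  by rewrite KSK// sqrtmx_sym// sqr_sqrtmx// /F KCE.
have sB' : sigma_algebra setT (sigma_proc `[0, +oo[ B') by exact: smallest_sigma_algebra.
have mB' : sigma_proc `[0, +oo[ B' `<=` measurable.
  by apply: sigma_proc_measurable => u /=; rewrite in_itv/= andbT => u0; exact: brownian_rvec_at hB' u0.
set E := <<s sigma_vec (Z s) `|` sigma_proc `[0, +oo[ B' >> in iXZ.
set E1 := <<s _ >> in iXZ.
have sE : sigma_algebra setT E by exact: smallest_sigma_algebra.
have mE : E `<=` measurable := joint_sigma_measurable mZs hB'.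
have mE1 : E1 `<=` measurable := joint_sigma_measurable mX0 hB.
have sCE := completion_sigma_algebra P sE.
(* The initial spread [y^T (Z s - x)] is independent of [B'] and has variance [quadform Q y]; this
   cancels the term [- quadform (Pf s) y] of the noise part, as [Pf s = Q], and leaves
   [quadform (Pf t) v]. *)
have gap v : char_gauss P W (fun w => (v^T *m D t w) ord0 ord0) (quadform (Pf t) v) /\
    adapted (completion P E) (fun w => (v^T *m D t w) ord0 ord0).
  have [y [cy ay]] := linear_path_char hW hB' s0 st cF cK mM1 mY M12 iJ1 iJ2 mD cD hD v cP dPF.
  pose g w := (y^T *m Z s w) ord0 ord0 - (y^T *m x) ord0 ord0.
  have aZ : adapted (sigma_vec (Z s)) g.
    apply/sigma_adaptedP; first exact: sigma_vec_sigma_algebra.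
    apply: measurable_funB; last exact: measurable_cst.
    by apply/sigma_adaptedP; [exact: sigma_vec_sigma_algebra|exact: sigma_vec_dot].
  have cg : char_gauss P W g (quadform Q y).
    apply: gauss_law_char => //; last exact: (gaussian_vec_dot y gZ).
    by have [_ [_ ->] _] := gZ.
  have mZ : sigma_vec (Z s) `<=` measurable by exact: sub_sigma_vec_measurable.
  have i1 := completion_indep mZ mB' iZB.
  have aZ' : adapted (completion P (sigma_vec (Z s))) g.
    by apply: adapted_sub aZ; exact: sub_completion.
  have cs := char_gaussD i1 (@completion_measurable _ _ _ P _) (@completion_measurable _ _ _ P _) aZ' ay cg cy
    (gcharD hW (v:=_) (u:=_)).
  have mDt : measurable_fun setT (fun w => (v^T *m D t w) ord0 ord0) by apply: rvec_dot; apply: mD; exact: ltW.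
  have eq_ae : {ae P, forall w, g w + ((v^T *m D t w) ord0 ord0 - (y^T *m D s w) ord0 ord0) =
      (v^T *m D t w) ord0 ord0}.
    by apply: filterS psi0 => w e; rewrite /g /D e (mulmxBr y^T) mx11D mx11N addrC subrK.
  split.
    move: cs; rewrite Ps addrC subrK => cs; exact: char_gauss_ae cs mDt eq_ae.
  have a1 : adapted (completion P E) (fun w => g w + ((v^T *m D t w) ord0 ord0 - (y^T *m D s w) ord0 ord0)).
    apply/sigma_adaptedP => //; apply: measurable_funD; apply/sigma_adaptedP => //.
      by apply: adapted_sub aZ'; apply: completionS; exact: joint_sigma_left.
    by apply: adapted_sub ay; apply: completionS; exact: joint_sigma_right.
  move=> U mU; apply: completion_ae (a1 U mU) _ _.
    by rewrite -[X in measurable X]setTI; exact: mDt.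
  by apply: filterS eq_ae => w /= ->.
have aD : vadapted (completion P E) (D t).
  apply/sigma_vadaptedP => // i; have [_] := gap (delta_mx i ord0).
  by congr adapted; apply/funext => w; rewrite trmx_delta -rowE mxE.
have FE1 : sigma_proc `[s, t] Y `<=` completion P E1 := observation_sigma_sub hXY s0.
have sF : sigma_algebra setT (sigma_proc `[s, t] Y) by exact: smallest_sigma_algebra.
have mF : sigma_proc `[s, t] Y `<=` measurable.
  by move=> B /FE1 /completion_measurable.
(* The observations lie in the completion generated by [X 0] and [WV], the gap in the completion
   generated by [Z s] and [B']; independence of the two copies passes to completions. *)
have iFE : indep P (completion P (sigma_proc `[s, t] Y)) (completion P E).
  move=> B1 B2 h1 h2; apply: (completion_indep mE1 mE iXZ) => //.
  by apply: completion_idem; exact: completionS h1.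
have apsi := filter_adapted (ltW st) cK mY psi0 hpsi.
apply: (cond_law_sum sF mF iFE apsi aD (@completion_measurable _ _ _ P E)).
- by apply: rvec_mulmx; exact: rvec_gauss_step hB 0.
- apply: (@char_gauss_law _ _ _ P _ W r _ _ (Pf t)).
  + by apply: mD; exact: ltW.
  + by apply: rvec_mulmx; exact: rvec_gauss_step hB 0.
  + by move=> u; case: (gap u).
  + by move=> u; exact: (gauss_step_char hB u pPt).
- rewrite (_ : (fun w => _) = Z t)//; apply/funext => w.
  by rewrite /D addrC subrK.
Qed.

End FilterLaw.

(** * Moments and couplings *)

Section PowerInequalities.
Context {R : realType}.

(** Convexity of the power in tangent form; the induction step leaves the gap [n y^(n-1) (x - y)^2].
    At [n = 0] the factor [n%:R] neutralises the predecessor. *)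
Lemma tangent_expr (x y : R) n : 0 <= x -> 0 <= y ->
  y ^+ n + n%:R * y ^+ n.-1 * (x - y) <= x ^+ n.
Proof.
move=> x0 y0; elim: n => [|n IH]; first by rewrite !expr0 mul0r mul0r addr0.
rewrite exprS [leRHS]exprS /= -natr1.
have h1 : x * (y ^+ n + n%:R * y ^+ n.-1 * (x - y)) <= x * x ^+ n by rewrite ler_wpM2l.
apply: le_trans h1; rewrite -subr_ge0.
have -> : x * (y ^+ n + n%:R * y ^+ n.-1 * (x - y)) - (y * y ^+ n + (n%:R + 1) * y ^+ n * (x - y)) =
  n%:R * (y ^+ n.-1 * (x - y) * x - y ^+ n * (x - y)) by ring.
case: n IH => [|n] IH; first by rewrite mul0r.
rewrite mulr_ge0//.
rewrite [X in 0 <= X](_ : _ = y ^+ n * (x - y) ^+ 2); last by rewrite exprS /=; ring.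
by apply: mulr_ge0; [exact: exprn_ge0|exact: sqr_ge0].
Qed.

Lemma expr_convex (l z : R) n : 0 <= l <= 1 -> 0 <= z ->
  (l + (1 - l) * z) ^+ n <= l + (1 - l) * z ^+ n.
Proof.
move=> /andP[l0 l1] z0; set y := l + (1 - l) * z.
have y0 : 0 <= y by rewrite addr_ge0// mulr_ge0// subr_ge0.
have h1 := tangent_expr n (ler01 : 0 <= 1) y0; rewrite expr1n in h1.
have h2 := tangent_expr n z0 y0.
have h3 := lerD (ler_wpM2l l0 h1) (ler_wpM2l (_ : 0 <= 1 - l) h2).
rewrite mulr1 in h3; apply: le_trans (h3 _); last by rewrite subr_ge0.
rewrite le_eqVlt; apply/orP; left; apply/eqP.
by set a := n%:R * y ^+ n.-1; rewrite /y; ring.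
Qed.

(* The convexity bound behind Minkowski's inequality: integrating it at a variable y
   with E y^n <= M^n gives E (a + k y)^n <= (a + k M)^n. *)
Lemma expr_affine_le (a k M : R) n : 0 <= a -> 0 <= k -> 0 < M ->
  exists c d : R, [/\ 0 <= c, 0 <= d,
    forall y, 0 <= y -> (a + k * y) ^+ n <= c + d * y ^+ n &
    c + d * M ^+ n = (a + k * M) ^+ n].
Proof.
move=> a0 k0 M0; pose L := a + k * M.
have kM0 : 0 <= k * M by rewrite mulr_ge0// ltW.
have L0 : 0 <= L by rewrite addr_ge0.
have [LE|Ln] := eqVneq L 0.
  have a_0 : a = 0 by move: LE; rewrite /L; lra.
  have k_0 : k = 0.
    by move/eqP : LE; rewrite /L a_0 add0r mulf_eq0 (gt_eqF M0) orbF => /eqP.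
  exists (0 ^+ n), 0; split => //.
  - by move=> y _; rewrite a_0 k_0 !mul0r !addr0.
  - by rewrite a_0 k_0 !mul0r !addr0.
have Lp : 0 < L by rewrite lt_def Ln.
have l01 : 0 <= a / L <= 1.
  by rewrite divr_ge0//= ler_pdivrMr// mul1r lerDl.
have l1 : 1 - a / L = k * M / L by rewrite /L; field; rewrite gt_eqF.
(* With weights [a / L] and [k M / L] the argument is [L] times a convex combination of 1 and
   [y / M]; [c] and [d] are what convexity of the power then leaves. *)
exists (L ^+ n * (a / L)), (L ^+ n * (k * M / L) / M ^+ n); split.
- by rewrite mulr_ge0 ?exprn_ge0// divr_ge0.
- by rewrite divr_ge0 ?exprn_ge0 ?(ltW M0)// mulr_ge0 ?exprn_ge0// divr_ge0.
- move=> y y0; have yM : 0 <= y / M by rewrite divr_ge0// ltW.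
  have := expr_convex n l01 yM; rewrite l1 => h.
  have -> : a + k * y = L * (a / L + k * M / L * (y / M)).
    by field; rewrite Ln gt_eqF.
  rewrite exprMn; apply: le_trans (ler_wpM2l (exprn_ge0 n L0) h) _.
  rewrite expr_div_n le_eqVlt; apply/orP; left; apply/eqP; ring.
- rewrite divfK ?expf_neq0 ?gt_eqF// -mulrDr -mulrDl -/L divff// mulr1//.
Qed.

(** The tangent inequality at the mean [p], where the linear terms sum to 0. *)
Lemma sum_expr_le r (x : 'I_r -> R) n : (forall i, 0 <= x i) ->
  (\sum_i x i) ^+ n.+1 <= r%:R ^+ n * \sum_i x i ^+ n.+1.
Proof.
case: r x => [|r] x x0; first by rewrite !big_ord0 expr0n mulr0.
pose p := (\sum_i x i) / r.+1%:R.
have r0 : 0 < r.+1%:R :> R by rewrite ltr0n.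
have p0 : 0 <= p by rewrite divr_ge0 ?sumr_ge0// ltW.
have sE : \sum_i x i = r.+1%:R * p by rewrite /p mulrC divfK// gt_eqF.
have h : \sum_i (p ^+ n.+1 + n.+1%:R * p ^+ n * (x i - p)) <= \sum_i x i ^+ n.+1.
  by apply: ler_sum => i _; exact: (tangent_expr n.+1 (x0 i) p0).
have e : \sum_i (p ^+ n.+1 + n.+1%:R * p ^+ n * (x i - p)) = r.+1%:R * p ^+ n.+1.
  rewrite big_split/= -mulr_sumr sumrB sE !sumr_const card_ord -[p *+ _]mulr_natl subrr mulr0 addr0.
  by rewrite mulr_natl.
rewrite e in h; rewrite sE exprMn exprSr -mulrA ler_wpM2l// exprn_ge0// ltW.
Qed.

Lemma fact_le_exp n : (n`! <= n ^ n)%N.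
Proof.
elim: n => // n IH; rewrite factS expnS leq_mul2l /=.
by case: n IH => [|n] IH //; rewrite (leq_trans IH)// leq_exp2r ?leqnSn.
Qed.

Lemma expR1_ge2 : 2 <= expR 1 :> R.
Proof. by have := @expR_ge1Dx R 1; rewrite -natr1 addrC. Qed.

(** Since [2 n (1/2 + 3/(4 n)) = n + 3/2], the right side is [(2 r n)^n e^n e^(3/2)]. The comparison
    reduces to [n! <= n^n], [2 <= e] and [sqrt 2 <= e^(3/2)]. *)
Lemma gaussian_moment_constant (r n : nat) : (0 < n)%N ->
  r%:R ^+ n * (Num.sqrt 2 * 4 ^+ n * n`!%:R) <=
  (2 * (Num.sqrt (r%:R * n%:R / 2) * expR (1 / 2 + 3 / (4 * n%:R)))) ^+ (2 * n) :> R.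
Proof.
move=> n0; have n0R : n%:R != 0 :> R by rewrite pnatr_eq0 -lt0n.
have -> : (2 * (Num.sqrt (r%:R * n%:R / 2) * expR (1 / 2 + 3 / (4 * n%:R)))) ^+ (2 * n) =
    (4 * (r%:R * n%:R / 2) * expR (1 + 3 / (2 * n%:R))) ^+ n :> R.
  rewrite exprM; congr (_ ^+ _).
  rewrite exprMn exprMn sqr_sqrtr; last by rewrite divr_ge0// mulr_ge0.
  rewrite -expRM_natl mulrA; congr (_ * _ * expR _); first by ring.
  by field.
rewrite !exprMn exprVn -expRM_natl.
have -> : n%:R * (1 + 3 / (2 * n%:R)) = n%:R * 1 + 3 / 2 :> R by field.
rewrite expRD expRM_natl.
have h2 : Num.sqrt 2 <= expR (3 / 2) :> R.
  apply: le_trans (_ : Num.sqrt (2 ^+ 2) <= _); first by rewrite ler_sqrt//; lra.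
  rewrite sqrtr_sqr ger0_norm//; apply: le_trans expR1_ge2 _.
  by rewrite ler_expR; lra.
have h3 : n`!%:R <= n%:R ^+ n :> R by rewrite -natrX ler_nat fact_le_exp.
have h4 : 2 ^+ n <= expR 1 ^+ n :> R by apply: lerXn2r; rewrite ?nnegrE ?expR_ge0// expR1_ge2.
set f := n`!%:R in h3 *; set N := n%:R ^+ n in h3 *; set e := expR 1 ^+ n in h4 *.
set q := Num.sqrt 2 in h2 *; set e' := expR (3/2) in h2 *.
have t0 : 0 < (2 : R) ^+ n by rewrite exprn_gt0.
have N0 : 0 <= N by rewrite exprn_ge0.
have f0 : 0 <= f by rewrite ler0n.
have q0 : 0 <= q by exact: sqrtr_ge0.
have h5 : q * f <= e' * N by exact: ler_pM.
have h6 : e' * N <= e' * N * (e / 2 ^+ n).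
  by rewrite ler_peMr ?mulr_ge0 ?expR_ge0// ler_pdivlMr// mul1r.
have := le_trans h5 h6; move: (r%:R ^+ n) (exprn_ge0 n (ler0n R r)) => a a0 h7.
have h8 : a * 4 ^+ n * (q * f) <= a * 4 ^+ n * (e' * N * (e / 2 ^+ n)).
  by rewrite ler_wpM2l// mulr_ge0// exprn_ge0.
apply: le_trans (_ : a * 4 ^+ n * (q * f) <= _).
  by rewrite le_eqVlt; apply/orP; left; apply/eqP; ring.
apply: le_trans h8 _; rewrite le_eqVlt; apply/orP; left; apply/eqP; ring.
Qed.

End PowerInequalities.

(** * Wasserstein bounds from random vectors with prescribed laws *)

Section Couplings.
Context {R : realType} {disp : measure_display} {T : measurableType disp}.
Variable P : probability T R.

Lemma measurable_norm2_diff d n :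
  measurable_fun setT (fun z : bvec R d * bvec R d => (norm2 ((z.1 : 'cV[R]_d) - (z.2 : 'cV[R]_d)) ^+ n)%:E).
Proof.
apply/measurable_EFinP; apply: measurable_funX.
have m1 : rvec (fun z : bvec R d * bvec R d => (z.1 : 'cV[R]_d)) by exact: measurable_fst.
have m2 : rvec (fun z : bvec R d * bvec R d => (z.2 : 'cV[R]_d)) by exact: measurable_snd.
exact: rvec_norm2 (rvecB m1 m2).
Qed.

Lemma wasserstein_ge0 d n (nu1 nu2 : probability (bvec R d) R) : (0 <= wasserstein n nu1 nu2)%E.
Proof. by apply: le_ereal_inf_tmp => _ [g _ <-]; exact: poweR_ge0. Qed.

Lemma wasserstein_le d n (nu1 nu2 : probability (bvec R d) R) (Z1 Z2 : T -> 'cV[R]_d) (L : R) :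
  rvec Z1 -> rvec Z2 ->
  (forall U : set (bvec R d), measurable U -> nu1 U = P (Z1 @^-1` U)) ->
  (forall U : set (bvec R d), measurable U -> nu2 U = P (Z2 @^-1` U)) ->
  (0 < n)%N -> 0 <= L ->
  (\int[P]_w (norm2 (Z1 w - Z2 w) ^+ n)%:E <= (L ^+ n)%:E)%E ->
  (wasserstein n nu1 nu2 <= L%:E)%E.
Proof.
move=> m1 m2 h1 h2 n0 L0 hL.
have mZ : measurable_fun setT (fun w => (Z1 w, Z2 w) : bvec R d * bvec R d).
  exact: measurable_fun_pair.
pose Z' : {mfun T >-> (bvec R d * bvec R d)%type} := mfun_Sub (mem_set mZ).
pose g : probability (bvec R d * bvec R d)%type R := distribution P Z'.
have cg : coupling nu1 nu2 g.
  move=> U mU; rewrite h1// h2//; split; congr (P _); apply/seteqP; split=> w //=.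
  - by case.
  - by case.
have : (wasserstein n nu1 nu2 <= (\int[g]_z
     ((norm2 ((z.1 : 'cV[R]_d) - (z.2 : 'cV[R]_d)) ^+ n)%:E)) `^ n%:R^-1)%E.
  by apply: ereal_inf_lbound; exists g.
move/le_trans; apply.
rewrite -(@integral_law _ _ _ P _ _ (fun w => (Z1 w, Z2 w) : bvec R d * bvec R d) g
  (fun z => (norm2 ((z.1 : 'cV[R]_d) - (z.2 : 'cV[R]_d)) ^+ n)%:E))//=; last 2 first.
- exact: measurable_norm2_diff.
- by move=> y; rewrite lee_fin exprn_ge0// norm2_ge0.
have : (0 <= \int[P]_w (norm2 (Z1 w - Z2 w) ^+ n)%:E)%E.
  by apply: integral_ge0 => w _; rewrite lee_fin exprn_ge0// norm2_ge0.
move: hL; case: (\int[P]_w _)%E => [i| |]//=; rewrite !lee_fin => iL i0.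
have nR : n%:R != 0 :> R by rewrite pnatr_eq0 -lt0n.
apply: (@le_trans _ _ ((L ^+ n) `^ n%:R^-1)).
  by apply: ge0_ler_powR; rewrite ?invr_ge0 ?nnegrE// exprn_ge0.
by rewrite -powR_mulrn// -powRrM mulfV// powRr1.
Qed.

End Couplings.

(** * Explicit couplings of two Gaussian laws *)

Section GaussianCouplings.
Context {R : realType} {disp : measure_display} {T : measurableType disp}.
Variable P : probability T R.
Context {r0 p : nat}.
Let r := r0.+1.
Variable WV : R -> T -> 'cV[R]_(r + p).
Hypothesis hB : brownian P WV.

(** Adding the integrals for [Y] and [- Y], equal by symmetry, cancels the linear term pointwise, so
    only integrals of nonnegative functions occur. *)
Lemma gauss_law_sqr_shift (Y : T -> R) (c v : R) : 0 <= v -> gauss_law P Y 0 v ->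
  gauss_law P (fun w => - Y w) 0 v -> (\int[P]_w ((c + Y w) ^+ 2)%:E <= (c ^+ 2 + v)%:E)%E.
Proof.
move=> v0 gY gN; have [mY _] := gY; have [mN _] := gN.
have mh : measurable_fun setT (fun y : R => ((c + y) ^+ 2)%:E).
  apply/measurable_EFinP; exact/measurable_funX/measurable_funD.
have h0 (y : R) : (0 <= ((c + y) ^+ 2)%:E)%E by rewrite lee_fin sqr_ge0.
have E := same_law_integral mY mN (gauss_law_same gY gN) mh h0.
have m1 : measurable_fun setT (fun w => ((c + Y w) ^+ 2)%:E) by exact: (measurableT_comp mh mY).
have m2 : measurable_fun setT (fun w => ((c + - Y w) ^+ 2)%:E) by exact: (measurableT_comp mh mN).
have mY2 : measurable_fun setT (fun w => (Y w ^+ 2)%:E).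
  by apply/measurable_EFinP; exact: measurable_funX.
have S2 : ((\int[P]_w ((c + Y w) ^+ 2)%:E + \int[P]_w ((c + Y w) ^+ 2)%:E) <= (2 * (c ^+ 2 + v))%:E)%E.
  rewrite [X in (_ + X)%E]E -ge0_integralD//.
  rewrite (_ : (fun w => _) = (fun w => ((2 * c ^+ 2)%:E + (2 : R)%:E * (Y w ^+ 2)%:E)%E)); last first.
    by apply/funext => w; rewrite -EFinM -!EFinD; congr EFin; ring.
  rewrite ge0_integralD//; last 3 first.
  - by move=> w _; rewrite lee_fin mulr_ge0// sqr_ge0.
  - by move=> w _; rewrite -EFinM lee_fin mulr_ge0// sqr_ge0.
  - by apply: emeasurable_funM => //; exact: measurable_cst.
  rewrite integral_prob_cst ge0_integralZl//; last by move=> w _; rewrite lee_fin sqr_ge0.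
  rewrite [leRHS](_ : _ = ((2 * c ^+ 2)%:E + (2 : R)%:E * v%:E)%E); last first.
    by rewrite -EFinM -EFinD mulrDr.
  rewrite leeD2l// lee_pmul2l ?lte_fin//.
  exact: gauss_law_sqr.
have : (0 <= \int[P]_w ((c + Y w) ^+ 2)%:E)%E by apply: integral_ge0 => w _; exact: h0.
move: S2; case: (\int[P]_w _)%E => [i| |]//=.
by rewrite -EFinD !lee_fin => h _; lra.
Qed.

(** The coordinates of [sqrtmx N *m xi] are centred Gaussian with the diagonal entries of [N] as
    variances, whence the trace. *)
Lemma integral_norm2_shift (m : 'cV[R]_r) (N : 'M[R]_r) k : psd N ->
  (\int[P]_w (norm2 (m + sqrtmx N *m gauss_step WV k w) ^+ 2)%:E <= (norm2 m ^+ 2 + \tr N)%:E)%E.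
Proof.
move=> pN; pose Y (i : 'I_r) w := (sqrtmx N *m gauss_step WV k w) i ord0.
have pS := psd_sqrtmx pN; have [sS _] := pS.
have YE (e : 'cV[R]_r) w : ((sqrtmx N *m e)^T *m gauss_step WV k w) ord0 ord0 = (e^T *m (sqrtmx N *m gauss_step WV k w)) ord0 ord0.
  by rewrite trmx_mul sS mulmxA.
have nE (e : 'cV[R]_r) : norm2 (sqrtmx N *m e) ^+ 2 = quadform N e.
  by rewrite -quadform_sqr// sqr_sqrtmx.
have dE i (v : 'cV[R]_r) : ((delta_mx i ord0 : 'cV[R]_r)^T *m v) ord0 ord0 = v i ord0.
  by rewrite trmx_delta -rowE mxE.
have qE i : quadform N (delta_mx i ord0) = N i i.
  by rewrite quadformE dE -colE mxE.
have g1 i : gauss_law P (Y i) 0 (N i i).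
  have := gauss_step_law hB k (sqrtmx N *m delta_mx i ord0); rewrite nE qE.
  by under eq_fun do rewrite YE dE.
have g2 i : gauss_law P (fun w => - Y i w) 0 (N i i).
  have := gauss_step_law hB k (- (sqrtmx N *m delta_mx i ord0)); rewrite norm2N nE qE.
  by under eq_fun do rewrite trmxN mulNmx mx11N YE dE.
have N0 i : 0 <= N i i by rewrite -qE; case: pN.
have mY i : measurable_fun setT (Y i) by case: (g1 i).
rewrite (_ : (fun w => _) = (fun w => \sum_i ((m i ord0 + Y i w) ^+ 2)%:E)%E); last first.
  by apply/funext => w; rewrite sqr_norm2 sumEFin; congr EFin; apply: eq_bigr => i _; rewrite [X in X ^+ 2]mxE.
rewrite ge0_integral_sum//; last 2 first.
- move=> i; apply/measurable_EFinP; exact/measurable_funX/measurable_funD.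
- by move=> i w _; rewrite lee_fin sqr_ge0.
rewrite sqr_norm2 /mxtrace -big_split/= -sumEFin; apply: lee_sum => i _.
exact: gauss_law_sqr_shift.
Qed.

(** The power mean inequality over the coordinates, each with the one-dimensional bound: [r^(n-1)]
    times [r] equal terms. *)
Lemma integral_norm2_moment n : (0 < n)%N ->
  (\int[P]_w (norm2 (gauss_step WV 0 w) ^+ (2 * n))%:E <= (r%:R ^+ n * (Num.sqrt 2 * 4 ^+ n * n`!%:R))%:E)%E.
Proof.
case: n => // n _; pose Y (i : 'I_r) w := gauss_step WV 0 w i ord0.
have dE i (v : 'cV[R]_r) : ((delta_mx i ord0 : 'cV[R]_r)^T *m v) ord0 ord0 = v i ord0.
  by rewrite trmx_delta -rowE mxE.
have g1 i : gauss_law P (Y i) 0 1.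
  have := gauss_step_law hB 0 (delta_mx i ord0 : 'cV[R]_r).
  rewrite sqr_norm2_dot dE mxE !eqxx.
  by under eq_fun do rewrite dE.
have mY i : measurable_fun setT (Y i) by case: (g1 i).
have mYn i : measurable_fun setT (fun w => (Y i w ^+ (2 * n.+1))%:E).
  by apply/measurable_EFinP; exact: measurable_funX.
have Yn0 i w : (0 <= (Y i w ^+ (2 * n.+1))%:E)%E by rewrite lee_fin exprM exprn_ge0// sqr_ge0.
have rn0 : 0 <= r%:R ^+ n :> R by rewrite exprn_ge0.
apply: (@le_trans _ _ (\int[P]_w ((r%:R ^+ n)%:E * \sum_i (Y i w ^+ (2 * n.+1))%:E))%E).
  apply: ge0_le_integral => //.
  - by move=> w _; rewrite lee_fin exprn_ge0// norm2_ge0.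
  - by apply/measurable_EFinP; apply: measurable_funX; apply: rvec_norm2; exact: rvec_gauss_step hB 0.
  - apply: emeasurable_funM; first exact: measurable_cst.
    by apply: emeasurable_sum => i.
  - move=> w _; rewrite sumEFin -EFinM lee_fin exprM sqr_norm2.
    under [X in _ <= _ * X]eq_bigr do rewrite exprM.
    by apply: sum_expr_le => i; exact: sqr_ge0.
have ms : measurable_fun setT (fun w => \sum_i (Y i w ^+ (2 * n.+1))%:E)%E by exact: emeasurable_sum.
have s0 w : setT w -> (0 <= \sum_i (Y i w ^+ (2 * n.+1))%:E)%E by move=> _; apply: sume_ge0.
rewrite (ge0_integralZl P measurableT ms s0) ?lee_fin//.
rewrite ge0_integral_sum//.
have hi i : (\int[P]_w (Y i w ^+ (2 * n.+1))%:E <= (Num.sqrt 2 * 4 ^+ n.+1 * (n.+1)`!%:R)%:E)%E.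
  by have := gauss_law_moment n.+1 ler01 (g1 i); rewrite mulr1.
apply: (@le_trans _ _ ((r%:R ^+ n)%:E * \sum_(i < r) (Num.sqrt 2 * 4 ^+ n.+1 * (n.+1)`!%:R)%:E)%E).
  by rewrite lee_wpmul2l ?lee_fin//; apply: lee_sum => i _; exact: hi.
rewrite sumEFin -EFinM lee_fin sumr_const card_ord -[X in _ * X <= _]mulr_natl.
by rewrite [r%:R ^+ n.+1]exprSr -!mulrA.
Qed.

Lemma wasserstein2_gaussian (nu1 nu2 : probability (bvec R r) R) (m1 m2 : 'cV[R]_r) (M N : 'M[R]_r) :
  psd M -> psd N ->
  (forall U : set (bvec R r), measurable U ->
    nu1 U = P [set w | U (m1 + sqrtmx (M + N) *m gauss_step WV 0 w)]) ->
  (forall U : set (bvec R r), measurable U ->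
    nu2 U = P [set w | U (m2 + sqrtmx M *m gauss_step WV 0 w)]) ->
  (wasserstein 2 nu1 nu2 ^+ 2 <= (norm2 (m1 - m2) ^+ 2 + \tr N)%:E)%E.
Proof.
move=> pM pN h1 h2; pose xi := gauss_step WV 0; pose xi2 := gauss_step WV 1.
have mxi k : rvec (gauss_step WV k) by exact: rvec_gauss_step hB k.
have pMN := psdD pM pN.
pose Y1 w := sqrtmx M *m xi w + sqrtmx N *m xi2 w.
have mY1 : rvec Y1 by apply: rvecD; apply: rvec_mulmx; exact: mxi.
have mY2 : rvec (fun w => sqrtmx (M + N) *m xi w) by apply: rvec_mulmx; exact: mxi.
(* The law of [sqrtmx (M + N) *m xi] is determined by [M + N], so it may be realised as a sum of two
   independent parts, of which the first is shared with [Z2]. *)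
have lawY := char_gauss_law mY2 mY1 (fun u => gauss_step_char hB u pMN) (fun u => gauss_step_char2 hB u pM pN).
pose Z1 w := m1 + Y1 w; pose Z2 w := m2 + sqrtmx M *m xi w.
have mZ1 : rvec Z1 by apply: rvecD => //; exact: rvec_cst.
have mZ2 : rvec Z2 by apply: rvecD; [exact: rvec_cst|apply: rvec_mulmx; exact: mxi].
have n1 (U : set (bvec R r)) : measurable U -> nu1 U = P (Z1 @^-1` U).
  move=> mU; rewrite h1//.
  have mV : measurable ([set y : 'cV[R]_r | U (m1 + y)] : set (bvec R r)).
    have : measurable_fun setT (fun y : bvec R r => (m1 + (y : 'cV[R]_r)) : bvec R r).
      apply: measurable_fun_bvec => i; under eq_fun do rewrite mxE.
      by apply: measurable_funD; [exact: measurable_cst|exact: measurable_bvec_coord].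
    by move=> /(_ measurableT U mU); rewrite setTI.
  exact: lawY mV.
have tN : 0 <= \tr N.
  apply: sumr_ge0 => i _; have [_ /(_ (delta_mx i ord0))] := pN.
  by rewrite quadformE trmx_delta -rowE -colE !mxE.
have B0 : 0 <= norm2 (m1 - m2) ^+ 2 + \tr N by rewrite addr_ge0// sqr_ge0.
have := @wasserstein_le _ _ _ P r 2 nu1 nu2 Z1 Z2 (Num.sqrt (norm2 (m1 - m2) ^+ 2 + \tr N))
  mZ1 mZ2 n1 h2 isT (sqrtr_ge0 _).
rewrite sqr_sqrtr//.
have -> : (\int[P]_w (norm2 (Z1 w - Z2 w) ^+ 2)%:E = \int[P]_w (norm2 ((m1 - m2) + sqrtmx N *m xi2 w) ^+ 2)%:E)%E.
  apply: eq_integral => w _; congr (norm2 _ ^+ _)%:E.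
  by rewrite /Z1 /Z2 /Y1 opprD addrACA; congr (_ + _); rewrite addrAC subrr add0r.
move=> /(_ (integral_norm2_shift _ _ pN)).
have := wasserstein_ge0 2 nu1 nu2; case: (wasserstein 2 nu1 nu2) => [z| |]//=.
rewrite -EFinM -expr2 !lee_fin => z0 zB.
by rewrite -[leRHS]sqr_sqrtr// ler_sqr ?nnegrE ?sqrtr_ge0.
Qed.

Lemma wasserstein_even_gaussian (nu1 nu2 : probability (bvec R r) R) (m1 m2 : 'cV[R]_r)
    (M N : 'M[R]_r) (b : R) n :
  (0 < n)%N -> 0 < b -> psd M -> psd N -> b^-1%:M <=L M -> b^-1%:M <=L N ->
  (forall U : set (bvec R r), measurable U ->
    nu1 U = P [set w | U (m1 + sqrtmx M *m gauss_step WV 0 w)]) ->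
  (forall U : set (bvec R r), measurable U ->
    nu2 U = P [set w | U (m2 + sqrtmx N *m gauss_step WV 0 w)]) ->
  (wasserstein (2 * n) nu1 nu2 <= (norm2 (m1 - m2) + Num.sqrt (r%:R * n%:R / 2) * Num.sqrt b
     * opnorm2 (M - N) * expR (1 / 2 + 3 / (4 * n%:R)))%:E)%E.
Proof.
move=> n0 b0 pM pN lM lN h1 h2; pose xi := gauss_step WV 0.
have mxi : rvec xi by exact: rvec_gauss_step hB 0.
pose Z1 w := m1 + sqrtmx M *m xi w; pose Z2 w := m2 + sqrtmx N *m xi w.
have mZ1 : rvec Z1 by apply: rvecD; [exact: rvec_cst|exact: rvec_mulmx].
have mZ2 : rvec Z2 by apply: rvecD; [exact: rvec_cst|exact: rvec_mulmx].
pose c := (Num.sqrt b)^-1; have sb0 : 0 < Num.sqrt b by rewrite sqrtr_gt0.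
have c0 : 0 < c by rewrite invr_gt0.
have c2 : c ^+ 2 = b^-1 by rewrite exprVn sqr_sqrtr// ltW.
(* The Lipschitz constant [1 / (2 c)] of the square root above [c ^+ 2 = b^-1], times the norm of
   [M - N]. *)
pose k := opnorm2 (M - N) * Num.sqrt b / 2.
have k0 : 0 <= k by rewrite divr_ge0// mulr_ge0 ?opnorm2_ge0// ltW.
have lip v : norm2 ((sqrtmx M - sqrtmx N) *m v) <= k * norm2 v.
  have := @sqrt_lipschitz R r (sqrtmx N) (sqrtmx M) c v c0 (psd_sqrtmx pN) (psd_sqrtmx pM).
  rewrite !sqr_sqrtmx// c2 => /(_ lN lM) /le_trans; apply.
  by rewrite le_eqVlt; apply/orP; left; apply/eqP; rewrite /k /c; field; rewrite gt_eqF.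
(* [2 * E] will bound the [2n]-th root of the moment of [norm2 (xi w)]; its factor 2 cancels the 1/2
   in [k]. *)
pose E := Num.sqrt (r%:R * n%:R / 2) * expR (1 / 2 + 3 / (4 * n%:R)) : R.
pose K := 2 * E.
have K0 : 0 < K.
  by rewrite /K /E !mulr_gt0 ?expR_gt0// sqrtr_gt0 divr_gt0// mulr_gt0 ?ltr0n.
have a0 := norm2_ge0 (m1 - m2).
have LE : norm2 (m1 - m2) + k * K = norm2 (m1 - m2) + Num.sqrt (r%:R * n%:R / 2) * Num.sqrt b
     * opnorm2 (M - N) * expR (1 / 2 + 3 / (4 * n%:R)).
  by rewrite /k /K /E; field.
rewrite -LE; apply: (@wasserstein_le _ _ _ P r (2 * n) nu1 nu2 Z1 Z2) => //.
- by rewrite muln_gt0.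
- by rewrite addr_ge0// mulr_ge0// ltW.
have [x [y [x0 y0 hxy hK]]] := expr_affine_le (2 * n) a0 k0 K0.
have mxn : measurable_fun setT (fun w => (norm2 (xi w) ^+ (2 * n))%:E).
  by apply/measurable_EFinP; apply: measurable_funX; exact: rvec_norm2.
have xn0 w : (0 <= (norm2 (xi w) ^+ (2 * n))%:E)%E by rewrite lee_fin exprn_ge0// norm2_ge0.
apply: (@le_trans _ _ (\int[P]_w (x%:E + y%:E * (norm2 (xi w) ^+ (2 * n))%:E))%E).
  apply: ge0_le_integral => //.
  - by move=> w _; rewrite lee_fin exprn_ge0// norm2_ge0.
  - by apply/measurable_EFinP; apply: measurable_funX; apply: rvec_norm2; exact: rvecB.
  - apply: emeasurable_funD; first exact: measurable_cst.
    by apply: emeasurable_funM => //; exact: measurable_cst.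
  - move=> w _; rewrite -EFinM -EFinD lee_fin; apply: le_trans (hxy _ (norm2_ge0 _)).
    apply: lerXn2r; rewrite ?nnegrE ?norm2_ge0//.
      by rewrite addr_ge0// mulr_ge0// norm2_ge0.
    have -> : Z1 w - Z2 w = (m1 - m2) + (sqrtmx M - sqrtmx N) *m xi w.
      by rewrite /Z1 /Z2 mulmxBl opprD addrACA.
    by apply: le_trans (ler_norm2D _ _) _; rewrite lerD2l.
rewrite ge0_integralD//; last 2 first.
- by move=> w _; rewrite mule_ge0// lee_fin.
- by apply: emeasurable_funM => //; exact: measurable_cst.
rewrite integral_prob_cst ge0_integralZl//.
rewrite -hK EFinD leeD2l// EFinM lee_wpmul2l ?lee_fin//.
apply: le_trans (integral_norm2_moment n0) _; rewrite lee_fin.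
exact: gaussian_moment_constant.
Qed.

End GaussianCouplings.

(** * Riccati flows and the theorem *)

Section Flows.
Context {R : realType} {r : nat}.
Variables (A S Rm : 'M[R]_r).
Hypotheses (pS : psd S) (pR : psd Rm).

Lemma ode_sol_mxcont F Q (f : R -> 'M[R]_r) (a b : R) : 0 <= a -> ode_sol F Q f -> mxcont a b f.
Proof.
move=> a0 [_ _ cf _]; apply: mxcont_within; apply: continuous_subspaceW cf => u /=.
by rewrite !in_itv/= andbT => /andP[au _]; exact: le_trans au.
Qed.

Lemma ode_sol_mxder F Q (f : R -> 'M[R]_r) (t : R) : 0 < t -> ode_sol F Q f -> mxder f t (F (f t)).
Proof. by move=> t0 [_ _ _ h]; apply: mxder_is_derive; exact: h. Qed.

Lemma ricc_lyapunov P : symmx P ->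
  ricc A S Rm P = (A - P *m S) *m P + P *m (A - P *m S)^T + (Rm + P *m S *m P).
Proof.
move=> sP; have [sS _] := pS; rewrite /ricc trmxD trmxN trmx_mul sP sS mulmxBl mulmxBr !mulmxA.
move: (A *m P) (P *m A^T) (P *m S *m P) => x y z; apply/matrixP => i j; rewrite !mxE; ring.
Qed.

Lemma ricc_pi_lyapunov pi P :
  ricc_pi A S Rm pi P = (A - pi P *m S) *m P + P *m (A - pi P *m S)^T + (Rm + pi P *m S *m pi P).
Proof. by rewrite /ricc_pi addrA. Qed.

(** The drift at the midpoint linearises the quadratic term exactly: [P' S P' - P S P] is half of
    [(P + P') S (P' - P) + (P' - P) S (P + P')]. Hence the only source left is [Gamma_pi]. *)
Lemma ricc_pi_gap pi P P' : symmx (pi P') -> symmx P -> symmx P' ->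
  ricc_pi A S Rm pi P' - ricc A S Rm P =
  (A - 2^-1 *: ((P + P') *m S)) *m (P' - P) + (P' - P) *m (A - 2^-1 *: ((P + P') *m S))^T
  + Gamma_pi S pi P'.
Proof.
move=> spi sP sP'; have [sS _] := pS.
have e : (2^-1 *: ((P + P') *m S))^T = 2^-1 *: (S *m (P + P')).
  by rewrite linearZ/= trmx_mul trmxD sS sP sP'.
rewrite /ricc_pi /ricc /Gamma_pi !(trmxD, trmxN) e trmx_mul sS spi.
rewrite !(mulmxDl, mulmxDr, mulmxBl, mulmxBr, mulNmx, mulmxN) -!(scalemxAl, scalemxAr).
rewrite !(mulmxDl, mulmxDr, mulmxBl, mulmxBr, mulNmx, mulmxN) !mulmxA.
move: (A *m P) (P *m A^T) (A *m P') (P' *m A^T) (P *m S *m P) (P' *m S *m P) (P *m S *m P') (P' *m S *m P').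
move: (pi P' *m S *m P') (P' *m S *m pi P') (pi P' *m S *m pi P') => a b c x1 x2 x3 x4 x5 x6 x7 x8.
by apply/matrixP => i j; rewrite !mxE; field.
Qed.

Lemma Gamma_pi_ge0 pi Q v : symmx (pi Q) -> symmx Q -> 0 <= quadform (Gamma_pi S pi Q) v.
Proof.
move=> spi sQ; have [_ S0] := pS.
have -> : Gamma_pi S pi Q = (pi Q - Q)^T *m S *m (pi Q - Q).
  by rewrite /Gamma_pi trmxD trmxN spi sQ.
by rewrite quadform_conj.
Qed.

Lemma psd_comparison pi Q (f g : R -> 'M[R]_r) (t : R) :
  (forall Q, psd Q -> psd (pi Q)) -> 0 <= t ->
  ode_sol (ricc A S Rm) Q f -> ode_sol (ricc_pi A S Rm pi) Q g -> psd (g t - f t).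
Proof.
move=> ppi t0 hf hg; have [f0 pf _ _] := hf; have [g0 pg _ _] := hg.
have sf u : 0 <= u -> symmx (f u) by move=> /pf[].
have sg u : 0 <= u -> symmx (g u) by move=> /pg[].
have spi u : 0 <= u -> symmx (pi (g u)) by move=> /pg /ppi[].
split; first by rewrite /symmx trmxD trmxN sf// sg.
move=> v; have cf : mxcont 0 t f := ode_sol_mxcont (lexx 0) hf.
have cg : mxcont 0 t g := ode_sol_mxcont (lexx 0) hg.
apply: (@lyapunov_quadform_ge0 R r 0 t (fun u => A - 2^-1 *: ((f u + g u) *m S)) (fun u => g u - f u)
  (fun u => Gamma_pi S pi (g u)) v t0).
- apply: mxcontB; first exact: mxcont_cst.
  have c2 : mxcont 0 t (fun u => (2^-1)%:M *m ((f u + g u) *m S)).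
    apply: mxcontM; first exact: mxcont_cst.
    by apply: mxcontM; [exact: mxcontD|exact: mxcont_cst].
  by move: c2; congr (mxcont _ _ _); apply/funext => u; rewrite mul_scalar_mx.
- exact: mxcontB.
- move=> u /andP[u0 _]; have u0' := ltW u0.
  have := mxderB (ode_sol_mxder u0 hg) (ode_sol_mxder u0 hf).
  by rewrite ricc_pi_gap//; [exact: spi|exact: sf|exact: sg].
- by move=> u w /andP[u0 _]; apply: Gamma_pi_ge0; [exact/spi/ltW|exact/sg/ltW].
- by move=> w; rewrite f0 g0 subrr /quadform mulmx0 mul0mx mxE.
Qed.

(** The bound at time [ups] is applied to the flow restarted at [t - ups]. It asks only that the
    value there be psd, so it is uniform in [Q] and in [t >= ups]. *)
Lemma riccati_flow_lower_bound Q (f : R -> 'M[R]_r) (ups wc woC t : R) :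
  0 < ups -> 0 < wc -> 0 < woC -> wc%:M <=L ctl_gram A Rm ups ->
  obs_gram_ctl A S Rm ups <=L woC%:M -> ode_sol (ricc A S Rm) Q f -> ups <= t ->
  ((woC + wc^-1)^-1)%:M <=L f t.
Proof.
move=> u0 wc0 wo0 hc ho hf ut; have [f0 pf _ _] := hf.
have t0 : 0 <= t by exact: le_trans (ltW u0) ut.
split; first by have [sf _] := pf t t0; rewrite /symmx trmxD trmxN tr_scalar_mx sf.
move=> v; rewrite quadformB quadform_scalar subr_ge0 mulrC.
have tu0 : 0 <= t - ups by rewrite subr_ge0.
have := @riccati_lower_bound R r A S Rm ups wc woC (fun u => f (t - ups + u)) v u0 wc0 wo0 pR pS hc ho.
rewrite subrK; apply.
- have cf : mxcont (t - ups) t f := ode_sol_mxcont tu0 hf.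
  have := @mxcont_translate _ _ _ _ _ _ (t - ups) cf.
  by rewrite subrr opprB addrC subrK.
- by rewrite addr0; exact: pf.
- move=> u /andP[h _]; have [] // := pf (t - ups + u).
  by rewrite addr_ge0// ltW.
- move=> u /andP[h _]; apply: mxder_shift; apply: ode_sol_mxder hf.
  by rewrite ltr_wpDl.
Qed.

(** [pi] is continuous only within [psd], but the solution never leaves [psd], so the composition is
    taken along the filter restricted to [psd]. *)
Lemma mxcont_gain pi F Q (f : R -> 'M[R]_r) (a b : R) : 0 <= a -> psd_map pi -> ode_sol F Q f ->
  mxcont a b (fun u => pi (f u)).
Proof.
move=> a0 [_ cpi] hf; have [_ pf cf _] := hf; apply: mxcont_within.
have cf' : {within `[a, b], continuous f}.
  apply: continuous_subspaceW cf => u /=.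
  by rewrite !in_itv/= andbT => /andP[au _]; exact: le_trans au.
apply/subspace_continuousP => u uab.
have u0 : 0 <= u by move: uab; rewrite /= in_itv/= => /andP[au _]; exact: le_trans au.
have /subspace_continuousP h1' := cf'; have h1 := h1' u uab.
have /subspace_continuousP h2' := cpi; have h2 := h2' (f u) (pf u u0).
apply: (@cvg_comp _ _ _ f pi (within `[a, b] (nbhs u)) (within psd (nbhs (f u)))) => //.
move=> B hB; have h3 : nbhs u [set y | `[a, b]%classic y -> psd (f y) -> B (f y)] := h1 _ hB.
apply: filterS h3 => y hy yab; apply: hy => //; apply: pf.
by move: yab; rewrite /= in_itv/= => /andP[ay _]; exact: le_trans ay.
Qed.

End Flows.

Theorem theorem3p5 (R : realType) (r r' : nat) (hr : (0 < r)%N) (hr' : (0 < r')%N)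
  (A : 'M[R]_r) (C : 'M[R]_(r', r)) (Rm : 'M[R]_r) (Sigma : 'M[R]_r')
  (S : 'M[R]_r)
  (hRm : posdef Rm) (hSigma : posdef Sigma)
  (hS : S = C^T *m invmx Sigma *m C)
  (hctl : controllable A (sqrtmx Rm)) (hobs : observable A C)
  (ups wc wo wcO woC : R)
  (hups : 0 < ups) (hwc : 0 < wc) (hwo : 0 < wo) (hwcO : 0 < wcO) (hwoC : 0 < woC)
  (hgc : wc%:M <=L ctl_gram A Rm ups)
  (hgo : wo%:M <=L obs_gram A S ups)
  (hgcO : ctl_gram_obs A S Rm ups <=L wcO%:M)
  (hgoC : obs_gram_ctl A S Rm ups <=L woC%:M)
  (phi : R -> 'M[R]_r -> 'M[R]_r)
  (hphi : is_flow (ricc A S Rm) phi)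
  (Pi : set ('M[R]_r -> 'M[R]_r))
  (hPi : forall pi, Pi pi -> psd_map pi) (hPic : compact_maps Pi)
  (phipi : ('M[R]_r -> 'M[R]_r) -> R -> 'M[R]_r -> 'M[R]_r)
  (hphipi : forall pi, Pi pi -> is_flow (ricc_pi A S Rm pi) (phipi pi))
  (B0 B1 B2 : ('M[R]_r -> 'M[R]_r) -> 'M[R]_r)
  (Rem : ('M[R]_r -> 'M[R]_r) -> 'M[R]_r -> 'M[R]_r)
  (hQ : forall pi, Pi pi -> condQ S pi (B0 pi) (B1 pi) (B2 pi) (Rem pi))
  (hK : condK A Rm S Pi (fun pi => A + B1 pi)
          (fun pi => Rm + B0 pi + (rem_bound (Rem pi))%:M)
          (fun pi => S - B2 pi))
  (disp : measure_display) (T : measurableType disp) (P : probability T R)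
  (WV : R -> T -> 'cV[R]_(r + r'))
  (X : R -> T -> 'cV[R]_r) (Y : R -> T -> 'cV[R]_r')
  (hXY : signal_observation P A Rm C Sigma WV X Y)
  (pi : 'M[R]_r -> 'M[R]_r) (hpi : Pi pi)
  (x : 'cV[R]_r) (Q : 'M[R]_r) (hQ0 : psd Q)
  (s t : R) (hs : 0 <= s) (ht : s + ups <= t)
  (psi psipi : R -> T -> 'cV[R]_r)
  (hpsi0 : {ae P, forall w, psi s w = x})
  (hpsi : solves_filter P A C (fun u => phi (u - s) Q *m C^T *m invmx Sigma) s
            (fun _ _ => 0) Y psi)
  (hpsipi0 : {ae P, forall w, psipi s w = x})
  (hpsipi : solves_filter P A C
              (fun u => pi (phipi pi (u - s) Q) *m C^T *m invmx Sigma) s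
              (fun _ _ => 0) Y psipi)
  (eta etapi : T -> probability (bvec R r) R)
  (heta : kalman_bucy_law P A Rm C Sigma WV X Y
            (fun u => phi (u - s) Q) s t x Q eta)
  (hetapi : kalman_bucy_law P A Rm C Sigma WV X Y
            (fun u => pi (phipi pi (u - s) Q)) s t x Q etapi) :
  {ae P, forall w,
    (wasserstein 2 (etapi w) (eta w) ^+ 2 <=
      (norm2 (psipi t w - psi t w) ^+ 2
       + \tr (phipi pi (t - s) Q - phi (t - s) Q)
       + 4 * r%:R * (wcO + wo^-1) * (woC + wc^-1)
         * opnorm2 (phipi pi (t - s) Q - phi (t - s) Q))%:E)%E}
  /\
  forall n : nat, (1 <= n)%N ->
  {ae P, forall w,
    (wasserstein (2 * n) (eta w) (etapi w) <=
      (norm2 (psi t w - psipi t w)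
       + Num.sqrt (r%:R * n%:R / 2) * Num.sqrt (woC + wc^-1)
         * opnorm2 (phi (t - s) Q - phipi pi (t - s) Q)
         * expR (1 / 2 + 3 / (4 * n%:R)))%:E)%E}.
Proof.
(* [r] becomes a successor, so that the driving Brownian motion has a first coordinate to serve as
   reference Gaussian. *)
case: r hr A C Rm S hRm hS hctl hobs hgc hgo hgcO hgoC phi hphi Pi hPi hPic phipi hphipi B0 B1 B2 Rem hQ hK
  WV X hXY pi hpi x Q hQ0 psi psipi hpsi0 hpsi hpsipi0 hpsipi eta etapi heta hetapi => [//|r0].
move=> _ A C Rm S hRm hS _ _ hgc _ _ hgoC phi hphi Pi hPi _ phipi hphipi _ _ _ _ _ _
  WV X hXY pi hpi x Q hQ0 psi psipi hpsi0 hpsi hpsipi0 hpsipi eta etapi heta hetapi.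
have st : s < t by rewrite (lt_le_trans _ ht)// ltrDl.
have ts0 : 0 <= t - s by rewrite subr_ge0 ltW.
have ut : ups <= t - s by rewrite lerBrDl.
have pS : psd S.
  by rewrite hS; apply: conj_psd; exact: invmx_psd.
have pR := posdef_psd hRm.
have [ppi cpi] := hPi pi hpi.
have hf := (hphi.1 Q hQ0); have hg := ((hphipi pi hpi).1 Q hQ0).
have [f0 pf _ _] := hf; have [g0 pg _ _] := hg.
have hB : brownian P WV by case: hXY.
(* The flows start at time 0, the filters at time [s]; continuity and derivatives are transported by
   the shift [u - s]. *)
have shift (h : R -> 'M[R]_r0.+1) : mxcont 0 (t - s) h -> mxcont s t (fun u => h (u - s)).
  move=> ch; have := @mxcont_translate _ _ _ h 0 (t - s) (- s) ch.
  rewrite sub0r opprK subrK; congr mxcont.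
  by apply/funext => u; rewrite addrC.
have shiftd (h : R -> 'M[R]_r0.+1) F u : s < u -> (forall v, 0 < v -> mxder h v (F (h v))) ->
    mxder (fun u => h (u - s)) u (F (h (u - s))).
  move=> su dh; have := @mxder_shift _ _ _ h (- s) u (F (h (u - s))).
  rewrite addrC; have u0 : 0 < u - s by rewrite subr_gt0.
  move=> /(_ (dh _ u0)); apply: mxder_congr => // v; by rewrite addrC.
have us0 u : s < u < t -> 0 <= u - s by move=> /andP[su _]; rewrite subr_ge0 ltW.
have cf : mxcont 0 (t - s) (phi^~ Q) := ode_sol_mxcont (lexx 0) hf.
have cg : mxcont 0 (t - s) (phipi pi ^~ Q) := ode_sol_mxcont (lexx 0) hg.
have cgain : mxcont 0 (t - s) (fun u => pi (phipi pi u Q)) := mxcont_gain (lexx 0) (hPi pi hpi) hg.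
have fs : phi (s - s) Q = Q by rewrite subrr.
have gs : phipi pi (s - s) Q = Q by rewrite subrr.
(* Gain and covariance are the same path here, and the Lyapunov equation of the gap is then the
   Riccati equation. *)
have law1 := @kalman_bucy_gaussian R disp T P r0 r' A Rm C Sigma WV X Y hRm hSigma hXY
  (fun u => phi (u - s) Q) s t x Q eta psi (fun u => phi (u - s) Q) hs st hpsi0 hpsi heta
  (shift (phi^~ Q) cf) (fun u su => (pf _ (us0 u su)).1) (shift (phi^~ Q) cf) fs (pf _ ts0).
(* The gain is now [pi] of the covariance, and the Lyapunov equation of the gap is the equation of
   the flow [phipi pi]. *)
have law2 := @kalman_bucy_gaussian R disp T P r0 r' A Rm C Sigma WV X Y hRm hSigma hXY
  (fun u => pi (phipi pi (u - s) Q)) s t x Q etapi psipi (fun u => phipi pi (u - s) Q) hs st hpsipi0 hpsipi hetapi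
  (shift (fun u => pi (phipi pi u Q)) cgain) (fun u su => (ppi _ (pg _ (us0 u su))).1) (shift (phipi pi ^~ Q) cg) gs (pg _ ts0).
have {}law1 : {ae P, forall w, forall U : set (bvec R r0.+1), measurable U ->
  eta w U = P [set w' | U (psi t w + sqrtmx (phi (t - s) Q) *m gauss_step WV 0 w')]}.
  apply: law1 => u su; rewrite -hS -ricc_lyapunov//; last by case: (pf _ (us0 u su)).
  have /andP[su' _] := su.
  by apply: (shiftd (phi^~ Q)) => // v v0; exact: ode_sol_mxder hf.
have {}law2 : {ae P, forall w, forall U : set (bvec R r0.+1), measurable U ->
  etapi w U = P [set w' | U (psipi t w + sqrtmx (phipi pi (t - s) Q) *m gauss_step WV 0 w')]}.
  apply: law2 => u su; rewrite -hS -ricc_pi_lyapunov.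
  have /andP[su' _] := su.
  by apply: (shiftd (phipi pi ^~ Q)) => // v v0; exact: ode_sol_mxder hg.
set M := phi (t - s) Q in law1 *; set N := phipi pi (t - s) Q in law2 *.
have pM : psd M := pf _ ts0; have pN : psd N := pg _ ts0.
have pD : psd (N - M) := psd_comparison pS ppi ts0 hf hg.
have NE : M + (N - M) = N by rewrite addrC subrK.
split.
  apply: filterS2 law1 law2 => w h1 h2.
  rewrite -NE in h2.
  apply: le_trans (wasserstein2_gaussian hB pM pD h2 h1) _.
  rewrite lee_fin lerDl mulr_ge0 ?opnorm2_ge0// mulr_ge0 ?addr_ge0 ?invr_ge0 ?(ltW hwoC) ?(ltW hwc)//.
  by rewrite mulr_ge0 ?addr_ge0 ?invr_ge0 ?(ltW hwo) ?(ltW hwcO)// mulr_ge0.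
move=> n n1.
have lM : ((woC + wc^-1)^-1)%:M <=L M.
  exact: (riccati_flow_lower_bound pS pR hups hwc hwoC hgc hgoC hf ut).
have lN : ((woC + wc^-1)^-1)%:M <=L N.
  by rewrite /loewner_le -NE -addrA addrCA; apply: psdD => //.
have b0 : 0 < woC + wc^-1 by rewrite addr_gt0// invr_gt0.
apply: filterS2 law1 law2 => w h1 h2.
exact: wasserstein_even_gaussian n1 b0 pM pN lM lN h1 h2.
Qed.
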